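(* Let $(a,b)=(a_n,b_n)$ be intervals with $-\infty\le a_n<b_n\le\infty$, and let $\alpha_n=\sqrt n\,\alpha(a,b)$. If either $\alpha_n\le0$ for all $n$, or $\alpha_n>0$ for all $n$ and $\sum_{n=1}^\infty\alpha_n^{-k}<\infty$ for some positive constant $k$, then $$\frac{N_n(a,b)}{\mathbb E[N_n(a,b)]}\xrightarrow{a.s.}1\quad\text{as }n\to\infty.$$
   Context: $P_n(x)=\sum_{j=0}^n\omega_j\sqrt{\binom nj}\,x^j$, $n\ge 1$, with $\omega_j$ i.i.d. standard real Gaussian random variables, all defined on a common probability space. $N_n(a,b)$ is the number of real zeros of $P_n$ in $(a,b)$. $\alpha(a,b)=\frac{b-a}{1+ab}$, understood in the extended sense: $\alpha(a,b)=+\infty$ if $ab=-1$; $\alpha(a,\infty)=1/a$ for finite $a\neq0$; $\alpha(-\infty,b)=-1/b$ for finite $b\neq0$; $\alpha(0,\infty)=\alpha(-\infty,0)=+\infty$; $\alpha(-\infty,\infty)=0$. When $\alpha_n=+\infty$, $\alpha_n^{-k}=0$. *)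

(* Defs.v *)
From HB Require Import structures.
From mathcomp Require Export all_boot all_order all_algebra.
From mathcomp Require Export finmap.
From mathcomp Require Export all_classical all_reals all_analysis.
Export Order.TTheory GRing.Theory Num.Theory.
Export numFieldNormedType.Exports.

Set Implicit Arguments.
Unset Strict Implicit.
Unset Printing Implicit Defensive.

Local Open Scope classical_set_scope.
Local Open Scope ring_scope.

Definition mutually_independent (d : measure_display) (T : measurableType d)
    (R : realType) (P : probability T R) (I : choiceType)
    (X : I -> {RV P >-> R}) : Prop :=
  forall (J : {fset I}) (A : I -> set R),
    (forall i, measurable (A i)) ->
    P (\bigcap_(i in [set` J]) (X i @^-1` A i)) =
    (\prod_(i <- J) P (X i @^-1` A i))%E.

Definition iid_standard_normal (d : measure_display) (T : measurableType d)
    (R : realType) (P : probability T R) (X : nat -> {RV P >-> R}) : Prop :=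
  mutually_independent X /\
  forall j (A : set R), measurable A ->
    distribution P (X j) A = normal_prob 0 1 A.

Definition elliptic_poly (R : realType) (c : nat -> R) (n : nat) : {poly R} :=
  \poly_(j < n.+1) (c j * Num.sqrt ('C(n, j)%:R)).

(* Number of distinct zeros in the open interval (a, b).  The zero polynomial,
   the only one with infinitely many zeros, is given the value 0 when a < b,
   since fset_set of an infinite set is empty. *)
Definition nb_real_zeros (R : realType) (p : {poly R}) (a b : \bar R) : nat :=
  #|` fset_set [set x : R | (a < x%:E < b)%E /\ root p x] |.

(* Only meaningful for a < b; the final branch collects pairs with
   a = +oo or b = -oo. *)
Definition alpha (R : realType) (a b : \bar R) : \bar R :=
  match a, b with
  | a'%:E, b'%:E =>
      if a' * b' == -1 then +oo%E else ((b' - a') / (1 + a' * b'))%:E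
  | a'%:E, +oo%E => if a' == 0 then +oo%E else (a'^-1)%:E
  | -oo%E, b'%:E => if b' == 0 then +oo%E else (- b'^-1)%:E
  | -oo%E, +oo%E => 0%E
  | _, _ => 0%E
  end.

Definition alpha_seq (R : realType) (a b : nat -> \bar R) (n : nat) : \bar R :=
  ((Num.sqrt (n%:R : R))%:E * alpha (a n) (b n))%E.

(* x ^ (- k) for 0 < x <= +oo and 0 < k, with (+oo) ^ (- k) = 0
   (poweR would give +oo `^ (- k) = +oo). *)
Definition inv_power (R : realType) (x : \bar R) (k : R) : \bar R :=
  if x is r%:E then (r `^ (- k))%:E else 0%E.

(* Main.v *)
Require Import Defs.
From mathcomp Require Import ring lra zify measurable_realfun.

(* Put x = tan t.  Then f(t) = cos^n t P_n(tan t) = \sum_k omega_k phi_k(t), with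
   phi_k(t) = sqrt 'C(n, k) sin^k t cos^(n - k) t, has covariance cos^n (s - t),
   so that the zeros in (a, b) are those of a stationary Gaussian process with
   correlation length n^(-1/2) on an interval of angles of length Theta, where
   tan Theta = alpha (a, b).  A translation of t acts on the coefficients by an
   orthogonal matrix, which preserves the i.i.d. normal law.

   Cut the angles into four quarters, each quarter into r^4 cells of length about
   n^(-1/2), where r^4 is about n^(1/2) Theta, and each cell into 2^r fine cells.
   Outside an event of probability O(r^6 2^-r) no fine cell has two zeros, f is
   at least 4^-r on the grid, and in each cell f can be replaced by a sum over a
   window of indices without changing its signs on the grid.  The windows of
   cells at distance at least r are disjoint, hence the capped numbers of sign
   changes in such cells are independent, and Chernoff's bound applied to the r
   residue classes of cells shows that the number N_n of zeros deviates from its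
   mean by more than e r^4 with probability at most C exp (- c r).  Each cell
   contains a sign change with probability bounded below, so the mean is at least
   of order r^4.  Finally exp (- c r) is smaller than any power of
   n^(1/2) Theta, and the hypothesis on alpha makes one of these powers summable,
   so that the Borel-Cantelli lemma applies. *)

Set Implicit Arguments.
Unset Strict Implicit.
Unset Printing Implicit Defensive.

Local Open Scope classical_set_scope.
Local Open Scope ring_scope.

(** * Standard Gaussian measure *)

(** The number of cells is dictated by Chernoff's bound. Windows become disjoint only at index
    distance r, which leaves r classes of independent counts, each capped at r. For r^j such counts
    a deviation e r^j has an exponent of order (e r^j)^2 / (r^j r^2) = e^2 r^(j - 2), and j = 3 is
    the least integer for which it grows: hence r^4 cells. The rotation has a second use: it brings
    every cell to the origin, where f is cos^n times a polynomial in tan with independent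
    coefficients of factorial decay. Zeros are then counted by algebra, by dividing out linear
    factors: m zeros force the constant coefficient, a standard normal variable, below a quantity of
    order 4^-m, and two zeros in a fine cell force two independent coefficients to be small. The
    values of alpha separate two regimes. For Theta <= pi / 4, alpha is tan Theta, positive and
    comparable to Theta; an alpha that is infinite or at most 0 occurs only for Theta > pi / 4,
    where a power of n alone makes the probabilities summable. *)

Section Lebesgue_affine.
Variable R : realType.
Local Notation mu := (@lebesgue_measure R).
Local Open Scope ereal_scope.

Let aff (c e : R) (x : measurableTypeR R) : measurableTypeR R := (c * x + e)%R.

Let measurable_aff c e : measurable_fun setT (aff c e).
Proof. rewrite /aff/=; by apply: measurable_funD => //; apply: measurable_funM. Qed.

(** Uniqueness of Lebesgue measure: the rescaled image measure gives b - a to each half-open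
    interval. A negative c moves the closed end to the other side, which keeps the length. *)
Lemma lebesgue_measure_affine (c e : R) (A : set R) : c != 0%R -> measurable A ->
  mu ((fun x => (c * x + e)%R) @^-1` A) = (`|c|^-1)%:E * mu A.
Proof.
move=> c0 mA.
have k0 : (0 <= `|c|)%R by [].
pose m' : {measure set (measurableTypeR R) -> \bar R} :=
  mscale (NngNum k0) (pushforward mu (aff c e)).
have E : forall A, measurable A -> mu A = m' (measurable_aff c e) A.
  apply: lebesgue_measure_unique => X [[a b] /= ab <-].
  rewrite /m' /= /mscale /= /pushforward.
  have -> : aff c e @^-1` `]a, b]%classic =
    if (0 < c)%R then `]((a - e) / c)%R, ((b - e) / c)%R]%classic
    else `[((b - e) / c)%R, ((a - e) / c)%R[%classic.
    have H (x : R) : (a < c * x + e <= b)%R = if (0 < c)%R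
        then ((a - e) / c < x <= (b - e) / c)%R
        else ((b - e) / c <= x < (a - e) / c)%R.
      case: (ltP 0%R c) => [cp|cn].
        by rewrite ltr_pdivrMr// ler_pdivlMr// ltrBlDr lerBrDr [(x * c)%R]mulrC.
      have {}cn : (c < 0)%R by rewrite lt_neqAle c0.
      rewrite ltr_ndivlMr// ler_ndivrMr// ltrBlDr lerBrDr [(x * c)%R]mulrC.
      by rewrite andbC.
    apply/seteqP; split => x; move: (H x); rewrite /aff; case: ifP => _ h.
    - by rewrite /= !in_itv/= -h.
    - by rewrite /= !in_itv/= -h.
    - by rewrite /= !in_itv/= -h.
    - by rewrite /= !in_itv/= -h.
  case: ltP => [cp|cn].
    rewrite !lebesgue_measure_itv /= !lte_fin.
    rewrite ltr_pM2r ?invr_gt0// ltrBlDr subrK.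
    case: ifP => // _; last by rewrite mule0.
    rewrite -!EFinD -EFinM gtr0_norm//; congr EFin; field; exact: c0.
  have {}cn : (c < 0)%R by rewrite lt_neqAle c0.
  rewrite !lebesgue_measure_itv /= !lte_fin.
  rewrite ltr_nM2r ?invr_lt0// ltrBlDr subrK.
  case: ifP => // _; last by rewrite mule0.
  rewrite -!EFinD -EFinM ltr0_norm//; congr EFin; field; exact: c0.
rewrite (E _ mA) /m' /= /mscale /= muleA -EFinM mulVf ?mul1e//.
by rewrite normr_eq0.
Qed.

Lemma ge0_integral_affine (c e : R) (F : R -> \bar R) : c != 0%R ->
  measurable_fun setT F -> (forall x, 0 <= F x) ->
  \int[mu]_x F (c * x + e)%R = (`|c|^-1)%:E * \int[mu]_x F x.
Proof.
move=> c0 mF F0.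
have k0 : (0 <= `|c|^-1)%R by rewrite invr_ge0.
rewrite -(@ge0_integral_mscale _ _ _ mu _ measurableT (NngNum k0))//.
have := @ge0_integral_pushforward _ _ _ _ _ _ (measurable_aff c e) mu setT F.
rewrite preimage_setT => <- //.
apply: eq_measure_integral => A mA _.
by rewrite /= /mscale /= -(@lebesgue_measure_affine c e _ c0 mA).
Qed.

End Lebesgue_affine.

(** * Small balls, tails and rotation invariance of the standard normal law *)

Section Normal.
Import HBNNSimple.
Variable R : realType.
Local Notation mu := (@lebesgue_measure R).
Local Notation gam := (@normal_prob R 0 1).
Local Notation pdf := (@normal_pdf R 0 1).

Lemma std_normal_pdfE x : pdf x = normal_peak 1 * expR (- (x ^+ 2) / 2).
Proof.
by rewrite normal_pdfE ?oner_neq0// /normal_fun subr0 expr1n.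
Qed.

Lemma normal_peak_le : normal_peak (1 : R) <= 2^-1.
Proof.
rewrite /normal_peak lef_pV2 ?posrE//; last first.
  by rewrite sqrtr_gt0 expr1n mul1r mulrn_wgt0// pi_gt0.
rewrite expr1n mul1r.
have -> : (2 : R) = Num.sqrt 4.
  by rewrite (_ : 4 = 2 ^+ 2) ?sqrtr_sqr ?ger0_norm//; ring.
rewrite ler_sqrt; last by rewrite mulrn_wge0// pi_ge0.
have := pi_ge2 R; lra.
Qed.

Lemma normal_prob_opp (A : set R) : measurable A ->
  gam (-%R @^-1` A) = gam A.
Proof.
move=> mA; have mmA : measurable (-%R @^-1` A).
  by rewrite -[X in measurable X]setTI; exact: oppr_measurable.
rewrite /normal_prob integral_mkcond [RHS]integral_mkcond.
have := @ge0_integral_affine R (-1) 0 ((fun x => (pdf x)%:E) \_ A).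
rewrite normrN1 invr1 mul1e => <-; last 3 first.
- by rewrite oppr_eq0 oner_neq0.
- apply/(measurable_restrictT _ mA) => //; apply/measurable_EFinP/measurable_funTS; exact: measurable_normal_pdf.
- by move=> x; apply: erestrict_ge0 => y _; rewrite lee_fin normal_pdf_ge0.
apply: eq_integral => x _; rewrite !patchE mulN1r addr0.
rewrite (_ : (x \in -%R @^-1` A) = (- x \in A)); last by apply/idP/idP; rewrite !inE.
by case: ifP => // _; rewrite !std_normal_pdfE sqrrN.
Qed.

(** The density is at most 1/2, so that no constant appears in front of t. *)
Lemma normal_small_ball (t : R) : 0 <= t -> (gam [set x | `|x| <= t]%R <= t%:E)%E.
Proof.
move=> t0.
have -> : [set x : R | `|x| <= t] = `[- t, t]%classic.
  by apply/seteqP; split => x /=; rewrite in_itv/= ler_norml.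
rewrite /normal_prob.
apply: (@le_trans _ _ (\int[mu]_(x in `[(- t)%R, t]) (2^-1)%:E)%E).
  apply: ge0_le_integral => //=.
  - by move=> x _; rewrite lee_fin normal_pdf_ge0.
  - by apply/measurable_EFinP/measurable_funTS; exact: measurable_normal_pdf.
  - move=> x _; rewrite lee_fin (le_trans _ normal_peak_le)// normal_pdf_ub//.
rewrite integral_cst//= lebesgue_measure_itv/= lte_fin.
case: ifP => [_|_]; last by rewrite mule0.
rewrite -EFinD -EFinM lee_fin; lra.
Qed.


(** From (x - 1)^2 >= 0. An exponential bound integrates in closed form and is strong enough for the
    union bounds over coefficients. *)
Lemma std_normal_pdf_le_expR (x : R) : pdf x <= 2^-1 * expR (2^-1 - x).
Proof.
rewrite std_normal_pdfE ler_pM ?normal_peak_ge0 ?expR_ge0 ?normal_peak_le//.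
by rewrite ler_expR; have := sqr_ge0 (x - 1); rewrite !expr2; lra.
Qed.

Lemma integral_expRN (a : R) :
  (\int[mu]_(x in `[a, +oo[) (expR (- x))%:E = (expR (- a))%:E)%E.
Proof.
rewrite (@ge0_continuous_FTC2y _ _ (fun x => - (expR (- x))) _ 0)//.
- by rewrite EFinN oppeK add0e.
- apply: continuous_subspaceT => x; apply: continuous_comp; last exact: continuous_expR.
  exact: opp_continuous.
- rewrite -oppr0; apply: cvgN; exact: cvgr_expR.
- apply: cvgN; apply/cvg_at_right_filter; apply: continuous_comp; last exact: continuous_expR.
  exact: opp_continuous.
- move=> z _.
  rewrite derive1E; apply: derive_val.
  apply: is_derive_eq; rewrite -?expRE /GRing.scale/=; ring.
Qed.

Lemma normal_tail (a : R) :
  (gam [set x | a < `|x|]%R <= (2 * expR (1 - a))%:E)%E.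
Proof.
have mT : measurable [set x : R | a < x].
  by rewrite -set_itvoy; exact: measurable_itv.
have mS : measurable (-%R @^-1` [set x : R | a < x]).
  by rewrite -[X in measurable X]setTI; exact: oppr_measurable.
have half : (gam [set x | a < x]%R <= (expR (1 - a))%:E)%E.
  rewrite /normal_prob.
  apply: (@le_trans _ _ (\int[mu]_(x in `[a, +oo[) ((2^-1 * expR 2^-1) * expR (- x))%:E)%E).
    apply: (@le_trans _ _ (\int[mu]_(x in `[a, +oo[) (pdf x)%:E)%E).
      apply: ge0_subset_integral => //=.
      - by apply/measurable_EFinP/measurable_funTS; exact: measurable_normal_pdf.
      - by move=> x _; rewrite lee_fin normal_pdf_ge0.
      - by move=> x /= ax; rewrite in_itv/= andbT ltW.
    apply: ge0_le_integral => //=.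
    - by move=> x _; rewrite lee_fin normal_pdf_ge0.
    - by apply/measurable_EFinP/measurable_funTS; exact: measurable_normal_pdf.
    - apply/measurable_EFinP/measurable_funTS; apply: measurable_funM => //.
      exact: measurableT_comp.
    - move=> x _; rewrite lee_fin -mulrA -expRD.
      exact: std_normal_pdf_le_expR.
  under eq_integral do rewrite EFinM.
  rewrite ge0_integralZl//=; last first.
    by apply/measurable_EFinP/measurable_funTS; exact: measurableT_comp.
  rewrite integral_expRN -EFinM lee_fin -mulrA -expRD.
  rewrite -[leRHS]mul1r ler_pM ?expR_ge0 ?ler_expR ?invr_ge0//; lra.
apply: (@le_trans _ _ (gam ([set x | a < x] `|` (-%R @^-1` [set x : R | a < x])))%R).
  apply: le_measure; rewrite ?inE; [|exact: measurableU|].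
    rewrite (_ : [set x : R | a < `|x|] = (fun x : R => `|x|) @^-1` [set x : R | a < x])//.
    by rewrite -[X in measurable X]setTI; exact: (@normr_measurable R).
  move=> x /=; rewrite ltr_normr => /orP[?|?]; [by left|by right].
apply: (le_trans (measureU2 _ _ _)) => //.
rewrite (_ : 2 * _ = expR (1 - a) + expR (1 - a)); last by ring.
by rewrite EFinD leeD//; have := normal_prob_opp mT => /= ->.
Qed.

Lemma normal_prob_itv_gt0 (a b : R) : a < b -> (0 < gam `]a, b[%classic)%E.
Proof.
move=> ab; pose M := Num.max `|a| `|b|; pose k := normal_peak (1 : R) * expR (- (M ^+ 2) / 2).
have k0 : 0 < k by rewrite mulr_gt0 ?expR_gt0 ?normal_peak_gt0 ?oner_neq0.
rewrite /normal_prob.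
apply: (@lt_le_trans _ _ (\int[mu]_(x in `]a, b[) k%:E)%E).
  rewrite integral_cst//= lebesgue_measure_itv/= lte_fin ab -EFinD -EFinM lte_fin.
  by rewrite mulr_gt0// subr_gt0.
apply: ge0_le_integral => //=.
- by move=> x _; rewrite lee_fin ltW.
- by apply/measurable_EFinP/measurable_funTS; exact: measurable_normal_pdf.
move=> x; rewrite in_itv/= => /andP[ax xb]; rewrite lee_fin std_normal_pdfE.
rewrite ler_pM2l ?normal_peak_gt0 ?oner_neq0// ler_expR ler_pM2r ?invr_gt0// lerN2.
have xM : `|x| <= M.
  rewrite /M le_max; have [h|h] := leP 0 (x : R).
    by rewrite (ger0_norm h) (le_trans (ltW xb) (ler_norm b)) orbT.
  rewrite (ltr0_norm h); apply/orP; left; apply: (@le_trans _ _ (- a)).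
    by rewrite lerN2 ltW.
  by rewrite -normrN ler_norm.
by rewrite -(real_normK (num_real x)) lerXn2r// nnegrE// (le_trans _ xM).
Qed.


Lemma normal_prob_integral (A : set R) : measurable A ->
  gam A = (\int[mu]_x ((\1_A x * pdf x)%:E))%E.
Proof.
move=> mA; rewrite /normal_prob integral_mkcond; apply: eq_integral => x _.
by rewrite patchE indicE; case: ifP => _; rewrite ?mul1r ?mul0r.
Qed.

(** [normal_prob] is given by its values on sets; the density formula passes from indicators to
    simple functions, then to nonnegative functions by monotone convergence on both sides. *)
Lemma ge0_integral_normal_prob (f : R -> \bar R) : measurable_fun setT f ->
  (forall x, 0 <= f x)%E ->
  (\int[gam]_x f x = \int[mu]_x (f x * (pdf x)%:E))%E.
Proof.
move=> mf f0; pose h := nnsfun_approx measurableT mf.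
have mpdf : measurable_fun [set: R] (EFin \o pdf).
  by apply/measurable_EFinP; exact: measurable_normal_pdf.
have p0 x : (0 <= (pdf x)%:E)%E by rewrite lee_fin normal_pdf_ge0.
have hm n : measurable_fun [set: R] (fun x : R => (h n x)%:E).
  by apply/measurable_EFinP; exact: measurable_funP.
have hnd (x : R) m n : (m <= n)%N -> h m x <= h n x.
  by move=> mn; exact/lefP/nd_nnsfun_approx.
have h0 n (x : R) : (0 <= (h n x)%:E)%E by rewrite lee_fin.
transitivity (lim (\int[gam]_x (h n x)%:E @[n --> \oo])%E).
  rewrite -monotone_convergence//=.
    apply: eq_integral => x /[!inE] xD; apply/esym/cvg_lim => //=.
    exact: cvg_nnsfun_approx.
  by move=> x _ m n mn; rewrite lee_fin; exact: hnd.
transitivity (lim (\int[mu]_x ((h n x)%:E * (pdf x)%:E)%E @[n --> \oo])%E); last first.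
  rewrite -monotone_convergence//=.
  - apply: eq_integral => x /[!inE] xD; apply/cvg_lim => //=.
    by apply: cvgeZr => //; exact: cvg_nnsfun_approx.
  - by move=> n; apply: emeasurable_funM => //; exact: hm.
  - by move=> n x _; rewrite mule_ge0// h0.
  - move=> x _ m n mn; rewrite lee_wpmul2r// lee_fin; exact: hnd.
apply: congr_lim; apply/funext => n.
transitivity (\int[gam]_x (\sum_(y \in range (h n)) (y * \1_(h n @^-1` [set y]) x)%:E))%E.
  by apply: eq_integral => t tE; rewrite /= fimfunE -fsumEFin.
have indich r : measurable_fun [set: R] (fun x => (r * \1_(h n @^-1` [set r]) x)%:E).
  by apply: (measurable_comp measurableT) => //; exact: measurable_funM.
rewrite ge0_integral_fsum//; last by move=> m y Ey; exact: nnfun_muleindic_ge0.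
transitivity (\int[mu]_x (\sum_(y \in range (h n))
    (y * \1_(h n @^-1` [set y]) x)%:E * (pdf x)%:E))%E; last first.
  apply: eq_integral => x xE.
  rewrite -ge0_mule_fsuml => [|y]; last exact: nnfun_muleindic_ge0.
  congr (_ * _)%E; apply/esym.
  by rewrite [in LHS](fimfunE _ (x : R)) -fsumEFin.
rewrite ge0_integral_fsum//; last 2 first.
  - by move=> y; exact: (emeasurable_funM (indich y) mpdf).
  - by move=> m y Ey; rewrite mule_ge0// nnfun_muleindic_ge0.
apply: eq_fsbigr => r rhn.
have mA : measurable (h n @^-1` [set r]) by [].
have [r0|r0] := leP 0 r; last first.
  have -> : h n @^-1` [set r] = set0.
    by apply/seteqP; split => // x /= hx; have := h0 n x; rewrite lee_fin hx leNgt r0.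
  by rewrite !integral0_eq// => x _; rewrite indic0 mulr0 ?mul0e.
have mI : measurable_fun [set: R] (fun x : R => (\1_(h n @^-1` [set r]) x)%:E : \bar R).
  by apply/measurable_EFinP; exact: measurable_indic.
under eq_integral do rewrite EFinM.
rewrite ge0_integralZl//=.
under [RHS]eq_integral do rewrite EFinM -muleA.
rewrite [RHS]ge0_integralZl//=; [|exact: (emeasurable_funM mI mpdf)|by move=> x _; rewrite mule_ge0// lee_fin].
congr (_ * _)%E; transitivity (gam (h n @^-1` [set r])).
  by rewrite integral_indic// setIT.
by rewrite normal_prob_integral//; apply: eq_integral => x _; rewrite EFinM.
Qed.

Let measurable_ind_pdf (A : set R) : measurable A ->
  measurable_fun [set: R] (fun x => \1_A x * pdf x).
Proof.
by move=> mA; apply: measurable_funM; [exact: measurable_indic|exact: measurable_normal_pdf].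
Qed.

Let rot (c s : R) (xy : R * R) : R * R :=
  (c * xy.1 + s * xy.2, - s * xy.1 + c * xy.2).

Lemma measurable_rot c s : measurable_fun [set: R * R] (rot c s).
Proof.
apply/measurable_fun_pairP; split => /=.
- by apply: measurable_funD; apply: measurable_funM.
- by apply: measurable_funD; apply: measurable_funM.
Qed.

(** Two shears replace a change of variables in the plane: by Tonelli, u = c x + s y is substituted
    at fixed y, where - s x + c y becomes y / c - (s / c) u, and this last quantity at fixed u. The
    factors 1 / |c| and |c| cancel. For c = 0 the rotation exchanges the coordinates up to sign. *)
Lemma lebesgue_rot (c s : R) (g h : R -> R) : c ^+ 2 + s ^+ 2 = 1 ->
  measurable_fun setT g -> measurable_fun setT h ->
  (forall x, 0 <= g x) -> (forall x, 0 <= h x) ->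
  (\int[mu]_x \int[mu]_y (g (c * x + s * y) * h (- s * x + c * y))%:E =
   (\int[mu]_x (g x)%:E) * (\int[mu]_x (h x)%:E))%E.
Proof.
move=> cs mg mh g0 h0.
have mgE : measurable_fun setT (EFin \o g) by exact/measurable_EFinP.
have mhE : measurable_fun setT (EFin \o h) by exact/measurable_EFinP.
have Ig0 : (0 <= \int[mu]_x (g x)%:E)%E by apply: integral_ge0 => x _; rewrite lee_fin.
have Ih0 : (0 <= \int[mu]_x (h x)%:E)%E by apply: integral_ge0 => x _; rewrite lee_fin.
have Iaff (k e : R) (F : R -> R) : k != 0 -> measurable_fun setT F -> (forall x, 0 <= F x) ->
    (\int[mu]_x (F (k * x + e))%:E = (`|k|^-1)%:E * \int[mu]_x (F x)%:E)%E.
  move=> k0 mF F0; apply: (@ge0_integral_affine R k e (EFin \o F)) => //.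
  exact/measurable_EFinP.
have [c0|c0] := eqVneq c 0.
  have s0 : s != 0.
    by apply: contra_eq_neq cs => ->; rewrite c0 !expr0n addr0 eq_sym oner_neq0.
  have s1 : `|s|^-1 = 1.
    apply/eqP; rewrite invr_eq1 -(@eqrXn2 _ 2)// expr1n real_normK ?num_real//.
    by move: cs; rewrite c0 expr0n add0r => ->.
  transitivity (\int[mu]_x ((h (- s * x + 0))%:E * \int[mu]_y (g y)%:E))%E.
    apply: eq_integral => x _.
    transitivity (\int[mu]_y ((h (- s * x + 0))%:E * (g (s * y + 0))%:E))%E.
      by apply: eq_integral => y _; rewrite c0 !mul0r add0r !addr0 mulrC EFinM.
    rewrite ge0_integralZl//=; last 3 first.
    - apply/measurable_EFinP; apply: measurableT_comp => //.
      by apply: measurable_funD => //; exact: measurable_funM.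
    - by move=> y _; rewrite lee_fin.
    - by rewrite lee_fin.
    by rewrite Iaff// s1 mul1e.
  rewrite ge0_integralZr//=; last 2 first.
  - apply/measurable_EFinP; apply: measurableT_comp => //.
    by apply: measurable_funD => //; exact: measurable_funM.
  - by move=> y _; rewrite lee_fin.
  by rewrite Iaff ?oppr_eq0// normrN s1 mul1e muleC.
have mlin1 (a b : R) : measurable_fun [set: R * R] (fun z : R * R => a * z.1 + b * z.2).
  by apply: measurable_funD; apply: measurable_funM.
rewrite (@fubini_tonelli _ _ _ _ _ mu mu (fun z => (g (c * z.1 + s * z.2) * h (- s * z.1 + c * z.2))%:E))/=; last 2 first.
- by apply/measurable_EFinP; apply: measurable_funM; [apply: (measurableT_comp mg (mlin1 c s))|apply: (measurableT_comp mh (mlin1 (- s) c))].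
- by move=> z; rewrite lee_fin mulr_ge0.
transitivity (\int[mu]_y ((`|c|^-1)%:E * \int[mu]_u (g u * h (c^-1 * y + - s / c * u))%:E))%E.
  apply: eq_integral => y _.
  rewrite -(@Iaff c (s * y) (fun u => g u * h (c^-1 * y + - s / c * u)))//.
  - apply: eq_integral => x _; congr (g _ * h _)%:E.
    have -> : c^-1 * y = c^-1 * (c ^+ 2 + s ^+ 2) * y by rewrite cs mulr1.
    by field.
  - apply: measurable_funM => //; apply: measurableT_comp => //.
    by apply: measurable_funD => //; exact: measurable_funM.
  - by move=> u; rewrite mulr_ge0.
have mF : measurable_fun [set: R * R] (fun z : R * R => (g z.2 * h (c^-1 * z.1 + - s / c * z.2))%:E).
  by apply/measurable_EFinP; apply: measurable_funM; exact: measurableT_comp.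
have F0 (z : R * R) : (0 <= (g z.2 * h (c^-1 * z.1 + - s / c * z.2))%:E)%E.
  by rewrite lee_fin mulr_ge0.
rewrite ge0_integralZl//=; last 2 first.
- exact: (@measurable_fun_fubini_tonelli_F _ _ _ _ _ mu _ mF).
- by move=> y _; apply: integral_ge0 => u _; rewrite lee_fin mulr_ge0.
rewrite (@fubini_tonelli _ _ _ _ _ mu mu (fun z => (g z.2 * h (c^-1 * z.1 + - s / c * z.2))%:E))//=.
transitivity ((`|c|^-1)%:E * \int[mu]_u ((g u)%:E * (`|c|%:E * \int[mu]_x (h x)%:E)))%E.
  congr (_ * _)%E; apply: eq_integral => u _.
  under eq_integral do rewrite EFinM.
  rewrite ge0_integralZl//=; last 3 first.
  - apply/measurable_EFinP; apply: measurableT_comp => //.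
    by apply: measurable_funD => //; exact: measurable_funM.
  - by move=> y _; rewrite lee_fin.
  - by rewrite lee_fin.
  by rewrite Iaff ?invr_eq0// normfV invrK.
rewrite ge0_integralZr//=; last 2 first.
- by move=> x _; rewrite lee_fin.
- by rewrite mule_ge0// lee_fin.
rewrite muleCA !muleA -[X in (X * _)%E]muleA -EFinM mulVf ?normr_eq0// mule1.
by [].
Qed.

(** The product density depends on x^2 + y^2 only, so it can be written in the rotated coordinates,
    and each factor is an indicator times a density. *)
Lemma normal_prob_rot (c s : R) (A B : set R) : c ^+ 2 + s ^+ 2 = 1 ->
  measurable A -> measurable B ->
  (gam \x gam)%E [set z | A (c * z.1 + s * z.2) /\ B (- s * z.1 + c * z.2)] = (gam A * gam B)%E.
Proof.
move=> cs mA mB.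
set Z := [set z | _].
have mZ : measurable Z.
  have := measurable_rot c s measurableT (measurableX mA mB).
  by rewrite setTI.
rewrite /product_measure1/=.
transitivity (\int[gam]_x (\int[mu]_y ((\1_Z (x, y) * pdf y)%:E)))%E.
  apply: eq_integral => x _.
  rewrite /= normal_prob_integral; last exact: measurable_xsection.
  apply: eq_integral => y _.
  by congr (_ * _)%:E; rewrite !indicE mem_xsection.
have mI : measurable_fun [set: R * R] (fun z => (\1_Z z * pdf z.2)%:E).
  apply/measurable_EFinP; apply: measurable_funM; first exact: measurable_indic.
  by apply: measurableT_comp => //; exact: measurable_normal_pdf.
have I0 z : (0 <= (\1_Z z * pdf z.2)%:E :> \bar R)%E.
  by rewrite lee_fin mulr_ge0 ?normal_pdf_ge0.
rewrite ge0_integral_normal_prob; last 2 first.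
- exact: (@measurable_fun_fubini_tonelli_F _ _ _ _ _ mu _ mI).
- by move=> x; apply: integral_ge0 => y _; exact: (I0 (x, y)).
transitivity (\int[mu]_x \int[mu]_y
   ((\1_A (c * x + s * y) * pdf (c * x + s * y)) *
    (\1_B (- s * x + c * y) * pdf (- s * x + c * y)))%:E)%E.
  apply: eq_integral => x _; rewrite -ge0_integralZr//=; last 2 first.
  - exact: (measurableT_comp mI (pair1_measurable x)).
  - by rewrite lee_fin normal_pdf_ge0.
  apply: eq_integral => y _; rewrite -EFinM; congr EFin.
  have -> : \1_Z (x, y) = \1_A (c * x + s * y) * \1_B (- s * x + c * y) :> R.
    rewrite !indicE -natrM mulnb; congr (nat_of_bool _)%:R.
    by apply/idP/andP; rewrite !inE.
  have E : pdf (c * x + s * y) * pdf (- s * x + c * y) = pdf x * pdf y.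
    rewrite !std_normal_pdfE mulrACA [RHS]mulrACA -!expRD; congr (_ * expR _).
    rewrite -!mulrDl; congr (_ / _).
    have -> : - x ^+ 2 - y ^+ 2 = - ((c ^+ 2 + s ^+ 2) * (x ^+ 2 + y ^+ 2)).
      by rewrite cs mul1r opprD.
    by ring.
  by rewrite [RHS]mulrACA E [pdf x * _]mulrC mulrA.
rewrite (@lebesgue_rot c s (fun u => \1_A u * pdf u) (fun u => \1_B u * pdf u))//.
- by rewrite !normal_prob_integral.
- exact: measurable_ind_pdf.
- exact: measurable_ind_pdf.
- by move=> x; rewrite mulr_ge0 ?normal_pdf_ge0.
- by move=> x; rewrite mulr_ge0 ?normal_pdf_ge0.
Qed.
End Normal.

(** * Gaussian families: rotation invariance and independence of blocks *)

Section Real_probability.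
Context d (T : measurableType d) (R : realType) (P : probability T R).

Definition pr (A : set T) : R := fine (P A).

Lemma prE (A : set T) : measurable A -> P A = (pr A)%:E.
Proof. by move=> mA; rewrite /pr fineK// fin_num_measure. Qed.

Lemma pr_ge0 (A : set T) : 0 <= pr A.
Proof. by rewrite fine_ge0. Qed.

Lemma pr_le (A B : set T) : measurable A -> measurable B -> A `<=` B -> pr A <= pr B.
Proof.
by move=> mA mB AB; rewrite -lee_fin -!prE//; apply: le_measure; rewrite ?inE.
Qed.

Lemma pr_le1 (A : set T) : measurable A -> pr A <= 1.
Proof. by move=> mA; rewrite -lee_fin -prE// probability_le1. Qed.

Lemma prC (A : set T) : measurable A -> pr (~` A) = 1 - pr A.
Proof.
move=> mA; apply: EFin_inj; rewrite -prE; last exact: measurableC.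
by rewrite probability_setC// prE.
Qed.

Lemma prU (A B : set T) : measurable A -> measurable B -> pr (A `|` B) <= pr A + pr B.
Proof.
move=> mA mB; rewrite -lee_fin -prE ?EFinD -?prE//; last exact: measurableU.
exact: measureU2.
Qed.

Lemma measurable_exists (I : finType) (F : I -> set T) :
  (forall i, measurable (F i)) -> measurable [set w | exists i, F i w].
Proof.
move=> mF; rewrite (_ : [set w | _] = \bigcup_(i in [set: I]) F i).
  by apply: fin_bigcup_measurable => // i _; exact: mF.
by apply/seteqP; split => w /= => [[i Fi]|[i _ Fi]]; exists i.
Qed.

Lemma measurable_forall (I : finType) (F : I -> set T) :
  (forall i, measurable (F i)) -> measurable [set w | forall i, F i w].
Proof.
move=> mF; rewrite (_ : [set w | _] = ~` [set w | exists i, (~` F i) w]).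
  by apply: measurableC; apply: measurable_exists => i; exact: measurableC.
apply/seteqP; split => w /= => [Fw [i]|h i]; first by apply; exact: Fw.
by apply: contrapT => nF; apply: h; exists i.
Qed.

Lemma pr_exists (I : finType) (F : I -> set T) :
  (forall i, measurable (F i)) -> pr [set w | exists i, F i w] <= \sum_i pr (F i).
Proof.
move=> mF; rewrite (_ : [set w | _] = \big[setU/set0]_(i <- enum I) F i); last first.
  apply/seteqP; split => w /=.
    by move=> [i Fi]; rewrite -bigcup_seq; exists i => //=; rewrite mem_enum.
  by rewrite -bigcup_seq => -[i _ Fi]; exists i.
rewrite -[leRHS](big_enum _ _ xpredT)/=.
elim: (enum I) => [|i s IHs].
  by rewrite !big_nil /pr measure0.
rewrite !big_cons (le_trans (prU _ _))//; first exact: bigsetU_measurable.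
by rewrite lerD2l.
Qed.

End Real_probability.

Section Gaussian_families.
Context d (T : measurableType d) (R : realType) (P : probability T R).
Local Notation gam := (@normal_prob R 0 1).

(** One product formula over all indices: sub-families follow by taking [setT] for the other
    sets. *)
Definition gauss_iid N (Y : 'I_N -> T -> R) : Prop :=
  (forall i, measurable_fun [set: T] (Y i)) /\
  forall A : 'I_N -> set R, (forall i, measurable (A i)) ->
    P [set w | forall i, A i (Y i w)] = (\prod_i gam (A i))%E.

Lemma measurable_fun_preimage (f : T -> R) (A : set R) :
  measurable_fun [set: T] f -> measurable A -> measurable [set w | A (f w)].
Proof. by move=> mf mA; have := mf measurableT _ mA; rewrite setTI. Qed.

Lemma measurable_sub_family N (Y : 'I_N -> T -> R) (J : {set 'I_N}) (A : 'I_N -> set R) :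
  (forall i, measurable_fun [set: T] (Y i)) -> (forall i, measurable (A i)) ->
  measurable [set w | forall i, i \in J -> A i (Y i w)].
Proof.
move=> mY mA; rewrite (_ : [set w | _] =
   [set w | forall i, [set w | A i (Y i w) \/ i \notin J] w]); last first.
  apply/seteqP; split => w /= h i.
    by case: (boolP (i \in J)) => [/h|]; [left|right].
  by move=> iJ; case: (h i) => //; rewrite iJ.
apply: measurable_forall => i; case: (boolP (i \in J)) => iJ.
  rewrite (_ : [set w | _] = [set w | A i (Y i w)]); first exact: measurable_fun_preimage.
  by apply/seteqP; split => w /=; [case|left].
have E : [set w | A i (Y i w) \/ ~~ false] = setT by apply/seteqP; split => w //= _; right.
by rewrite E; exact: measurableT.
Qed.

Lemma gauss_iid_sub N (Y : 'I_N -> T -> R) (J : {set 'I_N}) (A : 'I_N -> set R) :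
  gauss_iid Y -> (forall i, measurable (A i)) ->
  P [set w | forall i, i \in J -> A i (Y i w)] = (\prod_(i in J) gam (A i))%E.
Proof.
move=> [mY Yi] mA; pose B i := if i \in J then A i else [set: R].
have := Yi B; rewrite (_ : [set w | forall i, B i (Y i w)] =
    [set w | forall i, i \in J -> A i (Y i w)]); last first.
  apply/seteqP; split => w /= h i; first by move=> iJ; move: (h i); rewrite /B iJ.
  by rewrite /B; case: ifP => // /h.
move=> ->; last by move=> i; rewrite /B; case: ifP.
rewrite [RHS]big_mkcond; apply: eq_bigr => i _; rewrite /B; case: ifP => // _.
exact: probability_setT.
Qed.

Lemma gauss_iid1 N (Y : 'I_N -> T -> R) i (A : set R) : gauss_iid Y -> measurable A ->
  P [set w | A (Y i w)] = gam A.
Proof.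
move=> Yi mA; have := @gauss_iid_sub N Y [set i]%SET (fun=> A) Yi (fun=> mA).
rewrite big_set1 => <-; congr (P _); apply/seteqP; split => w /=.
  by move=> Aw k; rewrite inE => /eqP ->.
by move=> /(_ i); rewrite inE eqxx; exact.
Qed.

Lemma gauss_iid2 N (Y : 'I_N -> T -> R) i j (A B : set R) : gauss_iid Y -> i != j ->
  measurable A -> measurable B ->
  P [set w | A (Y i w) /\ B (Y j w)] = (gam A * gam B)%E.
Proof.
move=> Yi ij mA mB.
have := @gauss_iid_sub N Y [set i; j]%SET (fun k => if k == i then A else B) Yi.
rewrite big_setU1/= ?inE// big_set1 eqxx eq_sym (negbTE ij) => <-; last by move=> k; case: ifP.
congr (P _); apply/seteqP; split => w /=.
  by move=> [Aw Bw] k; rewrite !inE; case: eqP => [->//|_ /eqP ->].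
move=> h; split; first by have := h i; rewrite !inE eqxx; exact.
by have := h j; rewrite !inE eqxx orbT eq_sym (negbTE ij); exact.
Qed.

Definition act N (Q : 'M[R]_N) (Y : 'I_N -> T -> R) : 'I_N -> T -> R :=
  fun i w => \sum_j Q i j * Y j w.

Lemma measurable_act N (Q : 'M[R]_N) (Y : 'I_N -> T -> R) :
  (forall i, measurable_fun [set: T] (Y i)) -> forall i, measurable_fun [set: T] (act Q Y i).
Proof.
move=> mY i; rewrite /act.
by apply: measurable_sum => j; exact: measurable_funM.
Qed.

Lemma act_mul N (Q1 Q2 : 'M[R]_N) (Y : 'I_N -> T -> R) :
  act (Q1 *m Q2) Y = act Q1 (act Q2 Y).
Proof.
apply/funext => i; apply/funext => w; rewrite /act.
under [RHS]eq_bigr do rewrite big_distrr/=.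
rewrite exchange_big/=; apply: eq_bigr => j _.
rewrite mxE big_distrl/=; apply: eq_bigr => k _; by rewrite mulrA.
Qed.

Lemma act1 N (Y : 'I_N -> T -> R) : act 1%:M Y = Y.
Proof.
apply/funext => i; apply/funext => w; rewrite /act (bigD1 i)//= big1 ?addr0.
  by rewrite mxE eqxx mul1r.
by move=> j ji; rewrite mxE eq_sym (negbTE ji) mul0r.
Qed.

(** Stability under products reduces orthogonal matrices to rotations in coordinate planes and sign
    changes. *)
Definition gauss_inv N (Q : 'M[R]_N) := forall Y, gauss_iid Y -> gauss_iid (act Q Y).

Lemma gauss_inv_mul N (Q1 Q2 : 'M[R]_N) :
  gauss_inv Q1 -> gauss_inv Q2 -> gauss_inv (Q1 *m Q2).
Proof. by move=> h1 h2 Y Yi; rewrite act_mul; apply/h1/h2. Qed.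

Definition givens N (i j : 'I_N) (c s : R) : 'M[R]_N :=
  \matrix_(a, b) if a == i then c * (b == i)%:R + s * (b == j)%:R
    else if a == j then - s * (b == i)%:R + c * (b == j)%:R else (a == b)%:R.

Lemma sum_delta N (f : 'I_N -> R) i : \sum_l (l == i)%:R * f l = f i.
Proof.
rewrite (bigD1 i)//= eqxx mul1r big1 ?addr0// => l li.
by rewrite (negbTE li) mul0r.
Qed.

Lemma givensE N (i j a : 'I_N) (c s : R) (f : 'I_N -> R) :
  \sum_l givens i j c s a l * f l = if a == i then c * f i + s * f j
    else if a == j then - s * f i + c * f j else f a.
Proof.
have E (x y : R) : \sum_l (x * (l == i)%:R + y * (l == j)%:R) * f l = x * f i + y * f j.
  under eq_bigr do rewrite mulrDl -!mulrA.
  by rewrite big_split/= -!mulr_sumr !sum_delta.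
under eq_bigr do rewrite mxE.
case: eqP => [_|_]; first exact: E.
case: eqP => [_|_]; first exact: E.
by under eq_bigr do rewrite eq_sym; rewrite sum_delta.
Qed.

Lemma givens_orth N (i j : 'I_N) (c s : R) : i != j -> c ^+ 2 + s ^+ 2 = 1 ->
  givens i j c s *m (givens i j c s)^T = 1%:M.
Proof.
move=> ij cs; apply/matrixP => a b; rewrite !mxE.
under eq_bigr do rewrite [X in _ * X]mxE.
rewrite givensE !mxE !eqxx (eq_sym j i) (negbTE ij).
have t1 : (nat_of_bool true)%:R = 1 :> R by [].
have f0 : (nat_of_bool false)%:R = 0 :> R by [].
have [->|ai] := eqVneq a i.
  rewrite (eq_sym i b).
  have [bi|bi] := eqVneq b i; first by rewrite t1 f0 !mulr0 !mulr1 addr0 add0r -cs; ring.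
  by have [bj|bj] := eqVneq b j; rewrite ?t1 ?f0; ring.
have [->|aj] := eqVneq a j.
  rewrite (eq_sym j b).
  have [bi|bi] := eqVneq b i; first by rewrite bi (negbTE ij) t1 f0; ring.
  have [bj|bj] := eqVneq b j; first by rewrite t1 f0 !mulr0 !mulr1 addr0 add0r -cs; ring.
  by rewrite f0; ring.
have [->|bi] := eqVneq b i; first by rewrite ?(negbTE ai) ?(negbTE aj) f0; ring.
have [->|bj] := eqVneq b j; first by rewrite ?(negbTE ai) ?(negbTE aj) f0; ring.
by rewrite eq_sym.
Qed.

(** Only two coordinates move. Let E be the event that the others lie in their sets and q its
    probability: on E, the law of the pair (Y_i, Y_j) is q times the product of two normal laws, by
    uniqueness of product measures, and [normal_prob_rot] applies. *)
Lemma gauss_inv_givens N (i j : 'I_N) (c s : R) : i != j -> c ^+ 2 + s ^+ 2 = 1 ->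
  gauss_inv (givens i j c s).
Proof.
move=> ij cs Y Yi; have [mY _] := Yi; split; first exact: measurable_act.
move=> A mA.
have -> : [set w | forall k, A k (act (givens i j c s) Y k w)] =
   [set w | (A i (c * Y i w + s * Y j w) /\ A j (- s * Y i w + c * Y j w)) /\
      forall k, k \in ~: [set i; j]%SET -> A k (Y k w)].
  apply/seteqP; split => w /=; rewrite /act => h.
    split; first split.
    - by have := h i; rewrite givensE eqxx.
    - by have := h j; rewrite givensE eqxx eq_sym (negbTE ij).
    - move=> k; rewrite !inE negb_or => /andP[ki kj].
      by have := h k; rewrite givensE (negbTE ki) (negbTE kj).
  move=> k; rewrite givensE; move: h => [[hi hj] h].
  case: eqP => [->//|/eqP ki]; case: eqP => [->//|/eqP kj].
  by apply: h; rewrite !inE negb_or ki kj.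
pose E := [set w | forall k, k \in ~: [set i; j]%SET -> A k (Y k w)].
have mE : measurable E.
  exact: measurable_sub_family.

pose q : R := fine (P E).
have q0 : 0 <= q by rewrite fine_ge0.
have PE : P E = q%:E by rewrite /q fineK// fin_num_measure.
pose f w : measurableTypeR R * measurableTypeR R := (Y i w, Y j w).
have mp : measurable_fun [set: T] f by apply/measurable_fun_pairP; split; exact: mY.
pose m' : {measure set (measurableTypeR R * measurableTypeR R)%type -> \bar R} := pushforward (mrestr P mE) f.
(* The factor q is put on the second marginal, so that the restricted law is again a product
   measure. *)
pose g2 : {finite_measure set (measurableTypeR R) -> \bar R} := mscale (NngNum q0) gam.
have m'E (B C : set R) : measurable B -> measurable C -> m' mp (B `*` C) = (gam B * g2 C)%E.
  move=> mB mC; rewrite /= /pushforward /mrestr /g2 /= /mscale /=.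
  pose A' k := if k == i then B else if k == j then C else A k.
  have mA' k : measurable (A' k) by rewrite /A'; case: ifP => // _; case: ifP.
  have -> : f @^-1` (B `*` C) `&` E = [set w | forall k, A' k (Y k w)].
    apply/seteqP; split => w /=; rewrite /A'.
      move=> [[/= Bw Cw] Ew] k; case: eqP => [->//|/eqP ki]; case: eqP => [->//|/eqP kj].
      by apply: Ew; rewrite !inE negb_or ki kj.
    move=> h; split; first split => /=.
    - by have := h i; rewrite eqxx.
    - by have := h j; rewrite eqxx eq_sym (negbTE ij).
    - move=> k; rewrite !inE negb_or => /andP[ki kj].
      by have := h k; rewrite (negbTE ki) (negbTE kj).
  have [_ ->//] := Yi.
  rewrite (bigD1 i)//= (bigD1 j)/=; last by rewrite eq_sym.
  rewrite /A' !eqxx (eq_sym j i) (negbTE ij) [X in (_ * (_ * X))%E](_ : _ = q%:E).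
    by rewrite [(gam C * _)%E]muleC.
  rewrite -PE /E gauss_iid_sub//.
  apply: eq_big => k; first by rewrite !inE negb_or.
  by move=> /andP[/negbTE -> /negbTE ->].
pose Z := [set z : R * R | A i (c * z.1 + s * z.2) /\ A j (- s * z.1 + c * z.2)].
have mZ : measurable Z.
  by have := @measurable_rot R c s measurableT _ (measurableX (mA i) (mA j)); rewrite setTI.
have := @product_measure_unique _ _ _ _ _ gam g2 (m' mp) m'E _ mZ.
rewrite [m' mp _](_ : _ = P [set w | (A i (c * Y i w + s * Y j w) /\ A j (- s * Y i w + c * Y j w)) /\
      (forall k, k \in ~: [set i; j]%SET -> A k (Y k w))]) => [<-|]; last by [].
rewrite /product_measure1/=.
rewrite [LHS](_ : _ = (q%:E * (gam \x gam)%E Z)%E); last first.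
  rewrite /product_measure1/= -ge0_integralZl//=; last exact: measurable_fun_xsection.
rewrite normal_prob_rot// -PE gauss_iid_sub//.
rewrite [RHS](bigD1 i)//= [X in _ = (_ * X)%E](bigD1 j)/=; last by rewrite eq_sym.
rewrite muleC -muleA; congr (_ * (_ * _))%E.
by apply: eq_bigl => k; rewrite !inE negb_or.
Qed.

(** Rotations have determinant 1; sign changes are what remains to reach every orthogonal matrix. *)
Definition flip N (i : 'I_N) : 'M[R]_N := \matrix_(a, b) ((a == b)%:R * (-1) ^+ (a == i)).

Lemma flipE N (i a : 'I_N) (f : 'I_N -> R) :
  \sum_l flip i a l * f l = (-1) ^+ (a == i) * f a.
Proof.
under eq_bigr do rewrite mxE [a == _]eq_sym -mulrA.
exact: (sum_delta (fun l => (-1) ^+ (a == i) * f l)).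
Qed.

Lemma gauss_inv_flip N (i : 'I_N) : gauss_inv (flip i).
Proof.
move=> Y Yi; have [mY hY] := Yi; split; first exact: measurable_act.
move=> A mA.
pose B k := if k == i then -%R @^-1` A k else A k.
have mB k : measurable (B k).
  by rewrite /B; case: ifP => // _; rewrite -[X in measurable X]setTI; exact: oppr_measurable.
have := hY B mB.
rewrite (_ : [set w | forall k, B k (Y k w)] = [set w | forall k, A k (act (flip i) Y k w)]).
  move=> ->; apply: eq_bigr => k _; rewrite /B; case: ifP => // _.
  exact: normal_prob_opp.
apply/seteqP; split => w /= h k; move: (h k); rewrite /act flipE /B.
  by case: eqP => _ /=; rewrite ?expr1 ?mulN1r ?expr0 ?mul1r.
by case: eqP => _ /=; rewrite ?expr1 ?mulN1r ?expr0 ?mul1r.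
Qed.

Lemma flip_orth N (i : 'I_N) : flip i *m flip i = 1%:M.
Proof.
apply/matrixP => a b; rewrite !mxE flipE !mxE.
have [->|ab] := eqVneq a b; last by rewrite mul0r mulr0.
by rewrite mul1r -expr2 sqrr_sign.
Qed.

Lemma mulmx_givensT N (Q : 'M[R]_N) (i j : 'I_N) c s x y :
  (Q *m (givens i j c s)^T) x y = if y == i then c * Q x i + s * Q x j
    else if y == j then - s * Q x i + c * Q x j else Q x y.
Proof.
rewrite mxE; under eq_bigr do rewrite mxE mulrC.
exact: givensE.
Qed.

Lemma orth_row_dot N (Q : 'M[R]_N) (i j : 'I_N) : Q *m Q^T = 1%:M ->
  \sum_l Q i l * Q j l = (i == j)%:R.
Proof.
move=> /matrixP/(_ i j); rewrite !mxE => <-.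
by apply: eq_bigr => l _; rewrite mxE.
Qed.

(* Givens elimination: the first k rows are already those of the identity, and
   the entries of row k outside the diagonal are cleared one at a time. *)
Lemma gauss_inv_orth N (Q : 'M[R]_N) : Q *m Q^T = 1%:M -> gauss_inv Q.
Proof.
have step (k m : nat) : (k + m)%N = N ->
    forall Q : 'M[R]_N, Q *m Q^T = 1%:M ->
    (forall i l : 'I_N, (i < k)%N -> Q i l = (i == l)%:R) -> gauss_inv Q.
  elim: m k => [|m IHm] k km {}Q Qo Qk.
    have -> : Q = 1%:M.
      by apply/matrixP => i l; rewrite mxE Qk// -(addn0 k) km.
    by move=> Y; rewrite act1.
  have kN : (k < N)%N by lia.
  pose K := Ordinal kN.
  (* The inner induction is on the number of nonzero off-diagonal entries of row k. *)
  suff inner (c : nat) : forall Q : 'M[R]_N, Q *m Q^T = 1%:M ->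
      (forall i l : 'I_N, (i < k)%N -> Q i l = (i == l)%:R) ->
      (#|[set l : 'I_N | (l != K) && (Q K l != 0%R)]%SET| <= c)%N -> gauss_inv Q.
    exact: (inner _ Q Qo Qk (leqnn _)).
  elim: c => [|c IHc] {Qo Qk}Q Qo Qk cQ.
    have Q0 l : l != K -> Q K l = 0.
      move=> lK; apply/eqP; apply/negPn/negP => Ql.
      by move: cQ; rewrite leqn0 cards_eq0 => /eqP/setP/(_ l); rewrite !inE lK Ql.
    (* A row of norm 1 with only its diagonal entry left has 1 or -1 there. *)
    have : \sum_l Q K l * Q K l = 1 by rewrite (orth_row_dot _ _ Qo) eqxx.
    rewrite (bigD1 K)//= big1 => [|l /Q0 ->]; last by rewrite mul0r.
    rewrite addr0 -expr2 => /eqP; rewrite sqrf_eq1 => /orP[/eqP QK|/eqP QK].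
      apply: (IHm k.+1); [lia|exact: Qo|].
      move=> i l; rewrite ltnS leq_eqVlt => /orP[/eqP ik|]; last exact: Qk.
      have -> : i = K by apply/val_inj.
      have [<-|] := eqVneq K l; first by rewrite QK.
      by rewrite eq_sym => /Q0 ->.
    have -> : Q = (Q *m flip K) *m flip K by rewrite -mulmxA flip_orth mulmx1.
    apply: gauss_inv_mul; last exact: gauss_inv_flip.
    have fT : (flip K)^T = flip K.
      apply/matrixP => a b; rewrite !mxE eq_sym.
      by have [->|] := eqVneq a b; rewrite ?mul0r.
    have QfE x y : (Q *m flip K) x y = (-1) ^+ (y == K) * Q x y.
      rewrite mxE -[flip K]fT; under eq_bigr do rewrite mxE mulrC.
      exact: flipE.
    apply: (IHm k.+1); first lia.
      by rewrite trmx_mul fT mulmxA -(mulmxA Q) flip_orth mulmx1.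
    move=> i l; rewrite ltnS leq_eqVlt QfE => /orP[/eqP ik|ik]; last first.
      rewrite Qk//; have [lK|] := eqVneq l K; last by rewrite mul1r.
      suff -> : (i == l) = false by rewrite mulr0.
      by apply/negbTE; rewrite lK -val_eqE/= neq_ltn ik.
    have -> : i = K by apply/val_inj.
    have [->|] := eqVneq l K; first by rewrite QK /= expr1 mulrN1 opprK.
    by move=> lK; rewrite Q0// mulr0.
  have [S0|/finset.set0Pn[j]] := eqVneq [set l : 'I_N | (l != K) && (Q K l != 0%R)]%SET finset.set0.
    by apply: IHc => //; rewrite S0 cards0.
  rewrite inE => /andP[jK Qj].
  pose r := Num.sqrt (Q K K ^+ 2 + Q K j ^+ 2).
  have r20 : 0 < Q K K ^+ 2 + Q K j ^+ 2.
    by rewrite ltr_wpDl ?sqr_ge0// exprn_even_gt0.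
  have r0 : 0 < r by rewrite sqrtr_gt0.
  have r2 : r ^+ 2 = Q K K ^+ 2 + Q K j ^+ 2 by rewrite sqr_sqrtr// ltW.
  pose cc := Q K K / r; pose ss := Q K j / r.
  have cs : cc ^+ 2 + ss ^+ 2 = 1.
    by rewrite /cc /ss !exprMn -mulrDl -r2 exprVn divff// expf_neq0// gt_eqF.
  have Kj : K != j by rewrite eq_sym.
  have Go := givens_orth Kj cs.
  pose G := givens K j cc ss.
  have GTG : G^T *m G = 1%:M by apply: mulmx1C.
  have -> : Q = (Q *m G^T) *m G by rewrite -mulmxA GTG mulmx1.
  apply: gauss_inv_mul; last exact: gauss_inv_givens.
  (* For j < k, row j is that of the identity and orthogonality gives Q_kj = 0, against the choice
     of j. Hence the finished rows vanish in both columns that the rotation mixes, and stay as they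
     are. *)
  have jk : (k <= j)%N.
    rewrite leqNgt; apply/negP => jk; have := orth_row_dot K j Qo.
    under eq_bigr do rewrite (Qk j)// [j == _]eq_sym mulrC.
    by rewrite sum_delta (negbTE Kj) => /eqP; rewrite (negbTE Qj).
  apply: IHc.
  - by rewrite trmx_mul trmxK mulmxA -(mulmxA Q) GTG mulmx1.
  - move=> i l ik; rewrite mulmx_givensT !Qk//.
    have iK : (i == K) = false by apply/negbTE; rewrite -val_eqE/= neq_ltn ik.
    have ij : (i == j) = false.
      by apply/negbTE; rewrite -val_eqE/= neq_ltn (leq_trans ik jk).
    rewrite iK ij !mulr0 addr0; case: eqP => [->|_]; first by rewrite iK.
    by case: eqP => [->|_]; rewrite ?ij.
  rewrite -ltnS; apply: leq_trans cQ; apply: proper_card; apply/properP; split.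
    apply/fintype.subsetP => l; rewrite !inE mulmx_givensT => /andP[lK].
    rewrite lK (negbTE lK) /=; have [->|//] := eqVneq l j.
    by rewrite Qj.
  exists j; first by rewrite inE jK Qj.
  rewrite inE jK/= mulmx_givensT (negbTE jK) eqxx negbK.
  by rewrite /cc /ss; apply/eqP; field; rewrite gt_eqF.
move=> Qo; apply: (step 0%N N) => //.
Qed.


Lemma iid_gauss (omega : nat -> {RV P >-> R}) N : iid_standard_normal omega ->
  gauss_iid (fun i : 'I_N => omega i : T -> R).
Proof.
move=> [ind law]; split; first by move=> i; exact: measurable_funPT.
move=> A mA.
pose B (k : nat) : set R := if insub k is Some i then A i else setT.
have mB k : measurable (B k) by rewrite /B; case: insub.
have BE (i : 'I_N) : B i = A i by rewrite /B valK.
have := ind [fset nat_of_ord i | i in 'I_N]%fset B mB.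
have -> : \bigcap_(i in [set` [fset nat_of_ord i | i in 'I_N]%fset]) (omega i @^-1` B i) =
    [set w | forall i : 'I_N, A i (omega i w)].
  apply/seteqP; split => w /= h i.
    by have := h i; rewrite -BE; apply => /=; apply/imfsetP; exists i.
  by move=> /= /imfsetP[/= k _ ->]; rewrite BE; exact: h.
move=> ->; rewrite big_imfset/=; last by move=> x y _ _; exact: val_inj.
rewrite big_enum/=; apply: eq_bigr => i _.
by rewrite BE -(law i)//.
Qed.

(** The pi-system that generates the sigma-algebra of the coordinates in J. *)
Definition cyl N (Y : 'I_N -> T -> R) (J : {set 'I_N}) : set (set T) :=
  [set E | exists2 A : 'I_N -> set R, (forall i, measurable (A i)) &
     E = [set w | forall i, i \in J -> A i (Y i w)]].

Section Blocks.
Variables (N : nat) (Y : 'I_N -> T -> R).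
Hypothesis Yi : gauss_iid Y.

Lemma cyl_measurable J : cyl Y J `<=` measurable.
Proof. by move=> E [A mA ->]; apply: measurable_sub_family => //; exact: Yi.1. Qed.

Lemma cylT J : cyl Y J setT.
Proof. by exists (fun=> setT) => //; apply/seteqP; split. Qed.

Lemma cyl_setI J : setI_closed (cyl Y J).
Proof.
move=> E F [A mA ->] [B mB ->]; exists (fun i => A i `&` B i).
  by move=> i; exact: measurableI.
apply/seteqP; split => w /=; first by move=> [h1 h2] i iJ; split; [exact: h1|exact: h2].
by move=> h; split => i /h[].
Qed.

Lemma sub_cyl (J K : {set 'I_N}) : J \subset K -> cyl Y J `<=` cyl Y K.
Proof.
move=> /fintype.subsetP JK E [A mA ->]; exists (fun i => if i \in J then A i else setT).
  by move=> i; case: ifP.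
apply/seteqP; split => w /= h i.
  by move=> _; case: ifP => // /h.
by move=> iJ; have := h i (JK _ iJ); rewrite iJ.
Qed.

Definition sigma J : set (set T) := <<s cyl Y J >>.

Lemma sigma_measurable J E : sigma J E -> measurable E.
Proof. by apply: smallest_sub => //; [exact: sigma_algebra_measurable|exact: cyl_measurable]. Qed.

Lemma sub_sigma (J K : {set 'I_N}) : J \subset K -> sigma J `<=` sigma K.
Proof. by move=> JK; apply: sub_sigma_algebra2; exact: sub_cyl. Qed.

Lemma cyl_indep (J K : {set 'I_N}) E F : (forall i, i \in J -> i \notin K) -> cyl Y J E -> cyl Y K F ->
  P (E `&` F) = (P E * P F)%E.
Proof.
move=> JK [A mA ->] [B mB ->].
rewrite !gauss_iid_sub//.
pose C i := if i \in J then A i else B i.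
have mC i : measurable (C i) by rewrite /C; case: ifP.
have -> : [set w | forall i, i \in J -> A i (Y i w)] `&` [set w | forall i, i \in K -> B i (Y i w)] =
   [set w | forall i, i \in (J :|: K)%SET -> C i (Y i w)].
  apply/seteqP; split => w /=; rewrite /C.
    move=> [h1 h2] i; rewrite inE; case: (boolP (i \in J)) => [/h1//|_ /= /h2//].
  move=> h; split => i iJ; have := h i; rewrite inE iJ ?orbT => /(_ isT)//.
  by rewrite (negbTE (contraL (JK i) iJ)).
rewrite gauss_iid_sub// (bigID (fun i => i \in J))/=; congr (_ * _)%E; apply: eq_big => i.
- by rewrite finset.in_setU; case: (i \in J); rewrite ?andbF.
- by move=> /andP[_ iJ]; rewrite /C iJ.
- by rewrite finset.in_setU; case: (boolP (i \in J)) => [/JK/negbTE ->|]; rewrite ?andbT.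
- by move=> /andP[_ iJ]; rewrite /C (negbTE iJ).
Qed.

(** The pi-lambda argument is run once in each variable: with one event fixed, restricting P to it
    and multiplying P by its probability give two finite measures that agree on cylinders. *)
Lemma sigma_indep (J K : {set 'I_N}) E F : (forall i, i \in J -> i \notin K) -> sigma J E -> sigma K F ->
  P (E `&` F) = (P E * P F)%E.
Proof.
move=> JK.
have key (G : set (set T)) (D : set T) : measurable D -> setI_closed G -> G `<=` measurable -> G setT ->
    (forall E', G E' -> P (E' `&` D) = (P E' * P D)%E) ->
    forall E', <<s G >> E' -> P (E' `&` D) = (P E' * P D)%E.
  move=> mD GI Gm GT h E' sE.
  pose q : R := fine (P D).
  have q0 : 0 <= q by rewrite fine_ge0.
  have PF : P D = q%:E by rewrite /q fineK// fin_num_measure.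
  pose m1 : {measure set T -> \bar R} := mrestr P mD.
  pose m2 : {measure set T -> \bar R} := mscale (NngNum q0) P.
  have := @g_sigma_algebra_measure_unique _ _ _ G Gm (fun=> setT) (fun=> GT) _ m1 m2 GI _ _ E' sE.
  rewrite /m1 /m2 /= /mrestr /mscale/= => ->.
  - by rewrite PF muleC.
  - by rewrite bigcup_const.
  - by move=> A GA; rewrite /mrestr /mscale/= h// PF muleC.
  - by move=> _; rewrite /mrestr setTI PF ltry.
move=> sE sF; move: E sE; apply: (@key (cyl Y J) F); [exact: (sigma_measurable sF)|exact: cyl_setI|exact: cyl_measurable|exact: cylT|].
move=> E cE; rewrite setIC muleC; move: F sF.
apply: (@key (cyl Y K) E); [exact: (@cyl_measurable J)|exact: cyl_setI|exact: cyl_measurable|exact: cylT|].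
by move=> F cF; rewrite setIC muleC; exact: cyl_indep JK cE cF.
Qed.

Lemma sigmaT J : sigma J setT.
Proof. by apply: sub_sigma_algebra; exact: cylT. Qed.

Lemma sigmaI J E F : sigma J E -> sigma J F -> sigma J (E `&` F).
Proof.
move=> sE sF.
exact: (@measurableI _ (g_sigma_algebraType (cyl Y J)) E F sE sF).
Qed.

Lemma blocks_indep m (J : nat -> {set 'I_N}) (E : nat -> set T) :
  (forall i j, (i < m)%N -> (j < m)%N -> i != j -> forall k, k \in J i -> k \notin J j) ->
  (forall i, (i < m)%N -> sigma (J i) (E i)) ->
  P [set w | forall i, (i < m)%N -> E i w] = (\prod_(i < m) P (E i))%E.
Proof.
move=> disJ sE.
(* The induction also carries the sigma-algebra of the union of the blocks met so far, which is
   disjoint from the next block. *)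
suff: P [set w | forall i, (i < m)%N -> E i w] = (\prod_(i < m) P (E i))%E /\
   sigma (\bigcup_(i < m) J i)%SET [set w | forall i, (i < m)%N -> E i w] by case.
elim: m disJ sE => [|m IHm] disJ sE.
  rewrite !big_ord0; have -> : [set w : T | forall i, (i < 0)%N -> E i w] = setT.
    by apply/seteqP; split.
  by split; [exact: probability_setT|exact: sigmaT].
have [IH1 IH2] := IHm (fun i j im jm => disJ i j (ltnW im) (ltnW jm)) (fun i im => sE i (ltnW im)).
have -> : [set w : T | forall i, (i < m.+1)%N -> E i w] =
   [set w : T | forall i, (i < m)%N -> E i w] `&` E m.
  apply/seteqP; split => w /=.
    by move=> h; split; [move=> i im; apply: h; exact: ltnW|exact: h].
  by move=> [h1 h2] i; rewrite ltnS leq_eqVlt => /orP[/eqP ->//|/h1].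
rewrite !big_ord_recr/=; split.
  rewrite -IH1; apply: sigma_indep IH2 (sE m (ltnSn m)).
  move=> k /finset.bigcupP[i _]; apply: disJ => //; first exact: ltn_trans (ltn_ord i) _.
  by rewrite neq_ltn ltn_ord.
apply: sigmaI.
  apply: sub_sigma IH2; exact: finset.subsetUl.
apply: sub_sigma (sE m (ltnSn m)); exact: finset.subsetUr.
Qed.

Lemma sigma_fun (J : {set 'I_N}) (i : 'I_N) : i \in J ->
  measurable_fun [set: g_sigma_algebraType (cyl Y J)] (Y i).
Proof.
move=> iJ _ A mA; rewrite setTI; apply: sub_sigma_algebra.
exists (fun k => if k == i then A else setT); first by move=> k; case: ifP.
apply/seteqP; split => w /=.
  by move=> Aw k _; case: eqP => // ->.
by move=> /(_ i iJ); rewrite eqxx.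
Qed.

End Blocks.

End Gaussian_families.

(** * Real roots in the unit interval *)

Section Polynomial_roots.
Variable R : realType.
Implicit Types p q : {poly R}.

(** A bound, coefficient by coefficient, for |p^(k)| / k! on [-1, 1]. Only the coefficients of order
    at least k contribute. *)
Definition wnorm (n k : nat) p : R := \sum_(j < n) 'C(j, k)%:R * `|p`_j|.

(* Dividing out a root x with |x| <= 1: q_i = p_(i+1) + x q_(i+1), and the
   binomial weights absorb the resulting tail sums by Pascal's rule. *)
Lemma wnorm_div (n k : nat) p q (x : R) : (size p <= n)%N -> p = q * ('X - x%:P) ->
  `|x| <= 1 -> wnorm n k q <= wnorm n k.+1 p.
Proof.
move=> pn pq x1.
have qi i : `|q`_i| <= `|p`_i.+1| + `|q`_i.+1|.
  have -> : q`_i = p`_i.+1 + x * q`_i.+1.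
    by rewrite pq mulrBr coefB coefMX/= coefMC mulrC subrK.
  apply: (le_trans (ler_normD _ _)); rewrite lerD2l normrM.
  by rewrite ler_piMl.
have qn : q`_n = 0.
  have [->|q0] := eqVneq q 0; first by rewrite coef0.
  apply: nth_default; apply: leq_trans pn.
  by rewrite pq size_Mmonic ?monicXsubC// size_XsubC addn2.
have pn' : p`_n = 0 by apply: nth_default.
have step m : \sum_(j < m) 'C(j, k)%:R * `|q`_j| <=
    \sum_(j < m) 'C(j.+1, k.+1)%:R * `|p`_j.+1| + 'C(m, k.+1)%:R * `|q`_m|.
  elim: m => [|m IHm]; first by rewrite !big_ord0 add0r mulr_ge0.
  rewrite !big_ord_recr/=.
  have h : 'C(m.+1, k.+1)%:R * `|q`_m| <= 'C(m.+1, k.+1)%:R * (`|p`_m.+1| + `|q`_m.+1|) :> R.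
    by rewrite ler_wpM2l.
  have e : 'C(m.+1, k.+1)%:R = 'C(m, k.+1)%:R + 'C(m, k)%:R :> R by rewrite binS natrD.
  move: IHm h; rewrite mulrDr => IHm h.
  have e2 : 'C(m.+1, k.+1)%:R * `|q`_m| = 'C(m, k.+1)%:R * `|q`_m| + 'C(m, k)%:R * `|q`_m|.
    by rewrite e mulrDl.
  by move: IHm h e2; lra.
apply: (le_trans (step n)); rewrite qn normr0 mulr0 addr0 /wnorm.
case: n pn {step} qn pn' => [|n] pn qn pn'; first by rewrite !big_ord0.
rewrite big_ord_recr/= pn' normr0 mulr0 addr0 [leRHS]big_ord_recl/=.
by rewrite lerDr mulr_ge0.
Qed.

Lemma wnorm_div_prod (n k : nat) p q (rs : seq R) : (size p <= n)%N ->
  p = q * \prod_(x <- rs) ('X - x%:P) -> {in rs, forall x, `|x| <= 1} ->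
  wnorm n k q <= wnorm n (k + size rs) p.
Proof.
elim: rs k p q => [|x rs IHrs] k p q pn; first by rewrite big_nil mulr1 addn0 => ->.
rewrite big_cons => pq h; rewrite /= addnS -addSn.
apply: (@le_trans _ _ (wnorm n k.+1 (q * ('X - x%:P)))).
  apply: (@wnorm_div _ _ _ _ x) => //; last by apply: h; rewrite mem_head.
  have [->|q0] := eqVneq (q * ('X - x%:P)) 0; first by rewrite size_poly0.
  apply: leq_trans pn; rewrite pq mulrA [X in (_ <= X)%N](size_Mmonic q0) ?monic_prod_XsubC//.
  by rewrite size_prod_XsubC addnS leq_addr.
apply: IHrs => //; first by rewrite pq mulrA.
by move=> y yrs; apply: h; rewrite inE yrs orbT.
Qed.

(** At 0 the linear factors have absolute value at most 1, so the constant term of p is bounded by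
    that of the quotient, and each division raises the order of the norm by one. Many roots thus
    make p_0 as small as the high coefficients. *)
Lemma coef0_le_wnorm n p (q : {poly R}) (rs : seq R) : (size p <= n)%N -> (0 < n)%N ->
  p = q * \prod_(x <- rs) ('X - x%:P) -> {in rs, forall x, `|x| <= 1} ->
  `|p`_0| <= wnorm n (size rs) p.
Proof.
move=> pn n0 pq h; apply: (@le_trans _ _ (wnorm n 0 q)); last first.
  by rewrite -[size rs]add0n; exact: (wnorm_div_prod _ pn pq h).
apply: (@le_trans _ _ `|q`_0|).
  rewrite pq -!horner_coef0 hornerM normrM ler_piMr// horner_prod.
  rewrite normr_prod; elim: rs h {pq} => [|x rs IHrs] h; first by rewrite big_nil.
  rewrite big_cons mulr_ile1//; first by apply: prodr_ge0.
    by rewrite hornerXsubC sub0r normrN; apply: h; rewrite mem_head.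
  by apply: IHrs => y yrs; apply: h; rewrite inE yrs orbT.
rewrite /wnorm; case: n n0 {pn} => // n _; rewrite big_ord_recl/= bin0 mul1r lerDl.
by apply: sumr_ge0 => j _; rewrite mulr_ge0.
Qed.

Lemma coef0_le_wnorm_roots n p (rs : seq R) m : (size p <= n)%N -> (0 < n)%N ->
  uniq rs -> all (root p) rs -> {in rs, forall x, `|x| <= 1} -> (m <= size rs)%N ->
  `|p`_0| <= wnorm n m p.
Proof.
move=> pn n0 urs rrs h mrs.
have urs' : uniq (take m rs) by exact: take_uniq.
have rrs' : all (root p) (take m rs).
  by apply/allP => x /mem_take; exact: (allP rrs).
have [q pq] : exists q, p = q * \prod_(x <- take m rs) ('X - x%:P).
  by apply: uniq_roots_prod_XsubC => //; rewrite uniq_rootsE.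
have := @coef0_le_wnorm n p q (take m rs) pn n0 pq _.
rewrite size_takel//; apply.
by move=> x /mem_take; exact: h.
Qed.

(** Divisibility rather than two distinct roots: a double root counts. *)
Definition two_roots p := exists q (x y : R), [/\ 0 <= x <= 1, 0 <= y <= 1 &
  p = q * ('X - x%:P) * ('X - y%:P)].

(** With p = q (X - x) (X - y), p_1 = x y q_1 - (x + y) q_0 and both factors are controlled on
    [0, 1]. Smallness of two coefficients, which will be independent, gives a quadratic
    probability. *)
Lemma two_roots_coef n p : (size p <= n)%N -> (1 < n)%N -> two_roots p ->
  `|p`_0| <= wnorm n 2 p /\ `|p`_1| <= 2 * wnorm n 2 p.
Proof.
move=> pn n1 [q [x [y [x01 y01 pq]]]].
have pq' : p = q * \prod_(z <- [:: x; y]) ('X - z%:P).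
  by rewrite !big_cons big_nil mulr1 mulrA.
have h : {in [:: x; y], forall z, `|z| <= 1}.
  by move=> z; rewrite !inE => /orP[]/eqP ->; rewrite ger0_norm; lra.
split; first exact: (coef0_le_wnorm pn (ltnW n1) pq' h).
have qw := @wnorm_div_prod n 0 p q [:: x; y] pn pq' h.
apply: (@le_trans _ _ (2 * wnorm n 0 q)); last by rewrite ler_pM2l.
have -> : p`_1 = x * y * q`_1 - (x + y) * q`_0.
  rewrite pq -mulrA (_ : ('X - x%:P) * ('X - y%:P) = 'X * 'X - (x + y)%:P * 'X + (x * y)%:P); last first.
    by rewrite polyCD polyCM; ring.
  rewrite mulrDr mulrBr !coefD coefN coefMC !mulrA !coefMX/= coefMC; ring.
have : `|q`_0| + `|q`_1| <= wnorm n 0 q.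
  rewrite /wnorm; case: n n1 {pn qw} => // -[//|n] _; rewrite !big_ord_recl/= !bin0 !mul1r addrA lerDl.
  by apply: sumr_ge0 => j _; rewrite mulr_ge0.
have := ler_normB (x * y * q`_1) ((x + y) * q`_0).
rewrite !normrM (ger0_norm (_ : 0 <= x + y)) ?(ger0_norm (_ : 0 <= x)) ?(ger0_norm (_ : 0 <= y)); [|lra..].
have : x * y * `|q`_1| <= `|q`_1| by rewrite ler_piMl//; nra.
have : (x + y) * `|q`_0| <= 2 * `|q`_0| by rewrite ler_wpM2r//; lra.
have := normr_ge0 q`_1; have := normr_ge0 q`_0.
lra.
Qed.

Lemma sign_change_root p : p.[0] * p.[1] < 0 -> exists2 x, 0 < x < 1 & root p x.
Proof.
move=> h.
have [x] : exists2 x : R, x \in `[0, 1] & root p x.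
  have [p0|p0] := leP p.[0] 0.
    apply: (@poly_ivt _ p 0 1) => //; rewrite p0 /=.
    by rewrite leNgt; apply/negP => p1; nra.
  have [x xI rx] : exists2 x : R, x \in `[0, 1] & root (- p) x.
    apply: (@poly_ivt _ (- p) 0 1) => //; rewrite !hornerN oppr_le0 (ltW p0) oppr_ge0.
    by rewrite leNgt; apply/negP => p1; nra.
  by exists x => //; rewrite rootN in rx.
rewrite in_itv/= => /andP[x0 x1] rx; exists x => //.
have pN0 : p.[0] != 0 by apply: contraTneq h => ->; rewrite mul0r ltxx.
have pN1 : p.[1] != 0 by apply: contraTneq h => ->; rewrite mulr0 ltxx.
rewrite !lt_neqAle x0 x1 !andbT; apply/andP; split.
  by apply: contraNneq pN0 => e; rewrite -/(root p 0) e.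
by apply: contraNneq pN1 => e; rewrite -/(root p 1) -e.
Qed.

Lemma no_root_same_sign p : (forall x, 0 <= x <= 1 -> ~~ root p x) -> 0 < p.[0] * p.[1].
Proof.
move=> h; rewrite lt_neqAle; apply/andP; split.
  rewrite eq_sym mulf_neq0//.
    by have := h 0; rewrite lexx ler01; exact.
  by have := h 1; rewrite lexx ler01; exact.
rewrite leNgt; apply/negP => /sign_change_root[x /andP[x0 x1] rx].
by move: (h x); rewrite rx !ltW// => /(_ isT).
Qed.

(** If p = q (X - x), then q has no root in [0, 1], hence has one sign there, and p changes sign
    with X - x. *)
Lemma count_roots_sign_change p (rs : seq R) : ~ two_roots p -> p.[0] != 0 -> p.[1] != 0 ->
  uniq rs -> all (root p) rs -> {in rs, forall x, 0 <= x <= 1} ->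
  (size rs <= (p.[0] * p.[1] < 0)%R)%N.
Proof.
move=> n2 p0 p1 urs rrs h.
case: rs urs rrs h => [//|x rs] urs rrs h.
have x01 : 0 <= x <= 1 by apply: h; rewrite mem_head.
have rx : root p x by have /andP[] := rrs.
have [q pq] := factor_theorem _ _ rx.
have hq y : 0 <= y <= 1 -> ~~ root q y.
  move=> y01; apply/negP => /factor_theorem[q' qq]; apply: n2.
  by exists q', y, x; split => //; rewrite pq qq.
have rs0 : rs = [::].
  case: rs urs rrs h => // y rs /= /andP[]; rewrite inE negb_or => /andP[xy _] _ /and3P[_ ry _] h.
  have y01 : 0 <= y <= 1 by apply: h; rewrite !inE eqxx orbT.
  exfalso; move: ry; rewrite pq rootM root_XsubC eq_sym (negbTE xy) orbF.
  by apply/negP; exact: hq.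
have q01 := no_root_same_sign hq.
have x0 : x != 0 by apply: contraNneq p0 => e; rewrite -/(root p 0) -e.
have x1 : x != 1 by apply: contraNneq p1 => e; rewrite -/(root p 1) -e.
rewrite rs0 /= pq !hornerM !hornerXsubC.
suff -> : q.[0] * (0 - x) * (q.[1] * (1 - x)) < 0 by [].
have : 0 < x by rewrite lt_neqAle eq_sym x0; case/andP: x01.
have : x < 1 by rewrite lt_neqAle x1; case/andP: x01.
move=> h1 h2.
have : 0 < x * (1 - x) by rewrite mulr_gt0// subr_gt0.
have -> : q.[0] * (0 - x) * (q.[1] * (1 - x)) = - ((q.[0] * q.[1]) * (x * (1 - x))) by ring.
by move=> h3; rewrite oppr_lt0 mulr_gt0.
Qed.

(** Otherwise the difference would have the roots 0, 1, 2, ..., more of them than its degree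
    allows. *)
Lemma horner_inj_sum N (a b : 'I_N -> R) :
  (forall x, \sum_k a k * x ^+ k = \sum_k b k * x ^+ k) -> a =1 b.
Proof.
move=> h.
pose c (k : nat) : R := if insub k is Some i then a i - b i else 0.
pose p := \poly_(k < N) c k.
have cE (i : 'I_N) : c i = a i - b i by rewrite /c valK.
have p0 : p = 0.
  apply/eqP/negPn/negP => pN0.
  have := @max_poly_roots _ p [seq i%:R | i <- iota 0 (size p)] pN0.
  rewrite size_map size_iota ltnn => H; suff : false by [].
  apply: H.
    apply/allP => _ /mapP[i _ ->]; rewrite /root /p horner_poly.
    under eq_bigr do rewrite cE mulrBl.
    by rewrite sumrB h subrr.
  by rewrite map_inj_uniq ?iota_uniq// => i j /eqP; rewrite eqr_nat => /eqP.
move=> i; apply/eqP; rewrite -subr_eq0 -cE.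
by have := coef_poly N c i; rewrite -/p p0 coef0 ltn_ord => <-.
Qed.

End Polynomial_roots.

(** * Trigonometric form of the random polynomial *)

Section Rotation.
Variables (R : realType) (n : nat).
Implicit Types (t u : R).

Definition sqbin (k : nat) : R := Num.sqrt 'C(n, k)%:R.

Lemma sqbin_gt0 k : (k <= n)%N -> 0 < sqbin k.
Proof. by move=> kn; rewrite sqrtr_gt0 ltr0n bin_gt0. Qed.

Lemma sqbin_ge0 k : 0 <= sqbin k. Proof. exact: sqrtr_ge0. Qed.

Lemma sqr_sqbin k : sqbin k ^+ 2 = 'C(n, k)%:R.
Proof. by rewrite sqr_sqrtr. Qed.

Definition phi (k : nat) t : R := sqbin k * sin t ^+ k * cos t ^+ (n - k).

Definition ftrig (y : 'I_n.+1 -> R) t : R := \sum_k y k * phi k t.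

Definition ellp (y : 'I_n.+1 -> R) : {poly R} := \poly_(k < n.+1) (y (inord k) * sqbin k).

Lemma horner_ellp y x : (ellp y).[x] = \sum_(k < n.+1) y k * sqbin k * x ^+ k.
Proof. by rewrite horner_poly; apply: eq_bigr => k _; rewrite inord_val. Qed.

Lemma ftrig_ellp y t : cos t != 0 -> ftrig y t = cos t ^+ n * (ellp y).[tan t].
Proof.
move=> ct; rewrite horner_ellp mulr_sumr; apply: eq_bigr => k _.
have kn : (k <= n)%N by rewrite -ltnS.
have -> : cos t ^+ n = cos t ^+ (n - k) * cos t ^+ k by rewrite -exprD subnK.
rewrite /phi /tan expr_div_n.
by field; rewrite expf_neq0.
Qed.

(* \sum_j rotp_j(x) is obtained from x^j by the substitution induced on the
   homogeneous coordinates (sin, cos) by a rotation of angle tau. *)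
Definition rotp (tau : R) (j : nat) : {poly R} :=
  ((cos tau)%:P * 'X + (sin tau)%:P) ^+ j * ((cos tau)%:P - (sin tau)%:P * 'X) ^+ (n - j).

Lemma horner_rotp tau j x :
  (rotp tau j).[x] = (cos tau * x + sin tau) ^+ j * (cos tau - sin tau * x) ^+ (n - j).
Proof. by rewrite /rotp hornerM !horner_exp !hornerE. Qed.

Lemma size_rotp tau (j : nat) : (j <= n)%N -> (size (rotp tau j) <= n.+1)%N.
Proof.
move=> jn.
have h (q : {poly R}) k : (size q <= 2)%N -> (size (q ^+ k) <= k.+1)%N.
  move=> q2; apply: (leq_trans (size_poly_exp_leq q k)); rewrite ltnS.
  by rewrite -[leqRHS]mul1n leq_mul2r; apply/orP; right; case: (size q) q2 => // -[|[]].
apply: (leq_trans (size_polyMleq _ _)).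
have h1 : (size (((cos tau)%:P * 'X + (sin tau)%:P) ^+ j) <= j.+1)%N.
  apply: h; apply: (leq_trans (size_polyD _ _)); rewrite geq_max.
  rewrite (leq_trans (size_polyC_leq1 _))// andbT.
  by apply: (leq_trans (size_polyMleq _ _)); rewrite size_polyX addn2 ltnS size_polyC_leq1.
have h2 : (size (((cos tau)%:P - (sin tau)%:P * 'X) ^+ (n - j)) <= (n - j).+1)%N.
  apply: h; apply: (leq_trans (size_polyD _ _)); rewrite geq_max size_polyN.
  rewrite (leq_trans (size_polyC_leq1 _))//=.
  by apply: (leq_trans (size_polyMleq _ _)); rewrite size_polyX addn2 ltnS size_polyC_leq1.
by move: h1 h2; set A := size _; set B := size _; lia.
Qed.

(** The action of a rotation on binary forms of degree n, in the basis [sqbin k] x^k, which is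
    orthonormal for the Bombieri inner product. *)
Definition rotmx (tau : R) : 'M[R]_n.+1 :=
  \matrix_(k, j) (sqbin j * (rotp tau j)`_k / sqbin k).

Lemma horner_rotmx tau (j : 'I_n.+1) x :
  \sum_k rotmx tau k j * sqbin k * x ^+ k = sqbin j * (rotp tau j).[x].
Proof.
have jn : (j <= n)%N by rewrite -ltnS.
rewrite (horner_coef_wide _ (size_rotp tau jn)) mulr_sumr; apply: eq_bigr => k _.
have k0 : sqbin k != 0 by rewrite gt_eqF// sqbin_gt0// -ltnS.
by rewrite mxE; field.
Qed.

(** The entries are compared through their generating polynomial in x and y. Summed over j, the
    products of the images at x and y give the n-th power of the rotated form of 1 + x y; that form
    is invariant, and (1 + x y)^n is the generating polynomial of the identity. *)
Lemma rotmx_orth tau : rotmx tau *m (rotmx tau)^T = 1%:M.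
Proof.
have key (x y : R) : \sum_(k < n.+1) (\sum_(l < n.+1) sqbin k * sqbin l * (rotmx tau *m (rotmx tau)^T) k l * y ^+ l) * x ^+ k =
    \sum_(k < n.+1) ('C(n, k)%:R * y ^+ k) * x ^+ k.
  transitivity (\sum_(j < n.+1) (sqbin j * (rotp tau j).[x]) * (sqbin j * (rotp tau j).[y])).
    under [RHS]eq_bigr do rewrite -!horner_rotmx big_distrlr/=.
    rewrite exchange_big/=; apply: eq_bigr => k _.
    rewrite exchange_big/= big_distrl/=; apply: eq_bigr => l _.
    rewrite mxE mulr_sumr !big_distrl/=; apply: eq_bigr => j _.
    by rewrite [(rotmx tau)^T _ _]mxE; ring.
  transitivity ((1 + x * y) ^+ n).
    have -> : 1 + x * y = (cos tau - sin tau * x) * (cos tau - sin tau * y) +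
       (cos tau * x + sin tau) * (cos tau * y + sin tau).
      transitivity ((cos tau ^+ 2 + sin tau ^+ 2) * (1 + x * y)); last by ring.
      by rewrite cos2Dsin2 mul1r.
    rewrite exprDn; apply: eq_bigr => j _.
    rewrite !horner_rotp !exprMn -mulr_natr -sqr_sqbin; ring.
  rewrite exprDn; apply: eq_bigr => k _.
  by rewrite expr1n mul1r exprMn -mulr_natr; ring.
apply/matrixP => k l; rewrite [RHS]mxE.
have E (y : R) := @horner_inj_sum _ _ _ _ (fun x => key x y) k.
have {}E : forall y : R, \sum_(l < n.+1) (sqbin k * sqbin l * (rotmx tau *m (rotmx tau)^T) k l) * y ^+ l =
   \sum_(l < n.+1) ('C(n, k)%:R * (l == k)%:R) * y ^+ l.
  move=> y; rewrite E; under [RHS]eq_bigr do rewrite -mulrA.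
  by rewrite -mulr_sumr sum_delta.
have := horner_inj_sum E l.
have kn : sqbin k != 0 by rewrite gt_eqF// sqbin_gt0// -ltnS.
have ln : sqbin l != 0 by rewrite gt_eqF// sqbin_gt0// -ltnS.
rewrite [l == k]eq_sym; have [<-|kl] := eqVneq k l.
  rewrite mulr1 -sqr_sqbin expr2 -[in RHS](mulr1 (sqbin k * _)) => /mulfI -> //.
  by rewrite mulf_neq0.
by rewrite mulr0 => /eqP; rewrite !mulf_eq0 (negbTE kn) (negbTE ln)/= => /eqP.
Qed.

Definition rotv (tau : R) (y : 'I_n.+1 -> R) : 'I_n.+1 -> R :=
  fun k => \sum_j rotmx tau k j * y j.

(** At u = 0 it shows that f (tau) is a single coefficient of the rotated family, hence standard
    normal; for u in a cell it moves the cell to the origin. *)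
Lemma ftrig_rot tau y u : cos u != 0 -> ftrig y (tau + u) = ftrig (rotv tau y) u.
Proof.
move=> cu; rewrite [RHS]ftrig_ellp// horner_ellp /rotv.
under [in RHS]eq_bigr do rewrite !big_distrl/=.
rewrite exchange_big/= mulr_sumr; apply: eq_bigr => j _.
have jn : (j <= n)%N by rewrite -ltnS.
transitivity (cos u ^+ n * (y j * (sqbin j * (rotp tau j).[tan u]))); last first.
  rewrite -horner_rotmx mulr_sumr; congr (_ * _); apply: eq_bigr => k _; ring.
rewrite horner_rotp /phi sinD cosD.
have -> : cos tau * tan u + sin tau = (sin tau * cos u + cos tau * sin u) / cos u.
  by rewrite /tan; field.
have -> : cos tau - sin tau * tan u = (cos tau * cos u - sin tau * sin u) / cos u.
  by rewrite /tan; field.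
have -> : cos u ^+ n = cos u ^+ (n - j) * cos u ^+ j by rewrite -exprD subnK.
rewrite !expr_div_n.
by field; rewrite !expf_neq0.
Qed.

Lemma phi_ge0 k t : 0 <= sin t -> 0 <= cos t -> 0 <= phi k t.
Proof. by move=> s0 c0; rewrite !mulr_ge0 ?sqbin_ge0 ?exprn_ge0. Qed.

Lemma sum_phi t u : \sum_(k < n.+1) phi k t * phi k u = cos (t - u) ^+ n.
Proof.
rewrite cosB exprDn; apply: eq_bigr => k _.
rewrite /phi !exprMn -mulr_natr -sqr_sqbin; ring.
Qed.

Lemma ftrig0 y : ftrig y 0 = y ord0.
Proof.
rewrite /ftrig big_ord_recl big1 ?addr0 => [|k _].
  by rewrite /phi /sqbin bin0 sqrtr1 !expr0 cos0 expr1n !mulr1.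
by rewrite /phi sin0 expr0n/= mulr0 mul0r mulr0.
Qed.

End Rotation.

(** * Elementary inequalities on [0, pi / 4] *)

Section Trigonometric_bounds.
Variable R : realType.
Implicit Types x t u : R.

Lemma cos_sqr_ge_half x : 0 <= x <= pi / 4 -> 2^-1 <= cos x ^+ 2.
Proof.
move=> /andP[x0 x4]; have : 0 <= cos (x *+ 2).
  by apply: cos_ge0_pihalf; have := pi_gt0 R; rewrite -mulr_natr; lra.
rewrite cos_mulr2n -mulr_natr; lra.
Qed.

Lemma cos_gt0_piquarter x : 0 <= x <= pi / 4 -> 0 < cos x.
Proof.
move=> /andP[x0 x4]; apply: cos_gt0_pihalf.
by have := pi_gt0 R; lra.
Qed.

Lemma sin_ge0_piquarter x : 0 <= x <= pi / 4 -> 0 <= sin x.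
Proof.
move=> /andP[x0 x4]; apply: sin_ge0_pi.
by have := pi_gt0 R; lra.
Qed.

Lemma cos_ge_half x : 0 <= x <= pi / 4 -> 2^-1 <= cos x.
Proof.
move=> h; have := cos_sqr_ge_half h; have := cos_gt0_piquarter h; have := cos_le1 x.
rewrite expr2; nra.
Qed.

(** Mean value theorem: the derivative 1 / cos^2 lies in [1, 2] up to pi / 4. This is why the
    angles, of total length at most pi, are cut into quarters. *)
Lemma tan_bounds x : 0 <= x <= pi / 4 -> x <= tan x <= 2 * x.
Proof.
move=> /andP[x0 x4].
have [->|x_neq0] := eqVneq x 0; first by rewrite tan0 mulr0 lexx.
have cpos y : 0 <= y <= x -> 0 < cos y.
  by move=> /andP[y0 yx]; apply: cos_gt0_piquarter; rewrite y0 (le_trans yx).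
have [||c cI] := @MVT_segment R tan (fun y => (cos y) ^- 2) 0 x x0.
- move=> y; rewrite in_itv/= => /andP[y0 yx]; apply: is_derive_tan.
  by rewrite gt_eqF// cpos// !ltW.
- apply: continuous_in_subspaceT => y; rewrite inE/= in_itv/= => yI.
  by apply: continuous_tan; rewrite gt_eqF// cpos.
rewrite tan0 !subr0 => ->.
have cI' : 0 <= c <= pi / 4.
  by move: cI; rewrite in_itv/= => /andP[-> cx]; rewrite (le_trans cx).
have h1 := cos_sqr_ge_half cI'.
have h2 : cos c ^+ 2 <= 1.
  by rewrite -[leRHS](expr1n _ 2) lerXn2r// ?nnegrE ?cos_le1// ltW// cos_gt0_piquarter.
have h3 : 0 < cos c ^+ 2 by rewrite exprn_gt0// cos_gt0_piquarter.
apply/andP; split.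
  by rewrite -[leLHS]mul1r ler_wpM2r// invf_ge1.
by rewrite ler_wpM2r// -[leRHS]invrK lef_pV2 ?posrE ?invr_gt0.
Qed.

Lemma sin_ge_half x : 0 <= x <= pi / 4 -> x / 2 <= sin x.
Proof.
move=> h; have /andP[h1 _] := tan_bounds h.
have c0 := cos_gt0_piquarter h; have c1 := cos_ge_half h.
have x0 : 0 <= x by case/andP: h.
have -> : sin x = tan x * cos x by rewrite /tan mulfVK// gt_eqF.
by apply: ler_pM => //; rewrite invr_ge0.
Qed.

(** After squaring, cos^2 x = 1 - sin^2 x <= 1 - x^2 / 4 <= exp (- x^2 / 4). *)
Lemma cos_pow_le x n : 0 <= x <= pi / 4 -> cos x ^+ n <= expR (- (n%:R * x ^+ 2 / 8)).
Proof.
move=> h; have c0 := cos_gt0_piquarter h.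
have x0 : 0 <= x by case/andP: h.
rewrite -(@ler_pXn2r _ 2)// ?nnegrE ?exprn_ge0 ?(ltW c0) ?expR_ge0//.
rewrite -exprM mulnC exprM -expRM_natl.
have -> : 2 * - (n%:R * x ^+ 2 / 8) = n%:R * (- (x ^+ 2 / 4)) by field.
rewrite expRM_natl; apply: lerXn2r; rewrite ?nnegrE ?sqr_ge0 ?expR_ge0//.
apply: le_trans (expR_ge1Dx _).
have := sin_ge_half h; rewrite cos2sin2 => s1.
rewrite lerD2l lerN2.
have -> : x ^+ 2 / 4 = (x / 2) ^+ 2 by field.
by rewrite lerXn2r// nnegrE ?divr_ge0// (le_trans _ s1)// divr_ge0.
Qed.

End Trigonometric_bounds.

(** * Factorial decay of the coefficients and geometric sums *)

Section Factorial_bounds.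
Variable R : realType.
Implicit Types x : R.

Lemma fact_sqrt_gt0 k : 0 < Num.sqrt (k`!%:R : R).
Proof. by rewrite sqrtr_gt0 ltr0n fact_gt0. Qed.

Lemma sqbin_le n k x : 0 <= x ->
  sqbin R n k * x ^+ k <= (Num.sqrt n%:R * x) ^+ k / Num.sqrt k`!%:R.
Proof.
move=> x0; rewrite exprMn mulrAC ler_wpM2r ?exprn_ge0//.
rewrite ler_pdivlMr ?fact_sqrt_gt0//.
rewrite -(@ler_pXn2r _ 2)// ?nnegrE ?mulr_ge0 ?exprn_ge0 ?sqrtr_ge0//.
rewrite exprMn /sqbin !sqr_sqrtr// -exprM mulnC exprM sqr_sqrtr//.
rewrite -natrX -natrM ler_nat bin_ffact.
elim: k => [|k IHk] //.
by rewrite ffactnSr expnSr leq_mul// leq_subr.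
Qed.

Lemma pow_sqrt_fact_le k x : 0 <= x -> x ^+ k / Num.sqrt k`!%:R <= expR (x ^+ 2 / 2).
Proof.
move=> x0.
rewrite -(@ler_pXn2r _ 2)// ?nnegrE ?divr_ge0 ?exprn_ge0 ?expR_ge0 ?sqrtr_ge0//.
rewrite expr_div_n sqr_sqrtr// -expRM_natl -exprM mulnC exprM.
have -> : 2 * (x ^+ 2 / 2) = x ^+ 2 by field.
case: k => [|k].
  by rewrite expr0 fact0 divr1 -[leLHS]expR0 ler_expR sqr_ge0.
apply: le_trans (expR_ge1Dxn k (sqr_ge0 x)).
by rewrite lerDr.
Qed.

Lemma le_1D_pow2 k : (k.+1%:R : R) <= 2 ^+ k.
Proof. by rewrite -natrX ler_nat; exact: ltn_expl. Qed.

(** The weight 2^k bounds a binomial coefficient and k + 1 is the growth granted to the k-th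
    Gaussian coefficient. With k + 1 <= 2^k and a factor 4^k set aside, x becomes 16 x, and 128 =
    16^2 / 2. *)
Lemma weighted_term_le k x : 0 <= x ->
  2 ^+ k * k.+1%:R * (x ^+ k / Num.sqrt k`!%:R) <= expR (128 * x ^+ 2) * 4^-1 ^+ k.
Proof.
move=> x0.
apply: (@le_trans _ _ (2 ^+ k * 2 ^+ k * (x ^+ k / Num.sqrt k`!%:R))).
  rewrite ler_wpM2r ?divr_ge0 ?exprn_ge0 ?sqrtr_ge0// ler_wpM2l ?exprn_ge0//.
  exact: le_1D_pow2.
have -> : 2 ^+ k * 2 ^+ k * (x ^+ k / Num.sqrt k`!%:R) =
    ((16 * x) ^+ k / Num.sqrt k`!%:R) * 4^-1 ^+ k :> R.
  rewrite mulrA [RHS]mulrAC; congr (_ / _).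
  by rewrite -!exprMn; congr (_ ^+ _); field.
rewrite ler_wpM2r ?exprn_ge0 ?invr_ge0//.
apply: (le_trans (pow_sqrt_fact_le _ _)); first by rewrite mulr_ge0.
by rewrite ler_expR; lra.
Qed.

Lemma sum_geo4 N m : \sum_(k < N | (m <= k)%N) (4^-1 : R) ^+ k <= 2 * 4^-1 ^+ m.
Proof.
have h a : 0 <= (4^-1 : R) ^+ a by rewrite exprn_ge0// invr_ge0.
suff : (m <= N)%N -> \sum_(k < N | (m <= k)%N) (4^-1 : R) ^+ k + 2 * 4^-1 ^+ N <= 2 * 4^-1 ^+ m.
  case: (leqP m N) => [mN /(_ isT)|Nm _].
    by apply: le_trans; rewrite lerDl mulr_ge0.
  rewrite big1 ?mulr_ge0// => k mk.
  by have := leq_trans Nm mk; rewrite ltnNge (ltnW (ltn_ord k)).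
elim: N => [|N IHN] mN.
  by rewrite big_ord0 add0r; move: mN; rewrite leqn0 => /eqP ->.
move: mN; rewrite leq_eqVlt => /orP[/eqP ->|mN].
  rewrite big1 ?add0r// => k mk.
  by have := leq_trans (ltn_ord k) mk; rewrite ltnn.
rewrite big_mkcond big_ord_recr/= -big_mkcond/= -ltnS mN.
have := IHN mN; have := h N; rewrite exprSr; lra.
Qed.

(** The constant of [weighted_term_le] at x = 32, doubled for the geometric sum. A cell has length
    at most 16 n^(-1/2) and tan at most doubles it, whence 32. *)
Definition K0 : R := 2 * expR (128 * 32 ^+ 2).

Lemma K0_gt0 : 0 < K0. Proof. by rewrite mulr_gt0// expR_gt0. Qed.

Lemma weighted_sum_le N m (b a : 'I_N -> R) (B : R) :
  (forall k, 0 <= b k <= B ^+ k / Num.sqrt k`!%:R) ->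
  0 <= B <= 32 ->
  (forall k : 'I_N, (m <= k)%N -> 0 <= a k <= 2 ^+ k * k.+1%:R) ->
  \sum_(k < N | (m <= k)%N) a k * b k <= K0 * 4^-1 ^+ m.
Proof.
move=> bB /andP[B0 B32] a0.
have K : K0 * 4^-1 ^+ m = expR (128 * 32 ^+ 2) * (2 * 4^-1 ^+ m).
  by rewrite /K0 [2 * expR _]mulrC -mulrA.
rewrite K; apply: (@le_trans _ _ (expR (128 * 32 ^+ 2) * \sum_(k < N | (m <= k)%N) (4^-1 : R) ^+ k)); last first.
  by rewrite ler_wpM2l ?expR_ge0// sum_geo4.
rewrite mulr_sumr; apply: ler_sum => k mk.
apply: (@le_trans _ _ (2 ^+ k * k.+1%:R * (32 ^+ k / Num.sqrt k`!%:R))).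
  have /andP[b1 b2] := bB k; have /andP[a1 a2] := a0 k mk.
  apply: ler_pM => //; apply: (le_trans b2).
  by rewrite ler_wpM2r ?invr_ge0 ?sqrtr_ge0// lerXn2r// nnegrE.
by apply: (le_trans (weighted_term_le _ _)).
Qed.

Lemma pow_le_expR (k : nat) (c : R) : 0 < c -> exists r0 : nat, forall r : nat, (r0 <= r)%N ->
  r%:R ^+ k <= expR (c * r%:R).
Proof.
move=> c0; pose b : R := (k.+1)`!%:R / c ^+ k.+1.
have b0 : 0 <= b by rewrite divr_ge0// exprn_ge0// ltW.
exists (Num.truncn b).+1 => r r0r.
have br : b <= r%:R.
  apply: ltW; apply: (lt_le_trans (_ : b < (Num.truncn b).+1%:R)).
    by have /andP[] := truncn_itv b0.
  by rewrite ler_nat.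
apply: le_trans (_ : 1 + (c * r%:R) ^+ k.+1 / (k.+1)`!%:R <= _); last first.
  by apply: expR_ge1Dxn; rewrite mulr_ge0// ltW.
apply: (@le_trans _ _ ((c * r%:R) ^+ k.+1 / (k.+1)`!%:R)); last by rewrite lerDr.
rewrite exprMn [r%:R ^+ k.+1]exprS.
have -> : c ^+ k.+1 * (r%:R * r%:R ^+ k) / (k.+1)`!%:R = (r%:R / b) * r%:R ^+ k.
  by rewrite /b; field; rewrite expf_neq0 ?gt_eqF//= ltr0n fact_gt0.
have bp : 0 < b by rewrite divr_gt0 ?exprn_gt0// ltr0n fact_gt0.
by rewrite ler_peMl ?exprn_ge0// ler_pdivlMr// mul1r.
Qed.

End Factorial_bounds.

(** * Concentration and expectations *)

Section Chernoff.
Variable R : realType.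

(** exp x <= 1 / (1 - x), and (1 - x) (1 + x + 2 x^2) = 1 + x^2 (1 - 2 x) >= 1. *)
Lemma expR_le_quadratic (x : R) : x <= 2^-1 -> expR x <= 1 + x + 2 * x ^+ 2.
Proof.
move=> x2.
have h : 0 < 1 - x by lra.
have : expR x <= (1 - x)^-1.
  rewrite -[expR x]invrK lef_pV2 ?posrE ?invr_gt0 ?expR_gt0// -expRN.
  by have := expR_ge1Dx (- x).
move=> /le_trans; apply.
rewrite -div1r ler_pdivrMr// expr2.
have : 0 <= x * x by rewrite -expr2 sqr_ge0.
nra.
Qed.

Definition fmean (K : nat) (p : 'I_K.+1 -> R) : R := \sum_(v < K.+1) v%:R * p v.

(** Stated as a sum over vectors of values weighted by products of laws: independence enters only as
    a product of weights. The sign of s selects the upper or the lower tail. *)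
Lemma chernoff_finite (m K : nat) (p : 'I_m -> 'I_K.+1 -> R) (s a : R) :
  (forall c v, 0 <= p c v) -> (forall c, \sum_v p c v = 1) ->
  `|s| * K%:R <= 2^-1 ->
  \sum_(v : {ffun 'I_m -> 'I_K.+1} | a <= s * \sum_c ((v c)%:R - fmean (p c))) \prod_c p c (v c)
    <= expR (- a + m%:R * (2 * s ^+ 2 * K%:R ^+ 2)).
Proof.
move=> p0 p1 sK; pose mean c := fmean (p c); rewrite -/(mean _).
have mean01 c : 0 <= mean c <= K%:R.
  apply/andP; split; first by apply: sumr_ge0 => v _; rewrite mulr_ge0.
  have -> : K%:R = \sum_v K%:R * p c v by rewrite -mulr_sumr p1 mulr1.
  apply: ler_sum => v _.
  by rewrite ler_wpM2r// ler_nat -ltnS.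
have dev c (v : 'I_K.+1) : `|v%:R - mean c| <= K%:R.
  have /andP[h1 h2] := mean01 c.
  have h3 : (v%:R : R) <= K%:R by rewrite ler_nat -ltnS.
  have h4 : (0 : R) <= v%:R by [].
  by rewrite ler_norml; lra.
have factor c : \sum_v p c v * expR (s * (v%:R - mean c)) <= expR (2 * s ^+ 2 * K%:R ^+ 2).
  apply: (@le_trans _ _ (\sum_v p c v * (1 + s * (v%:R - mean c) + 2 * s ^+ 2 * K%:R ^+ 2))).
    apply: ler_sum => v _; rewrite ler_wpM2l//.
    have sx : `|s * (v%:R - mean c)| <= `|s| * K%:R by rewrite normrM ler_wpM2l.
    apply: (le_trans (expR_le_quadratic _)).
      by rewrite (le_trans (ler_norm _))// (le_trans sx).
    rewrite lerD2l -mulrA ler_wpM2l// -exprMn.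
    rewrite -[leLHS]real_normK ?num_real// -[leRHS]real_normK ?num_real//.
    rewrite lerXn2r ?nnegrE//.
    by rewrite (le_trans sx)// normrM ler_wpM2l// ler_norm.
  under eq_bigr do rewrite 2!mulrDr mulr1.
  rewrite 2!big_split/= p1 -mulr_suml p1 mul1r.
  have -> : \sum_v p c v * (s * (v%:R - mean c)) = 0.
    transitivity (s * (mean c - mean c * \sum_v p c v)); last by rewrite p1 mulr1 subrr mulr0.
    have mE : mean c = \sum_(v < K.+1) v%:R * p c v by [].
    rewrite [X in X - _]mE mulr_sumr -sumrB mulr_sumr; clearbody mean.
    by apply: eq_bigr => v _; ring.
  by rewrite addr0; exact: expR_ge1Dx.
(* Markov's inequality: the exponential factor is at least 1 on the selected vectors. *)
apply: (@le_trans _ _ (\sum_(v : {ffun 'I_m -> 'I_K.+1})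
   expR (- a) * \prod_c (p c (v c) * expR (s * ((v c)%:R - mean c))))).
  rewrite big_mkcond/=; apply: ler_sum => v _.
  have prod0 : 0 <= \prod_c p c (v c) by apply: prodr_ge0.
  case: ifP => [h|_]; last first.
    by rewrite mulr_ge0 ?expR_ge0// prodr_ge0// => c _; rewrite mulr_ge0 ?expR_ge0.
  rewrite big_split/= mulrCA -expR_sum -mulr_sumr -[leLHS]mulr1 ler_wpM2l// -expRD.
  by rewrite -[leLHS]expR0 ler_expR addrC subr_ge0.
rewrite -mulr_sumr expRD ler_wpM2l ?expR_ge0//.
rewrite -(bigA_distr_bigA (fun c v => p c v * expR (s * (v%:R - mean c)))) /=.
rewrite expRM_natl -[X in _ ^+ X](card_ord m) -prodr_const.
apply: ler_prod => c _; rewrite factor andbT.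
by apply: sumr_ge0 => v _; rewrite mulr_ge0 ?expR_ge0.
Qed.

End Chernoff.

Section Integral_squeeze.
Context d (T : measurableType d) (R : realType) (P : probability T R).

(* The number of zeros is never shown to be measurable: its expectation is
   squeezed between those of finite sums of indicators. *)
Lemma le_integral_nonmeasurable (f g : T -> \bar R) : (forall w, 0 <= f w)%E ->
  (forall w, f w <= g w)%E -> (\int[P]_w f w <= \int[P]_w g w)%E.
Proof.
move=> f0 fg; have g0 w : (0 <= g w)%E by exact: le_trans (fg w).
rewrite !ge0_integralTE//.
apply: ereal_sup_le => _ [h hf <-]; exists h => // w.
exact: le_trans (hf w) (fg w).
Qed.

Definition indb (A : set T) (w : T) : nat := (w \in A).

Lemma integral_sum_indb (I : finType) (A : I -> set T) : (forall i, measurable (A i)) ->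
  (\int[P]_w (((\sum_i indb (A i) w)%N)%:R : R)%:E = (\sum_i pr P (A i))%:E)%E.
Proof.
move=> mA.
transitivity (\int[P]_w (\sum_i (\1_(A i) w)%:E))%E.
  by apply: eq_integral => w _; rewrite natr_sum -sumEFin.
rewrite ge0_integral_sum//; last by move=> i; apply/measurable_EFinP; exact: measurable_indic.
rewrite -sumEFin; apply: eq_bigr => i _.
by rewrite integral_indic// setIT; exact: prE.
Qed.

Lemma expectation_nat_le (N : T -> nat) (I : finType) (A : I -> set T) :
  (forall i, measurable (A i)) -> (forall w, (N w <= \sum_i indb (A i) w)%N) ->
  ('E_P[fun w => (N w)%:R : R] <= (\sum_i pr P (A i))%:E)%E.
Proof.
move=> mA h; rewrite -integral_sum_indb// expectation.unlock.
by apply: le_integral_nonmeasurable => w; rewrite lee_fin ?ler_nat.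
Qed.

Lemma expectation_nat_ge (N : T -> nat) (I : finType) (A : I -> set T) :
  (forall i, measurable (A i)) -> (forall w, (\sum_i indb (A i) w <= N w)%N) ->
  ((\sum_i pr P (A i))%:E <= 'E_P[fun w => (N w)%:R : R])%E.
Proof.
move=> mA h; rewrite -integral_sum_indb// expectation.unlock.
by apply: le_integral_nonmeasurable => w; rewrite lee_fin ?ler_nat.
Qed.

Lemma indbE (A : set T) w : A w -> indb A w = 1%N.
Proof. by move=> Aw; rewrite /indb mem_set. Qed.

Lemma indbN (A : set T) w : ~ A w -> indb A w = 0%N.
Proof. by move=> Aw; rewrite /indb memNset. Qed.

End Integral_squeeze.

(** * Concentration of sums of independent capped counts *)

Section Capped_sum_concentration.
Context d (T : measurableType d) (R : realType) (P : probability T R).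
Variables (N : nat) (Y : 'I_N -> T -> R).
Hypothesis Yi : gauss_iid P Y.

(** The mean of a variable bounded by K as a sum of tail probabilities: being a finite sum of
    probabilities of events, it can be compared with an expectation squeezed between sums of
    indicators. *)
Definition tmean (K : nat) (X : T -> nat) : R := \sum_(v < K) pr P [set w | (v < X w)%N].

Lemma pr_pred_sum (K : nat) (X : T -> nat) (q : pred nat) : (forall w, (X w <= K)%N) ->
  (forall v, measurable [set w | X w = v]) ->
  measurable [set w | q (X w)] /\
  pr P [set w | q (X w)] = \sum_(v < K.+1 | q v) pr P [set w | X w = v].
Proof.
move=> XK mX.
pose A (v : 'I_K.+1) := if q v then [set w | X w = v] else set0.
have mA v : measurable (A v) by rewrite /A; case: ifP.
have E : [set w | q (X w)] = [set w | exists v, A v w].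
  apply/seteqP; split => w /=.
    move=> qw; have XK1 : (X w < K.+1)%N by rewrite ltnS.
    by exists (Ordinal XK1); rewrite /A /= qw.
  by move=> [v]; rewrite /A; case: ifP => // qv /= ->.
have mq : measurable [set w | q (X w)] by rewrite E; exact: measurable_exists.
split => //; apply: EFin_inj.
have -> : \sum_(v < K.+1 | q v) pr P [set w | X w = v] = \sum_(v < K.+1) pr P (A v).
  rewrite big_mkcond; apply: eq_bigr => v _; rewrite /A; case: ifP => // _.
  by rewrite /pr measure0.
rewrite -integral_sum_indb//.
have := @integral_sum_indb _ _ _ P 'I_1 (fun=> [set w | q (X w)]) (fun=> mq).
rewrite big_ord1 => <-; apply: eq_integral => w _; rewrite big_ord1; congr (_%:R%:E).
have XK1 : (X w < K.+1)%N by rewrite ltnS.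
rewrite (bigD1 (Ordinal XK1))//= big1 ?addn0 => [|v vX].
  rewrite /indb; congr nat_of_bool; apply/idP/idP; rewrite !inE /A/=; first by move=> ->.
  by case: ifP.
apply: indbN; rewrite /A; case: ifP => [_ /= e|_ []]; move/eqP: vX; apply.
by apply/val_inj.
Qed.

Lemma tmeanE (K : nat) (X : T -> nat) : (forall w, (X w <= K)%N) ->
  (forall v, measurable [set w | X w = v]) ->
  tmean K X = \sum_(v < K.+1) v%:R * pr P [set w | X w = v].
Proof.
move=> XK mX; rewrite /tmean.
transitivity (\sum_(v < K) \sum_(u < K.+1) (v < u)%N%:R * pr P [set w | X w = u]).
  apply: eq_bigr => v _.
  rewrite (@pr_pred_sum K X (fun u => v < u)%N XK mX).2 big_mkcond/=.
  by apply: eq_bigr => u _; case: ifP; rewrite ?mul1r ?mul0r.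
rewrite exchange_big/=; apply: eq_bigr => u _; rewrite -mulr_suml -natr_sum; congr (_%:R * _).
have uK : (u <= K)%N by rewrite -ltnS.
rewrite -[RHS]card_ord -sum1_card (big_ord_widen K (fun=> 1%N) uK) [RHS]big_mkcond/=.
by apply: eq_bigr => v _; case: ifP.
Qed.

Lemma sum_pr_eq1 (K : nat) (X : T -> nat) : (forall w, (X w <= K)%N) ->
  (forall v, measurable [set w | X w = v]) -> \sum_(v < K.+1) pr P [set w | X w = v] = 1.
Proof.
move=> XK mX; rewrite -(@pr_pred_sum K X xpredT XK mX).2.
by rewrite (_ : [set w | _] = setT)/pr ?probability_setT//; apply/seteqP; split.
Qed.

(** The event is a union over the admissible vectors of values; [blocks_indep] turns the probability
    of each into the product of weights summed in [chernoff_finite]. *)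
Lemma capped_sum_tail (m K : nat) (W : nat -> {set 'I_N}) (X : nat -> T -> nat) (s a : R) :
  (forall i j, (i < m)%N -> (j < m)%N -> i != j -> forall k, k \in W i -> k \notin W j) ->
  (forall c v, (c < m)%N -> sigma Y (W c) [set w | X c w = v]) ->
  (forall c w, (X c w <= K)%N) ->
  `|s| * K%:R <= 2^-1 ->
  pr P [set w | a <= s * \sum_(c < m) ((X c w)%:R - tmean K (X c))]
    <= expR (- a + m%:R * (2 * s ^+ 2 * K%:R ^+ 2)).
Proof.
move=> disW sX XK sK.
have mX (c : nat) v : (c < m)%N -> measurable [set w | X c w = v].
  by move=> cm; apply: (sigma_measurable Yi (sX c v cm)).
pose p (c : 'I_m) (v : 'I_K.+1) := pr P [set w | X c w = v].
have p0 c v : 0 <= p c v by exact: pr_ge0.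
have p1 c : \sum_v p c v = 1 by apply: sum_pr_eq1 => // v; exact: mX.
have := @chernoff_finite R m K p s a p0 p1 sK.
apply: le_trans.
have tE (c : 'I_m) : tmean K (X c) = \sum_(v < K.+1) v%:R * p c v.
  by apply: tmeanE => // v; exact: mX.
pose mean c := fmean (p c).
pose cond (v : {ffun 'I_m -> 'I_K.+1}) := a <= s * \sum_c ((v c)%:R - mean c).
pose E (v : {ffun 'I_m -> 'I_K.+1}) (c : nat) : set T :=
  if insub c is Some i then [set w | X c w = v i] else setT.
pose F v := if cond v then [set w | forall c, (c < m)%N -> E v c w] else set0.
have EE v (c : 'I_m) : E v c = [set w | X c w = v c] by rewrite /E valK.
have sE v c : (c < m)%N -> sigma Y (W c) (E v c).
  by move=> cm; rewrite -[c]/(val (Ordinal cm)) EE; exact: sX.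
have mF0 v : measurable [set w | forall c, (c < m)%N -> E v c w].
  rewrite (_ : [set w | _] = [set w | forall c : 'I_m, E v c w]).
    by apply: measurable_forall => c; rewrite EE; exact: mX.
  by apply/seteqP; split => w /= h c => [|cm]; [exact: h|exact: (h (Ordinal cm))].
have mF v : measurable (F v) by rewrite /F; case: ifP.
apply: (@le_trans _ _ (pr P [set w | exists v, F v w])).
  have sub : [set w | a <= s * \sum_(c < m) ((X c w)%:R - tmean K (X c))] = [set w | exists v, F v w].
    apply/seteqP; split => w /=.
      move=> aw; exists [ffun c : 'I_m => inord (X c w)]; rewrite /F.
      have -> : cond [ffun c : 'I_m => inord (X c w)].
        rewrite /cond (_ : \sum_c _ = \sum_(c < m) ((X c w)%:R - tmean K (X c)))//.
        by apply: eq_bigr => c _; rewrite ffunE inordK ?ltnS// tE.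
      move=> /= c cm; rewrite -[c]/(val (Ordinal cm)) EE /= ffunE inordK//.
      by rewrite ltnS.
    move=> [v]; rewrite /F; case: ifP => // cv /= h.
    move: cv; rewrite /cond (_ : \sum_c _ = \sum_(c < m) ((X c w)%:R - tmean K (X c)))//.
    by apply: eq_bigr => c _; rewrite tE; have := h c (ltn_ord c); rewrite EE/= => ->.
  by rewrite sub.
apply: (le_trans (pr_exists P mF)).
rewrite [leRHS]big_mkcond/=; apply: ler_sum => v _.
rewrite /F -/(cond v); case: ifP => _; last by rewrite /pr measure0.
rewrite /pr (blocks_indep Yi disW (fun c cm => sE v c cm)).
rewrite (_ : (\prod_(i < m) P (E v i))%E = (\prod_(i < m) p i (v i))%:E)//.
rewrite (eq_bigr (fun i : 'I_m => (p i (v i))%:E)) => [|i _].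
  by elim/big_rec2: _ => // i x y _ ->.
by rewrite EE prE//; exact: mX.
Qed.

End Capped_sum_concentration.

(** * Deterministic count of the zeros in a quarter of the interval *)

Section Cells.
Variables (R : realType) (n : nat).
Implicit Types (y : 'I_n.+1 -> R) (tau de t u : R).

(* The polynomial of a cell of angular length de, in the coordinate
   z = tan u / tan de that maps the cell onto [0, 1]. *)
Definition spoly de y : {poly R} :=
  \poly_(k < n.+1) (y (inord k) * (sqbin R n k * tan de ^+ k)).

Lemma horner_spoly de y z :
  (spoly de y).[z] = \sum_(k < n.+1) y k * (sqbin R n k * tan de ^+ k) * z ^+ k.
Proof. by rewrite horner_poly; apply: eq_bigr => k _; rewrite inord_val. Qed.

Lemma coef_spoly de y (k : 'I_n.+1) : (spoly de y)`_k = y k * (sqbin R n k * tan de ^+ k).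
Proof. by rewrite coef_poly ltn_ord inord_val. Qed.

Lemma size_spoly de y : (size (spoly de y) <= n.+1)%N.
Proof. exact: size_poly. Qed.

Lemma coef0_spoly de y : (spoly de y)`_0 = y ord0.
Proof.
by rewrite -[0%N]/(val (ord0 : 'I_n.+1)) coef_spoly /sqbin bin0 sqrtr1 expr0 !mulr1.
Qed.

Lemma tan_gt0_piquarter de : 0 < de <= pi / 4 -> 0 < tan de.
Proof.
move=> /andP[d0 d4]; have h : 0 <= de <= pi / 4 by rewrite ltW.
by have /andP[+ _] := tan_bounds h; apply: lt_le_trans.
Qed.

Lemma ftrig_spoly tau de y u : 0 < de <= pi / 4 -> 0 <= u <= de ->
  ftrig y (tau + u) = cos u ^+ n * (spoly de (rotv tau y)).[tan u / tan de].
Proof.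
move=> hde /andP[u0 ude]; have /andP[d0 d4] := hde.
have cu : cos u != 0 by rewrite gt_eqF// cos_gt0_piquarter// u0 (le_trans ude).
rewrite ftrig_rot// ftrig_ellp// horner_ellp horner_spoly; congr (_ * _).
have : tan de != 0 by rewrite gt_eqF// tan_gt0_piquarter.
move: (tan u) (tan de) => a b b0.
apply: eq_bigr => k _; rewrite expr_div_n -!mulrA; congr (_ * (_ * _)).
by rewrite mulrCA divff ?mulr1// expf_neq0.
Qed.

Lemma tan_ratio01 de u : 0 < de <= pi / 4 -> 0 <= u <= de -> 0 <= tan u / tan de <= 1.
Proof.
move=> hde /andP[u0 ude]; have /andP[d0 d4] := hde.
have td := tan_gt0_piquarter hde.
have /andP[tu _] : u <= tan u <= 2 * u by apply: tan_bounds; rewrite u0 (le_trans ude).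
apply/andP; split; first by apply: divr_ge0; [exact: le_trans tu|exact: ltW].
rewrite ler_pdivrMr// mul1r.
move: ude; rewrite le_eqVlt => /orP[/eqP ->//|ude]; apply: ltW.
by rewrite ltr_tan// in_itv/=; have := pi_gt0 R; lra.
Qed.

Section Cell.
Variables (tau de : R) (y : 'I_n.+1 -> R).
Hypothesis hde : 0 < de <= pi / 4.
Let p := spoly de (rotv tau y).
Let zmap (t : R) := tan (t - tau) / tan de.

Let zmap_inj : {in [pred t | tau <= t <= tau + de] &, injective zmap}.
Proof.
move=> s t; rewrite !inE => /andP[s0 s1] /andP[t0 t1] /(mulIf _) h.
have td : (tan de)^-1 != 0 by rewrite invr_eq0 gt_eqF// tan_gt0_piquarter.
have := h td; have := pi_gt0 R; move: hde => /andP[d0 d4] pi0.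
move=> /tan_inj; rewrite !in_itv/= => e.
have : s - tau = t - tau by apply: e; lra.
lra.
Qed.

Let zmap01 t : tau <= t <= tau + de -> 0 <= zmap t <= 1.
Proof. by move=> h; apply: tan_ratio01 => //; lra. Qed.

Lemma root_zmap t : tau <= t <= tau + de -> (ftrig y t == 0) = root p (zmap t).
Proof.
move=> h; have -> : ftrig y t = cos (t - tau) ^+ n * p.[zmap t].
  have {1}-> : t = tau + (t - tau) by lra.
  by apply: ftrig_spoly => //; lra.
rewrite mulf_eq0 expf_eq0; have -> : (cos (t - tau) == 0) = false.
  by apply/negbTE; rewrite gt_eqF// cos_gt0_piquarter//; move: hde; lra.
by rewrite andbF.
Qed.

Lemma cell_roots (zs : seq R) : uniq zs ->
  {in zs, forall t, tau <= t <= tau + de /\ ftrig y t = 0} ->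
  [/\ uniq (map zmap zs), all (root p) (map zmap zs) & {in map zmap zs, forall z, 0 <= z <= 1}].
Proof.
move=> uzs h; split.
- rewrite map_inj_in_uniq// => s t /h[hs _] /h[ht _]; exact: zmap_inj.
- apply/allP => _ /mapP[t /h[ht ft] ->]; by rewrite -root_zmap// ft.
- by move=> _ /mapP[t /h[ht _] ->]; exact: zmap01.
Qed.

Lemma cell_count_wnorm (zs : seq R) m : uniq zs ->
  {in zs, forall t, tau <= t <= tau + de /\ ftrig y t = 0} -> (m <= size zs)%N ->
  `|rotv tau y ord0| <= wnorm n.+1 m p.
Proof.
move=> uzs h mzs; have [h1 h2 h3] := cell_roots uzs h.
rewrite -(coef0_spoly de); apply: (@coef0_le_wnorm_roots _ _ _ (map zmap zs)) => //.
- exact: size_spoly.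
- by move=> z /h3 /andP[z0 z1]; rewrite ger0_norm.
- by rewrite size_map.
Qed.

(* Two zeros in the cell, counted with multiplicity, force this event, whose
   probability is quadratic in the size of the second order coefficients. *)
Definition double_zero : Prop :=
  `|rotv tau y ord0| <= wnorm n.+1 2 p /\ `|p`_1| <= 2 * wnorm n.+1 2 p.

Let p0E : p.[0] = ftrig y tau.
Proof.
have h : 0 <= (0 : R) <= de by rewrite lexx ltW//; case/andP: hde.
have := ftrig_spoly tau y hde h.
by rewrite addr0 cos0 expr1n mul1r tan0 mul0r.
Qed.

Let p1E : ftrig y (tau + de) = cos de ^+ n * p.[1].
Proof.
have h : 0 <= de <= de by rewrite lexx ltW//; case/andP: hde.
by rewrite (ftrig_spoly tau y hde h) divff// gt_eqF// tan_gt0_piquarter.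
Qed.

Let cde : 0 < cos de ^+ n.
Proof. by rewrite exprn_gt0// cos_gt0_piquarter//; case/andP: hde => /ltW -> ->. Qed.

Let sgnE : (p.[0] * p.[1] < 0) = (ftrig y tau * ftrig y (tau + de) < 0).
Proof. by rewrite p0E p1E mulrCA [RHS]pmulr_rlt0. Qed.

Lemma cell_sign_change : ftrig y tau * ftrig y (tau + de) < 0 ->
  exists2 t, tau < t < tau + de & ftrig y t = 0.
Proof.
rewrite -sgnE => /sign_change_root[z /andP[z0 z1] rz].
have td := tan_gt0_piquarter hde.
have zt : 0 < z * tan de by rewrite mulr_gt0.
pose u := atan (z * tan de).
have tu : tan u = z * tan de by rewrite atanK.
have u0 : 0 < u by rewrite -(atan0 R) lt_atan.
have ude : u < de.
  rewrite -[de]tanK; last by rewrite in_itv/=; have := pi_gt0 R; move: hde; lra.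
  by rewrite lt_atan// gtr_pMl.
exists (tau + u); first by rewrite ltrDl u0 ltrD2l.
have ht : tau <= tau + u <= tau + de by rewrite lerDl lerD2l !ltW.
apply/eqP; rewrite (root_zmap ht) /zmap [tau + u]addrC addrK tu mulfK//.
by rewrite gt_eqF.
Qed.

Lemma cell_count_sign_change (zs : seq R) : (0 < n)%N -> ~ double_zero ->
  ftrig y tau != 0 -> ftrig y (tau + de) != 0 -> uniq zs ->
  (forall t, t \in zs = (tau <= t < tau + de) && (ftrig y t == 0)) ->
  size zs = (ftrig y tau * ftrig y (tau + de) < 0) :> nat.
Proof.
move=> n0 nd f0 f1 uzs hzs.
have h : {in zs, forall t, tau <= t <= tau + de /\ ftrig y t = 0}.
  by move=> t; rewrite hzs => /andP[/andP[-> /ltW ->] /eqP ->].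
have [h1 h2 h3] := cell_roots uzs h.
have n2 : ~ two_roots p.
  move=> t2; apply: nd.
  by have := two_roots_coef (size_spoly _ _) (_ : (1 < n.+1)%N) t2; rewrite coef0_spoly; apply.
have pn0 : p.[0] != 0 by rewrite p0E.
have pn1 : p.[1] != 0 by apply: contraNneq f1 => e; rewrite p1E e mulr0.
have := count_roots_sign_change n2 pn0 pn1 h1 h2 h3.
rewrite size_map sgnE => le1.
move: le1; case sc: (_ < 0) => le1; last by move: le1 => /=; rewrite leqn0 => /eqP.
apply/eqP; rewrite eqn_leq le1 /=.
have [t /andP[t0 t1] ft] := cell_sign_change sc.
have : t \in zs by rewrite hzs ft eqxx (ltW t0) t1.
by case: (zs).
Qed.

End Cell.

End Cells.

Section Sequences.

Lemma count_itv_sum (R : realType) (g : nat -> R) (m : nat) (zs : seq R) :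
  {homo g : i j / (i <= j)%N >-> i <= j} ->
  (\sum_(i < m) count (fun z => (g i <= z)%R && (z < g i.+1)%R) zs =
   count (fun z => (g 0 <= z)%R && (z < g m)%R) zs)%N.
Proof.
move=> gm; elim: m => [|m IHm].
  rewrite big_ord0 (@eq_count _ _ pred0) ?count_pred0// => z /=.
  by case: leP => // h; rewrite ltNge h.
rewrite big_ord_recr/= IHm -count_predUI [X in (_ + X)%N](_ : _ = 0%N) ?addn0.
  apply: eq_count => z /=.
  have [zm|mz] := ltP z (g m); rewrite ?andbT ?andbF/= ?orbF.
    have -> : z < g m.+1 by rewrite (lt_le_trans zm)// gm.
    by rewrite andbT.
  by rewrite (le_trans _ mz)// gm.
rewrite (@eq_count _ _ pred0) ?count_pred0// => z /=.
by have [zm|mz] := ltP z (g m); rewrite ?andbF ?andbT//= lt_geF ?andbF.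
Qed.

(** Discrete intermediate value theorem. *)
Lemma sign_change_sum_gt0 (R : realType) (f : nat -> R) (m : nat) :
  (forall i, (i <= m)%N -> f i != 0) -> f 0%N * f m < 0 ->
  (0 < \sum_(i < m) (f i * f i.+1 < 0)%R)%N.
Proof.
elim: m => [|m IHm] f0 fm.
  by move: fm; rewrite -expr2 ltNge sqr_ge0.
rewrite big_ord_recr/=; have [h|h] := ltP (f m * f m.+1) 0; first by rewrite addn1.
rewrite addn0; apply: IHm => [i im|]; first by apply: f0; exact: leqW.
have fm0 : f m * f m.+1 != 0 by rewrite mulf_neq0// f0.
have pos : 0 < f m * f m.+1 by rewrite lt_neqAle eq_sym fm0.
have pos2 : 0 < f m.+1 ^+ 2 by rewrite lt_neqAle sqr_ge0 eq_sym sqrf_eq0 f0.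
have : (f 0%N * f m.+1) * (f m * f m.+1) < 0 by rewrite nmulr_rlt0.
by rewrite mulrACA -expr2 pmulr_llt0.
Qed.

End Sequences.

(** * Cells, fine cells and windows of a quarter *)

Section Quarter.
Variables (R : realType) (n r : nat) (theta : R).
Hypothesis n0 : (0 < n)%N.
Hypothesis r0 : (0 < r)%N.
Hypothesis th : 0 < theta <= pi / 4.
Implicit Types (y : 'I_n.+1 -> R).

Definition ncell : nat := (r ^ 4)%N.
Definition nfine : nat := (2 ^ r)%N.
Definition clen : R := theta / ncell%:R.
Definition flen : R := clen / nfine%:R.
Definition gpt (g : nat) : R := g%:R * flen.

Lemma ncell_gt0 : (0 < ncell)%N. Proof. by rewrite expn_gt0 r0. Qed.
Lemma nfine_gt0 : (0 < nfine)%N. Proof. by rewrite expn_gt0. Qed.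

Lemma clen_bounds : 0 < clen <= pi / 4.
Proof.
case/andP: th => t0 t4; rewrite divr_gt0 ?ltr0n ?ncell_gt0//=.
apply: le_trans t4; rewrite ler_pdivrMr ?ltr0n ?ncell_gt0// ler_peMr ?(ltW t0)//.
by rewrite ler1n ncell_gt0.
Qed.

Lemma flen_bounds : 0 < flen <= pi / 4.
Proof.
case/andP: clen_bounds => t0 t4; rewrite divr_gt0 ?ltr0n ?nfine_gt0//=.
apply: le_trans t4; rewrite ler_pdivrMr ?ltr0n ?nfine_gt0// ler_peMr ?(ltW t0)//.
by rewrite ler1n nfine_gt0.
Qed.

Lemma gptS g : gpt g.+1 = gpt g + flen.
Proof. by rewrite /gpt -natr1 mulrDl mul1r. Qed.

Lemma gpt0 : gpt 0 = 0. Proof. by rewrite /gpt mul0r. Qed.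

Lemma gpt_cell c : gpt (c.+1 * nfine)%N = gpt (c * nfine)%N + clen.
Proof.
rewrite /gpt /flen !natrM -natr1; field.
by rewrite pnatr_eq0 -lt0n nfine_gt0.
Qed.

Lemma gpt_end : gpt (ncell * nfine)%N = theta.
Proof.
rewrite /gpt /flen /clen natrM; field.
by rewrite !pnatr_eq0 -!lt0n nfine_gt0 ncell_gt0.
Qed.

Lemma gpt_mono : {homo gpt : i j / (i <= j)%N >-> i <= j}.
Proof. by move=> i j ij; rewrite ler_wpM2r ?ler_nat// ltW//; case/andP: flen_bounds. Qed.

Lemma gpt_range g : (g <= ncell * nfine)%N -> 0 <= gpt g <= pi / 4.
Proof.
move=> h; rewrite -{1}gpt0 gpt_mono//= (le_trans (gpt_mono h))// gpt_end.
by case/andP: th.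
Qed.

(** The threshold 8^-r of the windows is a factor 2^r below the tolerance 4^-r for the truncation
    error, which leaves room for polynomially many omitted terms. *)
Definition eps8 : R := 8^-1 ^+ r.
Definition eps4 : R := 4^-1 ^+ r.

(* The windows of two cells at index distance at least r are disjoint, so that
   the corresponding truncated counts are independent. *)
Definition window (c : nat) : {set 'I_n.+1} :=
  [set k : 'I_n.+1 | [exists i : 'I_nfine.+1, eps8 < phi n k (gpt (c * nfine + i)%N)]]%SET.

Definition ftrunc (c : nat) y (t : R) : R := \sum_(k in window c) y k * phi n k t.

(* Capped at r, which makes the Chernoff bound applicable. *)
Definition tcount (c : nat) y : nat :=
  minn (\sum_(i < nfine) (ftrunc c y (gpt (c * nfine + i)%N) * ftrunc c y (gpt (c * nfine + i).+1%N) < 0)%R) r.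

Definition cvec (c : nat) y := rotv (gpt (c * nfine)%N) y.

(* Holds as soon as cell c contains m zeros. *)
Definition many (c m : nat) y : Prop :=
  `|cvec c y ord0| <= wnorm n.+1 m (spoly clen (cvec c y)).

(** The number of zeros is then a function of the truncated counts: zeros of fine cells are sign
    changes, the truncation error stays below the size of f on the grid, and the cap r is never
    reached. *)
Record good y : Prop := Good {
  good_dbl : forall g, (g < ncell * nfine)%N -> ~ double_zero (gpt g) flen y;
  good_ball : forall g, (g <= ncell * nfine)%N -> eps4 < `|ftrig y (gpt g)|;
  good_trunc : forall c i, (c < ncell)%N -> (i <= nfine)%N ->
    `|ftrig y (gpt (c * nfine + i)%N) - ftrunc c y (gpt (c * nfine + i)%N)| <= eps4;
  good_many : forall c, (c < ncell)%N -> ~ many c r.+1 y }.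

Lemma close_same_sign (a b a' b' e : R) : e < `|a| -> e < `|b| ->
  `|a - a'| <= e -> `|b - b'| <= e -> (a * b < 0) = (a' * b' < 0).
Proof.
move=> ea eb aa bb.
have h (x x' : R) : e < `|x| -> `|x - x'| <= e -> (0 < x /\ 0 < x') \/ (x < 0 /\ x' < 0).
  rewrite ler_distl; have [x0|x0] := leP 0 x.
    by rewrite ger0_norm// => ? /andP[? ?]; left; split; lra.
  by rewrite ltr0_norm// => ? /andP[? ?]; right; split; lra.
case: (h _ _ ea aa) => -[a0 a1]; case: (h _ _ eb bb) => -[b0 b1].
- by rewrite (lt_gtF (mulr_gt0 a0 b0)) (lt_gtF (mulr_gt0 a1 b1)).
- by rewrite (pmulr_rlt0 _ a0) (pmulr_rlt0 _ a1) b0 b1.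
- by rewrite (pmulr_llt0 _ b0) (pmulr_llt0 _ b1) a0 a1.
- have p1 : 0 < a * b by rewrite nmulr_rgt0.
  have p2 : 0 < a' * b' by rewrite nmulr_rgt0.
  by rewrite (lt_gtF p1) (lt_gtF p2).
Qed.

Let in_grid c i : (c < ncell)%N -> (i <= nfine)%N -> (c * nfine + i <= ncell * nfine)%N.
Proof.
move=> cm im; apply: (@leq_trans (c.+1 * nfine)%N); last by rewrite leq_mul2r cm orbT.
by rewrite mulSn addnC leq_add2r.
Qed.

Lemma good_sign_change y c i : good y -> (c < ncell)%N -> (i < nfine)%N ->
  (ftrig y (gpt (c * nfine + i)%N) * ftrig y (gpt (c * nfine + i).+1%N) < 0) =
  (ftrunc c y (gpt (c * nfine + i)%N) * ftrunc c y (gpt (c * nfine + i).+1%N) < 0).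
Proof.
move=> gy cm im.
have h1 := in_grid cm (ltnW im); have := in_grid cm im; rewrite addnS => h2.
apply: close_same_sign (good_ball gy h1) (good_ball gy h2) (good_trunc gy cm (ltnW im)) _.
by have := good_trunc gy cm im; rewrite addnS.
Qed.

Lemma good_neq0 y g : good y -> (g <= ncell * nfine)%N -> ftrig y (gpt g) != 0.
Proof.
move=> gy gm; have := good_ball gy gm; apply: contraTneq => ->.
by rewrite normr0 -leNgt exprn_ge0// invr_ge0.
Qed.

Definition czeros y c (zs : seq R) : nat :=
  count (fun z => (gpt (c * nfine)%N <= z) && (z < gpt (c.+1 * nfine)%N)) zs.

Lemma czeros_filter y c zs :
  czeros y c zs = size [seq z <- zs | (gpt (c * nfine)%N <= z) && (z < gpt (c.+1 * nfine)%N)].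
Proof. by rewrite size_filter. Qed.

Lemma sum_czeros y zs : (forall z, z \in zs -> 0 <= z < theta) ->
  size zs = (\sum_(c < ncell) czeros y c zs)%N.
Proof.
move=> h; rewrite (@count_itv_sum _ (fun c => gpt (c * nfine)%N)).
  rewrite mul0n gpt0 gpt_end; apply/esym/eqP; rewrite -all_count.
  by apply/allP => z /h.
by move=> i j ij; apply: gpt_mono; rewrite leq_mul2r ij orbT.
Qed.

Lemma czeros_many y c zs m : uniq zs -> (forall z, z \in zs -> ftrig y z = 0) ->
  (m <= czeros y c zs)%N -> many c m y.
Proof.
move=> uzs fz; rewrite czeros_filter => mz.
apply: (cell_count_wnorm clen_bounds (filter_uniq _ uzs) _ mz).
move=> z; rewrite mem_filter gpt_cell => /andP[/andP[z0 z1] /fz f0].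
by split=> //; rewrite z0 ltW.
Qed.

Lemma good_czeros y c zs : good y -> (c < ncell)%N -> uniq zs ->
  (forall z, z \in zs = (0 <= z < theta) && (ftrig y z == 0)) ->
  czeros y c zs = tcount c y.
Proof.
move=> gy cm uzs hzs.
have E : czeros y c zs = (\sum_(i < nfine) (ftrunc c y (gpt (c * nfine + i)%N) * ftrunc c y (gpt (c * nfine + i).+1%N) < 0)%R)%N.
  have := @count_itv_sum _ (fun i => gpt (c * nfine + i)%N) nfine zs.
  rewrite addn0 -[(c * nfine + nfine)%N]addnC -mulSn -/(czeros y c zs) => <-; last first.
    by move=> i j ij; apply: gpt_mono; rewrite leq_add2l.
  apply: eq_bigr => i _; rewrite -good_sign_change// addnS gptS.
  rewrite -size_filter.
  have gi := in_grid cm (ltn_ord i); rewrite addnS in gi.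
  apply: cell_count_sign_change => //.
  - exact: flen_bounds.
  - exact: good_dbl gy _ gi.
  - by apply: good_neq0 gy (ltnW gi).
  - by rewrite -gptS; apply: good_neq0 gy gi.
  - exact: filter_uniq.
  - move=> z; rewrite mem_filter hzs -gptS.
    case: (boolP (gpt (c * nfine + i)%N <= z < gpt (c * nfine + i).+1)) => //= /andP[z0 z1].
    have /andP[g0 _] := gpt_range (ltnW gi).
    rewrite (le_trans g0 z0)/= (lt_le_trans z1)//.
    by rewrite -gpt_end gpt_mono.
(* More than r zeros in the cell would give [many c r.+1 y], so the minimum with r is harmless. *)
rewrite /tcount -E; apply/esym/minn_idPl; rewrite leqNgt; apply/negP => h.
apply: (good_many gy cm); apply: (czeros_many uzs _ h).
by move=> z; rewrite hzs => /andP[_ /eqP].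
Qed.

Lemma good_size_zeros y zs : good y -> uniq zs ->
  (forall z, z \in zs = (0 <= z < theta) && (ftrig y z == 0)) ->
  size zs = (\sum_(c < ncell) tcount c y)%N.
Proof.
move=> gy uzs hzs; rewrite (sum_czeros y); last by move=> z; rewrite hzs => /andP[].
by apply: eq_bigr => c _; apply: good_czeros.
Qed.

(** A count is the number of m with m + 1 at most equal to it. The bound asks nothing of y, and so
    controls the expectation on the exceptional event. *)
Lemma size_zeros_le y zs : uniq zs -> (size zs <= n.+1)%N ->
  (forall z, z \in zs -> 0 <= z < theta /\ ftrig y z = 0) ->
  (size zs <= \sum_(c < ncell) \sum_(m < n.+1) `[< many c m.+1 y >])%N.
Proof.
move=> uzs szs h; rewrite (sum_czeros y); last by move=> z /h[].
apply: leq_sum => c _.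
have cn : (czeros y c zs <= n.+1)%N by apply: leq_trans szs; exact: count_size.
rewrite -[leqLHS]card_ord -sum1_card (big_ord_widen n.+1 (fun=> 1%N) cn) big_mkcond/=.
apply: leq_sum => m _; case: ifP => // mc.
by rewrite asboolT//; apply: (czeros_many uzs _ mc) => z /h[].
Qed.

Lemma good_tcount_gt0 y c : good y -> (c < ncell)%N ->
  ftrig y (gpt (c * nfine)%N) * ftrig y (gpt (c.+1 * nfine)%N) < 0 -> (0 < tcount c y)%N.
Proof.
move=> gy cm h; rewrite /tcount leq_min r0 andbT.
have -> : (\sum_(i < nfine) (ftrunc c y (gpt (c * nfine + i)%N) * ftrunc c y (gpt (c * nfine + i).+1%N) < 0)%R)%N =
   (\sum_(i < nfine) (ftrig y (gpt (c * nfine + i)%N) * ftrig y (gpt (c * nfine + i.+1)%N) < 0)%R)%N.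
  by apply: eq_bigr => i _; rewrite -good_sign_change// addnS.
apply: (@sign_change_sum_gt0 _ (fun i => ftrig y (gpt (c * nfine + i)%N))).
  by move=> i im; apply: good_neq0 gy (in_grid cm im).
by rewrite addn0 -[(c * nfine + nfine)%N]addnC -mulSn.
Qed.

Lemma tcount_le c y : (tcount c y <= r)%N.
Proof. exact: geq_minr. Qed.

End Quarter.

(** * Probability of the exceptional events *)

Lemma expR1_ge2 (R : realType) : 2 <= expR (1 : R).
Proof. by have := expR_ge1Dx (1 : R); lra. Qed.

Lemma expR1_le4 (R : realType) : expR (1 : R) <= 4.
Proof.
have -> : (1 : R) = 2^-1 + 2^-1 by field.
rewrite expRD; have : expR (2^-1 : R) <= 2.
  apply: (le_trans (expR_le_quadratic _)) => //.
  by rewrite expr2; lra.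
by have := expR_ge0 (2^-1 : R); nra.
Qed.

Lemma expRN_le_half (R : realType) (k : nat) : expR (- k%:R : R) <= 2^-1 ^+ k.
Proof.
rewrite -mulr_natl mulr1 -[- _]mulrN1 expRM_natl lerXn2r ?nnegrE ?expR_ge0 ?invr_ge0//.
by rewrite expRN lef_pV2 ?posrE ?expR_gt0// expR1_ge2.
Qed.

Lemma sum_geo_half (R : realType) (q : R) N m : 0 <= q <= 2^-1 ->
  \sum_(k < N | (m <= k)%N) q ^+ k <= 2 * q ^+ m.
Proof.
move=> /andP[q0 q2]; have h a : 0 <= q ^+ a by rewrite exprn_ge0.
suff : (m <= N)%N -> \sum_(k < N | (m <= k)%N) q ^+ k + 2 * q ^+ N <= 2 * q ^+ m.
  case: (leqP m N) => [mN /(_ isT)|Nm _].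
    by apply: le_trans; rewrite lerDl mulr_ge0.
  rewrite big1 ?mulr_ge0// => k mk.
  by have := leq_trans Nm mk; rewrite ltnNge (ltnW (ltn_ord k)).
elim: N => [|N IHN] mN.
  by rewrite big_ord0 add0r; move: mN; rewrite leqn0 => /eqP ->.
move: mN; rewrite leq_eqVlt => /orP[/eqP ->|mN].
  rewrite big1 ?add0r// => k mk.
  by have := leq_trans (ltn_ord k) mk; rewrite ltnn.
rewrite big_mkcond big_ord_recr/= -big_mkcond/= -ltnS mN.
have := IHN mN; have := h N; rewrite exprSr => h1.
have : q ^+ N * q <= q ^+ N * 2^-1 by rewrite ler_wpM2l.
lra.
Qed.

Section Gaussian_events.
Context d (T : measurableType d) (R : realType) (P : probability T R).
Variables (N : nat) (Z : 'I_N -> T -> R).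
Hypothesis Zi : gauss_iid P Z.

Lemma measurable_le_fun (f g : T -> R) : measurable_fun [set: T] f ->
  measurable_fun [set: T] g -> measurable [set w | f w <= g w].
Proof.
move=> mf mg; rewrite (_ : [set w | _] = [set w | `[0, +oo[%classic (g w - f w)]).
  by apply: (@measurable_fun_preimage _ _ _ (fun w => g w - f w)) => //; exact: measurable_funB.
by apply/seteqP; split => w /=; rewrite in_itv/= andbT subr_ge0.
Qed.

Lemma measurable_lt_fun (f g : T -> R) : measurable_fun [set: T] f ->
  measurable_fun [set: T] g -> measurable [set w | f w < g w].
Proof.
move=> mf mg; rewrite (_ : [set w | _] = ~` [set w | g w <= f w]).
  by apply: measurableC; exact: measurable_le_fun.
by apply/seteqP; split => w /=; rewrite ltNge => /negP.
Qed.

Lemma measurable_coord i : measurable_fun [set: T] (Z i).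
Proof. by case: Zi. Qed.

Lemma measurable_normc i : measurable_fun [set: T] (fun w => `|Z i w|).
Proof. by apply: measurableT_comp => //; exact: measurable_coord. Qed.

Lemma pr_small_ball i (t : R) : 0 <= t -> pr P [set w | `|Z i w| <= t] <= t.
Proof.
move=> t0; rewrite -lee_fin -prE; last exact: measurable_le_fun (measurable_normc i) _.
rewrite (gauss_iid1 i Zi (_ : measurable [set x : R | `|x| <= t]))//; first exact: normal_small_ball.
have -> : [set x : R | `|x| <= t] = `[- t, t]%classic.
  by apply/seteqP; split => x /=; rewrite in_itv/= ler_norml.
exact: measurable_itv.
Qed.

Lemma pr_small_ball2 i j (t u : R) : i != j -> 0 <= t -> 0 <= u ->
  pr P [set w | `|Z i w| <= t /\ `|Z j w| <= u] <= t * u.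
Proof.
move=> ij t0 u0.
have mB (x : R) : measurable [set y : R | `|y| <= x].
  have -> : [set y : R | `|y| <= x] = `[- x, x]%classic.
    by apply/seteqP; split => y /=; rewrite in_itv/= ler_norml.
  exact: measurable_itv.
rewrite -lee_fin -prE; last first.
  by apply: measurableI; exact: measurable_le_fun (measurable_normc _) _.
rewrite (gauss_iid2 Zi ij (mB t) (mB u)) EFinM.
by apply: lee_pmul; rewrite ?measure_ge0//; exact: normal_small_ball.
Qed.

(** In [pr_big_coord]: a factor 2 e from the normal tail, and 2 from the geometric sum. *)
Definition Kt : R := 4 * expR 1.

(** A linear growth in k makes the union bound over the coefficients geometric, and the factorial
    decay in a cell absorbs it. *)
Definition big_coord (al m : nat) : set T :=
  [set w | exists k : 'I_N, (m <= k)%N /\ al%:R * k.+1%:R < `|Z k w|].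

Lemma big_coordE al m : big_coord al m =
  [set w | exists k : 'I_N, (if (m <= k)%N then [set w | al%:R * k.+1%:R < `|Z k w|] else set0) w].
Proof.
apply/seteqP; split => w /= [k]; first by case=> mk h; exists k; rewrite mk.
by case: ifP => // mk h; exists k.
Qed.

Lemma measurable_big_coord al m : measurable (big_coord al m).
Proof.
rewrite big_coordE; apply: measurable_exists => k; case: ifP => // _.
exact: measurable_lt_fun (measurable_normc k).
Qed.

Lemma pr_big_coord al m : (0 < al)%N ->
  pr P (big_coord al m) <= Kt * 2^-1 ^+ (al * m.+1).
Proof.
move=> al0.
pose F (k : 'I_N) := if (m <= k)%N then [set w | al%:R * k.+1%:R < `|Z k w|] else set0.
have mF k : measurable (F k).
  by rewrite /F; case: ifP => // _; exact: measurable_lt_fun (measurable_normc k).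
rewrite big_coordE; apply: (le_trans (pr_exists P mF)).
pose q : R := 2^-1 ^+ al.
have q01 : 0 <= q <= 2^-1.
  rewrite exprn_ge0 ?invr_ge0//= /q; case: (al) al0 => // a _.
  by rewrite exprS ler_piMr ?invr_ge0// exprn_ile1 ?invr_ge0// invf_le1// ler1n.
apply: (@le_trans _ _ (\sum_(k < N | (m <= k)%N) 2 * expR 1 * q * q ^+ k)).
  rewrite big_mkcond [leRHS]big_mkcond/=; apply: ler_sum => k _; rewrite /F; case: ifP => mk; last first.
    by rewrite /pr measure0.
  rewrite -lee_fin -prE; last exact: measurable_lt_fun (measurable_normc k).
  rewrite (gauss_iid1 k Zi (_ : measurable [set x : R | al%:R * k.+1%:R < `|x|]))//.
    apply: (le_trans (normal_tail _)); rewrite lee_fin -!mulrA ler_pM2l//.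
    rewrite expRD ler_pM2l ?expR_gt0// -exprS -exprM -natrM.
    exact: expRN_le_half.
  rewrite (_ : [set x | _] = (fun x : R => `|x|) @^-1` `]al%:R * k.+1%:R, +oo[%classic).
    by rewrite -[X in measurable X]setTI; exact: normr_measurable.
  by apply/seteqP; split => x /=; rewrite in_itv/= andbT.
rewrite -mulr_sumr /Kt exprM exprS.
have := sum_geo_half N m q01; rewrite -/q => h.
apply: (@le_trans _ _ (2 * expR 1 * q * (2 * q ^+ m))).
  by rewrite ler_wpM2l// !mulr_ge0 ?expR_ge0//; case/andP: q01.
by rewrite le_eqVlt; apply/orP; left; apply/eqP; ring.
Qed.

End Gaussian_events.

Section Spoly_bounds.
Variables (R : realType) (n : nat).
Implicit Types (y : 'I_n.+1 -> R).

Definition bco (de : R) (k : nat) : R := sqbin R n k * tan de ^+ k.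

Lemma wnorm_spoly de m y : wnorm n.+1 m (spoly de y) =
  \sum_(k < n.+1) 'C(k, m)%:R * `|y k * bco de k|.
Proof. by apply: eq_bigr => k _; rewrite coef_spoly. Qed.

Lemma bco_bounds de k (B : R) : 0 < de <= pi / 4 -> Num.sqrt n%:R * de <= B ->
  0 <= bco de k <= (2 * B) ^+ k / Num.sqrt k`!%:R.
Proof.
move=> /andP[d0 d4] dB.
have h : 0 <= de <= pi / 4 by rewrite ltW.
have /andP[t1 t2] := tan_bounds h.
have t0 : 0 <= tan de by rewrite (le_trans _ t1)// ltW.
have B0 : 0 <= B by rewrite (le_trans _ dB)// mulr_ge0 ?sqrtr_ge0// ltW.
rewrite /bco; move: (tan de) t0 t1 t2 => t t0 t1 t2.
apply/andP; split; first by rewrite mulr_ge0 ?sqbin_ge0 ?exprn_ge0.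
apply: (le_trans (sqbin_le _ _ t0)).
rewrite ler_wpM2r ?invr_ge0 ?sqrtr_ge0// lerXn2r// ?nnegrE ?mulr_ge0 ?sqrtr_ge0//.
apply: (@le_trans _ _ (Num.sqrt n%:R * (2 * de))); first by rewrite ler_wpM2l ?sqrtr_ge0.
by rewrite mulrCA ler_pM2l.
Qed.

Lemma bin_le_pow2 k m : ('C(k, m)%:R : R) <= 2 ^+ k.
Proof.
rewrite -natrX ler_nat.
elim: k m => [|k IHk] [|m]; rewrite ?bin0 ?expn_gt0// binS expnS mul2n -addnn.
by rewrite leq_add.
Qed.

(* On a fine cell c = 2^-2r; on a coarse one c = 1. *)
Lemma wnorm_le de m y (al c : R) : 0 <= al -> 0 <= c ->
  (forall k : 'I_n.+1, (m <= k)%N -> 0 <= bco de k <= c * (32 ^+ k / Num.sqrt k`!%:R)) ->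
  (forall k : 'I_n.+1, (m <= k)%N -> `|y k| <= al * k.+1%:R) ->
  wnorm n.+1 m (spoly de y) <= al * c * (K0 R * 4^-1 ^+ m).
Proof.
move=> al0 c0 hb hy; rewrite wnorm_spoly.
apply: (@le_trans _ _ (\sum_(k < n.+1 | (m <= k)%N) (al * c) * ((2 ^+ k * k.+1%:R) * (32 ^+ k / Num.sqrt k`!%:R)))).
  rewrite [leRHS]big_mkcond/=; apply: ler_sum => k _; case: ifP => [mk|/negbT].
    have /andP[b0 b1] := hb k mk.
    rewrite normrM (ger0_norm b0).
    have -> : al * c * (2 ^+ k * k.+1%:R * (32 ^+ k / Num.sqrt k`!%:R)) =
       2 ^+ k * ((al * k.+1%:R) * (c * (32 ^+ k / Num.sqrt k`!%:R))) by ring.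
    by apply: ler_pM => //; [exact: mulr_ge0|exact: bin_le_pow2|apply: ler_pM => //; exact: hy].
  by rewrite -ltnNge => km; rewrite bin_small// mul0r.
rewrite -mulr_sumr ler_wpM2l ?mulr_ge0//.
apply: (@weighted_sum_le _ n.+1 m (fun k => 32 ^+ k / Num.sqrt k`!%:R) (fun k => 2 ^+ k * k.+1%:R) 32).
- by move=> k; rewrite divr_ge0 ?exprn_ge0 ?sqrtr_ge0//=.
- by rewrite lexx ler0n.
- by move=> k mk; rewrite mulr_ge0 ?exprn_ge0//=.
Qed.

End Spoly_bounds.

Lemma sum_const_lt (R : realType) (c : R) N J : 0 <= c ->
  \sum_(k < N | (k < J)%N) c <= J%:R * c.
Proof.
move=> c0; suff : \sum_(k < N | (k < J)%N) c <= (minn N J)%:R * c.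
  by move=> h; apply: (le_trans h); rewrite ler_wpM2r// ler_nat geq_minr.
elim: N => [|N IHN]; first by rewrite big_ord0 min0n mul0r.
rewrite big_mkcond big_ord_recr/= -big_mkcond/=.
case: ltnP => NJ; last by rewrite addr0 (le_trans IHN)// ler_wpM2r// ler_nat; lia.
have -> : minn N.+1 J = (minn N J).+1 by lia.
by rewrite -natr1 mulrDl mul1r lerD2r.
Qed.

Lemma sum_blocks (V : zmodType) (m r : nat) (F : nat -> V) :
  \sum_(i < m * r) F i = \sum_(j < m) \sum_(i < r) F (j * r + i)%N.
Proof.
elim: m => [|m IHm]; first by rewrite mul0n !big_ord0.
rewrite mulSn addnC big_split_ord/= big_ord_recr/= -IHm; congr (_ + _).
Qed.

Section Boolean_functions.
Context d (T : measurableType d).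

Lemma measurable_bool_fun m (b : 'I_m -> T -> bool) (g : {ffun 'I_m -> bool} -> nat) v :
  (forall i, measurable [set w | b i w]) ->
  measurable [set w | g [ffun i => b i w] = v].
Proof.
move=> mb; pose F (x : {ffun 'I_m -> bool}) : set T :=
  if g x == v then [set w | forall i, (if x i then [set w | b i w] else ~` [set w | b i w]) w] else set0.
rewrite (_ : [set w | _] = [set w | exists x, F x w]).
  apply: measurable_exists => x; rewrite /F; case: ifP => // _.
  by apply: measurable_forall => i; case: (x i) => //; exact: measurableC.
apply/seteqP; split => w /=.
  move=> gv; exists [ffun i => b i w]; rewrite /F gv eqxx => i /=.
  by rewrite ffunE; case: (boolP (b i w)) => // /negP.
move=> [x]; rewrite /F; case: ifP => // /eqP <- h; congr g.
by apply/ffunP => i; rewrite ffunE; have := h i; case: (x i) => //= /negP/negbTE.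
Qed.

End Boolean_functions.

(** * Probability that a quarter is not good *)

Section Quarter_probability.
Context d (T : measurableType d) (R : realType) (P : probability T R).
Variables (n r : nat) (theta : R) (Y : 'I_n.+1 -> T -> R).
Hypothesis n0 : (0 < n)%N.
Hypothesis r0 : (0 < r)%N.
Hypothesis th : 0 < theta <= pi / 4.
Hypothesis hr : r%:R ^+ 4 <= Num.sqrt n%:R * theta <= r.+1%:R ^+ 4.
Hypothesis Yi : gauss_iid P Y.

Local Notation sn := (Num.sqrt (n%:R : R)).
Local Notation clen := (clen r theta).
Local Notation flen := (flen r theta).
Local Notation gpt := (gpt r theta).
Local Notation ncell := (ncell r).
Local Notation nfine := (nfine r).
Local Notation Yw w := (fun k => Y k w).

Lemma rS_le : (r.+1%:R : R) ^+ 4 <= 16 * r%:R ^+ 4.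
Proof.
have : (r.+1%:R : R) <= 2 * r%:R by rewrite -natrM ler_nat mul2n -addnn -addn1 leq_add2l.
move=> h; apply: (@le_trans _ _ ((2 * r%:R) ^+ 4)).
  by rewrite lerXn2r// nnegrE.
by rewrite exprMn; apply: ler_pM => //; rewrite -natrX ler_nat.
Qed.

(** r is the integer part of a fourth root, so that n^(1/2) theta lies between r^4 and (r + 1)^4 <=
    16 r^4. *)
Lemma sn_clen : 1 <= sn * clen <= 16.
Proof.
have rp : (0 : R) < r%:R ^+ 4 by rewrite exprn_gt0// ltr0n.
rewrite /clen /ncell natrX mulrA ler_pdivlMr// mul1r ler_pdivrMr//.
by case/andP: hr => -> h /=; rewrite (le_trans h) ?rS_le.
Qed.

Lemma sn_flen : sn * flen = sn * clen / nfine%:R.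
Proof. by rewrite /flen mulrA. Qed.

Lemma nfineE : (nfine%:R : R) = 2 ^+ r.
Proof. by rewrite /nfine natrX. Qed.

Definition Zc tau : 'I_n.+1 -> T -> R := act (rotmx n tau) Y.

Lemma Zc_iid tau : gauss_iid P (Zc tau).
Proof. by apply: gauss_inv_orth => //; exact: rotmx_orth. Qed.

Lemma measurable_wnorm (Z : 'I_n.+1 -> T -> R) de m :
  (forall k, measurable_fun [set: T] (Z k)) ->
  measurable_fun [set: T] (fun w => wnorm n.+1 m (spoly de (fun k => Z k w))).
Proof.
move=> mZ; rewrite (_ : (fun w => _) = (fun w => \sum_(k < n.+1) 'C(k, m)%:R * `|Z k w * bco n de k|)).
  apply: measurable_sum => k; apply: measurable_funM => //; apply: measurableT_comp => //.
  by apply: measurable_funM.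
by apply/funext => w; rewrite wnorm_spoly.
Qed.

Lemma bco_clen k : 0 <= bco n clen k <= 32 ^+ k / Num.sqrt k`!%:R.
Proof.
have /andP[_ h] := sn_clen.
have := bco_bounds k (clen_bounds r0 th) h.
by rewrite (_ : 2 * 16 = 32 :> R)// -natrM.
Qed.

(** A fine cell is 2^r times shorter than a cell, which gains (2^-r)^k, hence (2^-r)^2 from order 2
    on. *)
Lemma bco_flen k : (2 <= k)%N ->
  0 <= bco n flen k <= (2 ^- r) ^+ 2 * (32 ^+ k / Num.sqrt k`!%:R).
Proof.
move=> k2; have h : sn * flen <= 16 * 2 ^- r.
  by rewrite sn_flen nfineE ler_wpM2r ?invr_ge0//; case/andP: sn_clen.
have /andP[-> /le_trans -> //] := bco_bounds k (flen_bounds r0 th) h.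
rewrite mulrA ler_wpM2r ?invr_ge0 ?sqrtr_ge0//.
have -> : 2 * (16 * 2 ^- r) = 2 ^- r * 32 :> R by ring.
rewrite exprMn ler_wpM2r ?exprn_ge0//.
have q0 : (0 : R) <= 2 ^- r by rewrite invr_ge0.
rewrite -(subnKC k2) exprD ler_piMr ?exprn_ge0// exprn_ile1//.
by rewrite -exprVn exprn_ile1// ?invr_ge0// invf_le1// ler1n.
Qed.

Definition K1 : R := Kt R + K0 R.

Lemma Kt_ge0 : 0 <= Kt R. Proof. by rewrite mulr_ge0 ?expR_ge0. Qed.
Lemma K1_ge0 : 0 <= K1. Proof. by rewrite addr_ge0 ?Kt_ge0// ltW// K0_gt0. Qed.

Definition manyev c m : set T := [set w | many r theta c m (Yw w)].

Lemma measurable_manyev c m : measurable (manyev c m).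
Proof.
have [mZ _] := Zc_iid (gpt (c * nfine)%N).
apply: (@measurable_le_fun _ _ _ (fun w => `|Zc (gpt (c * nfine)%N) ord0 w|)).
  by apply: measurableT_comp.
exact: (measurable_wnorm clen m mZ).
Qed.

(** Either some coefficient of order k >= m exceeds k + 1, or the norm is at most K0 4^-m and the
    standard normal variable Z_0 falls in a ball of that radius. *)
Lemma pr_manyev c m : pr P (manyev c m) <= K1 * 2^-1 ^+ m.
Proof.
have Zi := Zc_iid (gpt (c * nfine)%N); set Z := Zc _ in Zi.
have mS : measurable [set w | `|Z ord0 w| <= K0 R * 4^-1 ^+ m].
  exact: measurable_le_fun (measurable_normc Zi _) _.
have mB := measurable_big_coord Zi 1 m.
have q0 : (0 : R) <= 4^-1 ^+ m by rewrite exprn_ge0// invr_ge0.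
have K00 := ltW (K0_gt0 R).
apply: (@le_trans _ _ (pr P (big_coord Z 1 m `|` [set w | `|Z ord0 w| <= K0 R * 4^-1 ^+ m]))).
  apply: pr_le; [exact: measurable_manyev|exact: measurableU|].
  move=> w; rewrite /manyev/= /many => h.
  have [Bw|nB] := pselect (big_coord Z 1 m w); [by left|right => /=].
  apply: (le_trans h); rewrite -[leRHS]mul1r -[X in X * _]mulr1.
  apply: wnorm_le => // k mk.
    by rewrite mul1r; exact: bco_clen.
  rewrite leNgt; apply/negP => hk; apply: nB; exists k; split => //.
apply: (le_trans (prU _ mB mS)).
rewrite mulrDl lerD//.
  apply: (le_trans (pr_big_coord Zi _ _)) => //.
  by rewrite ler_wpM2l ?Kt_ge0// mul1n exprS ler_piMl ?exprn_ge0 ?invr_ge0// invf_le1// ler1n.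
apply: (le_trans (pr_small_ball Zi _ _)); first by rewrite mulr_ge0.
rewrite ler_wpM2l// lerXn2r ?nnegrE ?invr_ge0// lef_pV2 ?posrE//.
by rewrite ler_nat.
Qed.

Definition dblev g : set T := [set w | double_zero (gpt g) flen (Yw w)].

Let i1 : 'I_n.+1 := inord 1.
Let i1E : i1 = 1%N :> nat. Proof. by rewrite inordK. Qed.

Lemma bco1_ge tau : 0 < tau <= pi / 4 -> sn * tau <= bco n tau 1.
Proof.
move=> h; rewrite /bco /sqbin bin1 expr1 ler_wpM2l ?sqrtr_ge0//.
have h' : 0 <= tau <= pi / 4 by case/andP: h => /ltW -> ->.
by have /andP[] := tan_bounds h'.
Qed.

Lemma coef1_spoly de (y : 'I_n.+1 -> R) : (spoly de y)`_1 = y i1 * bco n de 1.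
Proof. by rewrite -[in LHS]i1E coef_spoly /bco i1E. Qed.

Lemma measurable_dblev g : measurable (dblev g).
Proof.
have [mZ _] := Zc_iid (gpt g).
have mW := measurable_wnorm flen 2 mZ.
apply: measurableI.
  apply: (@measurable_le_fun _ _ _ (fun w => `|Zc (gpt g) ord0 w|)) => //.
  by apply: measurableT_comp.
rewrite [X in _ X](_ : _ = [set w | `|Zc (gpt g) i1 w * bco n flen 1| <=
   2 * wnorm n.+1 2 (spoly flen (fun k => Zc (gpt g) k w))]).
  apply: measurable_le_fun; last exact: measurable_funM.
  by apply: measurableT_comp => //; apply: measurable_funM.
by apply/seteqP; split => w /=; rewrite coef1_spoly.
Qed.

(** Unless some coefficient of order k >= 2 exceeds 3 r (k + 1), the second order norm is at most W
    = 3 r 4^-r K0. Then |Z_0| <= W and, the linear coefficient being at least 2^-r |Z_1|, |Z_1| <= 2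
    W 2^r. By independence the probability is at most 2 W^2 2^r, of order r^2 8^-r, small against
    the r^4 2^r fine cells. *)
Lemma pr_dblev g : pr P (dblev g) <= (Kt R + 18 * r%:R ^+ 2 * K0 R ^+ 2) * 8^-1 ^+ r.
Proof.
have Zi := Zc_iid (gpt g); set Z := Zc _ in Zi.
pose W : R := (3 * r)%:R * (2 ^- r) ^+ 2 * K0 R.
pose S := [set w | `|Z ord0 w| <= W /\ `|Z i1 w| <= 2 * W * 2 ^+ r].
have mS : measurable S.
  by apply: measurableI; exact: measurable_le_fun (measurable_normc Zi _) _.
have mB := measurable_big_coord Zi (3 * r) 2.
have K00 := ltW (K0_gt0 R).
have W0 : 0 <= W by rewrite !mulr_ge0.
apply: (@le_trans _ _ (pr P (big_coord Z (3 * r) 2 `|` S))).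
  apply: pr_le; [exact: measurable_dblev|exact: measurableU|].
  move=> w; rewrite /dblev/= /double_zero coef1_spoly.
  have [Bw|nB] := pselect (big_coord Z (3 * r) 2 w); first by left.
  set w2 := wnorm _ _ _ => -[h0 h1]; right; rewrite /S /=.
  have w2W : w2 <= W.
    apply: (@le_trans _ _ ((3 * r)%:R * (2 ^- r) ^+ 2 * (K0 R * 4^-1 ^+ 2))).
      apply: wnorm_le => // k mk; first exact: bco_flen.
      rewrite leNgt; apply/negP => hk; apply: nB; exists k; split => //.
    rewrite /W ler_wpM2l ?mulr_ge0// ler_piMr// exprn_ile1 ?invr_ge0// invf_le1//.
    by rewrite ler1n.
  split; first exact: le_trans w2W.
  have b1 : 2 ^- r <= bco n flen 1.
    apply: le_trans (bco1_ge (flen_bounds r0 th)).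
    rewrite sn_flen nfineE ler_peMl ?invr_ge0//; by case/andP: sn_clen.
  have b0 : 0 < bco n flen 1 by apply: lt_le_trans b1; rewrite invr_gt0 exprn_gt0.
  rewrite -ler_pdivrMr ?exprn_gt0//.
  apply: (@le_trans _ _ (2 * w2)); last by rewrite ler_wpM2l.
  apply: le_trans h1; rewrite normrM (gtr0_norm b0) ler_wpM2l//.
apply: (le_trans (prU _ mB mS)); rewrite mulrDl lerD//.
  apply: (le_trans (pr_big_coord Zi _ _)); first by rewrite muln_gt0.
  rewrite ler_wpM2l ?Kt_ge0//.
  have -> : 8^-1 ^+ r = (2^-1 : R) ^+ (3 * r).
    by rewrite exprM; congr (_ ^+ _); field.
  by rewrite mulnS exprD ler_piMr ?exprn_ge0 ?invr_ge0// exprn_ile1 ?invr_ge0// invf_le1// ler1n.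
apply: (le_trans (pr_small_ball2 Zi _ _ _)) => //.
- by rewrite -val_eqE/= i1E.
- by rewrite !mulr_ge0.
have -> : 8^-1 ^+ r = ((2 : R) ^- r) ^+ 3.
  by rewrite -!exprVn -exprM mulnC exprM; congr (_ ^+ _); field.
rewrite /W natrM le_eqVlt; apply/orP; left; apply/eqP.
have : (2 : R) ^+ r != 0 by rewrite expf_neq0.
by move: (_ ^+ r) => q q0; field.
Qed.

Definition ballev g : set T := [set w | `|ftrig (Yw w) (gpt g)| <= eps4 R r].

Lemma ftrig_Zc w t : ftrig (Yw w) t = Zc t ord0 w.
Proof. by rewrite -{1}[t]addr0 ftrig_rot ?cos0 ?oner_neq0// ftrig0. Qed.

Lemma ballevE g : ballev g = [set w | `|Zc (gpt g) ord0 w| <= eps4 R r].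
Proof. by apply/seteqP; split => w; rewrite /ballev /= ftrig_Zc. Qed.

Lemma measurable_ballev g : measurable (ballev g).
Proof. by rewrite ballevE; exact: measurable_le_fun (measurable_normc (Zc_iid _) _) _. Qed.

Lemma pr_ballev g : pr P (ballev g) <= 4^-1 ^+ r.
Proof.
by rewrite ballevE; apply: (pr_small_ball (Zc_iid _)); rewrite exprn_ge0// invr_ge0.
Qed.

(* The exponent 128 x^2 of weighted_term_le for x = 32 r^4. *)
Definition Ltr : nat := (128 * (32 * r ^ 4) ^ 2)%N.

(** A cut-off polynomial in r: [Ltr] indices let 8^-k compensate the factor exp [Ltr], and r more of
    them give 8^-r. *)
Definition Jtr : nat := (Ltr + r)%N.

Lemma phi_le_fact k t : 0 <= t <= theta ->
  phi n k t <= (32 * r%:R ^+ 4) ^+ k / Num.sqrt k`!%:R.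
Proof.
move=> /andP[t0 tt]; case/andP: th => th0 th4.
have h : 0 <= t <= pi / 4 by rewrite t0 (le_trans tt).
have s0 := sin_ge0_piquarter h; have c0 := ltW (cos_gt0_piquarter h).
apply: (@le_trans _ _ (sqbin R n k * sin t ^+ k)).
  by rewrite /phi ler_piMr ?mulr_ge0 ?sqbin_ge0 ?exprn_ge0// exprn_ile1// cos_le1.
have t20 : 0 <= 2 * t by rewrite mulr_ge0.
apply: (@le_trans _ _ (sqbin R n k * (2 * t) ^+ k)).
  rewrite ler_wpM2l ?sqbin_ge0// lerXn2r ?nnegrE//.
  have /andP[_] := tan_bounds h; apply: le_trans.
  rewrite /tan ler_pdivlMr ?cos_gt0_piquarter//.
  by rewrite ler_piMr// cos_le1.
apply: (le_trans (sqbin_le _ _ t20)).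
rewrite ler_wpM2r ?invr_ge0 ?sqrtr_ge0// lerXn2r// ?nnegrE ?mulr_ge0 ?sqrtr_ge0 ?exprn_ge0//.
apply: (@le_trans _ _ (2 * (sn * theta))).
  by rewrite mulrCA ler_pM2l// ler_wpM2l ?sqrtr_ge0.
have -> : 32 * r%:R ^+ 4 = 2 * (16 * r%:R ^+ 4) :> R by rewrite mulrA -natrM.
by rewrite ler_pM2l//; case/andP: hr => _ /le_trans; apply; exact: rS_le.
Qed.

Lemma tail_term_le k t : 0 <= t <= theta ->
  k.+1%:R * phi n k t <= expR 1 ^+ Ltr * 8^-1 ^+ k.
Proof.
move=> ht; apply: (@le_trans _ _ (k.+1%:R * ((32 * r%:R ^+ 4) ^+ k / Num.sqrt k`!%:R))).
  by rewrite ler_wpM2l// phi_le_fact.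
have x0 : (0 : R) <= 32 * r%:R ^+ 4 by rewrite mulr_ge0 ?exprn_ge0.
have := weighted_term_le k x0.
have -> : (128 * (32 * r%:R ^+ 4) ^+ 2 : R) = Ltr%:R.
  by rewrite /Ltr natrM natrX natrM natrX.
rewrite -[Ltr%:R]mulr1 expRM_natl => h.
have -> : (8^-1 : R) ^+ k = (4^-1) ^+ k / 2 ^+ k.
  by rewrite -exprVn -exprMn -invfM -natrM.
by rewrite [leRHS]mulrA ler_pdivlMr ?exprn_gt0// [leLHS]mulrC [leLHS]mulrA.
Qed.

(** An omitted index below [Jtr] has phi_k <= 8^-r on the grid of the cell, by definition of the
    window; from [Jtr] on the factorial decay takes over. The total is 3 r (Jtr^2 + 2) 8^-r, at most
    2^r 8^-r. *)
Lemma good_trunc_small (c i : nat) (y : 'I_n.+1 -> R) :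
  (c < ncell)%N -> (i <= nfine)%N ->
  (3 * r * (Jtr ^ 2 + 2) <= 2 ^ r)%N ->
  (forall k, `|y k| <= (3 * r)%:R * k.+1%:R) ->
  `|ftrig y (gpt (c * nfine + i)%N) - ftrunc r theta c y (gpt (c * nfine + i)%N)| <= eps4 R r.
Proof.
move=> cm im hJ hy; set t := gpt _.
have gi : (c * nfine + i <= ncell * nfine)%N.
  apply: (@leq_trans (c.+1 * nfine)%N); last by rewrite leq_mul2r cm orbT.
  by rewrite mulSn addnC leq_add2r.
have tq : 0 <= t <= pi / 4 by exact: gpt_range.
have tt : 0 <= t <= theta.
  by case/andP: tq => -> _ /=; rewrite -{1}(gpt_end theta r0) gpt_mono.
have p0 k : 0 <= phi n k t.
  by apply: phi_ge0; [exact: sin_ge0_piquarter|exact/ltW/cos_gt0_piquarter].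
rewrite /ftrig /ftrunc [in X in _ - X]big_mkcond/= -sumrB.
apply: (le_trans (ler_norm_sum _ _ _)).
pose A : R := Jtr%:R * 8^-1 ^+ r; pose B : R := expR 1 ^+ Ltr.
have A0 : 0 <= A by rewrite mulr_ge0 ?exprn_ge0 ?invr_ge0.
have B0 : 0 <= B by rewrite exprn_ge0 ?expR_ge0.
apply: (@le_trans _ _ (\sum_(k < n.+1) (3 * r)%:R * (if (k < Jtr)%N then A else B * 8^-1 ^+ k))).
  apply: ler_sum => k _.
  have A1 : 0 <= (3 * r)%:R * (if (k < Jtr)%N then A else B * 8^-1 ^+ k).
    by rewrite mulr_ge0//; case: ifP => // _; rewrite mulr_ge0// exprn_ge0// invr_ge0.
  case: (boolP (k \in _)) => [_|kW]; first by rewrite subrr normr0.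
  rewrite subr0 normrM (ger0_norm (p0 k)).
  apply: (@le_trans _ _ ((3 * r)%:R * k.+1%:R * phi n k t)); first by rewrite ler_wpM2r.
  rewrite -mulrA ler_wpM2l//; case: ltnP => kJ; last exact: tail_term_le.
  apply: ler_pM => //; first by rewrite ler_nat.
  move: kW; rewrite inE negb_exists => /forallP /(_ (inord i)).
  by rewrite inordK// -leNgt.
rewrite -mulr_sumr.
apply: (@le_trans _ _ ((3 * r)%:R * (Jtr%:R * A + 2 * 8^-1 ^+ r))).
  rewrite ler_wpM2l// (bigID (fun k : 'I_n.+1 => (k < Jtr)%N))/= lerD//.
    apply: le_trans (sum_const_lt n.+1 Jtr A0).
    by rewrite le_eqVlt; apply/orP; left; apply/eqP; apply: eq_bigr => k ->.
  apply: (@le_trans _ _ (B * \sum_(k < n.+1 | (Jtr <= k)%N) 8^-1 ^+ k)).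
    rewrite mulr_sumr le_eqVlt; apply/orP; left; apply/eqP.
    by apply: eq_big => k; rewrite -?leqNgt// => kJ; rewrite ltnNge kJ.
  apply: (@le_trans _ _ (B * (2 * 8^-1 ^+ Jtr))).
    rewrite ler_wpM2l// sum_geo_half// invr_ge0 ler0n/= lef_pV2 ?posrE//.
    by rewrite ler_nat.
  rewrite mulrCA ler_pM2l// /Jtr exprD mulrA ler_piMl ?exprn_ge0 ?invr_ge0//.
  rewrite /B -exprMn exprn_ile1// ?mulr_ge0 ?expR_ge0 ?invr_ge0//.
  by have := expR1_le4 R; rewrite ler_pdivrMr// mul1r => /le_trans; apply; rewrite ler_nat.
have -> : (3 * r)%:R * (Jtr%:R * A + 2 * 8^-1 ^+ r) = (3 * r * (Jtr ^ 2 + 2))%:R * 8^-1 ^+ r :> R.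
  by rewrite /A !natrM natrD natrX; ring.
have -> : eps4 R r = 2 ^+ r * 8^-1 ^+ r.
  rewrite /eps4 -exprMn; congr (_ ^+ _).
  by field.
by rewrite ler_wpM2r ?exprn_ge0 ?invr_ge0// -natrX ler_nat.
Qed.

Definition badev : set T :=
  [set w | exists g : 'I_(ncell * nfine), dblev g w] `|`
  [set w | exists g : 'I_(ncell * nfine).+1, ballev g w] `|`
  big_coord Y (3 * r) 0 `|`
  [set w | exists c : 'I_ncell, manyev c r.+1 w].

Lemma measurable_badev : measurable badev.
Proof.
apply: measurableU; [apply: measurableU; [apply: measurableU|]|].
- by apply: measurable_exists => g; exact: measurable_dblev.
- by apply: measurable_exists => g; exact: measurable_ballev.
- exact: (measurable_big_coord Yi).
- by apply: measurable_exists => c; exact: measurable_manyev.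
Qed.

(** The union bound over fine cells, grid points, large coefficients and crowded cells, in this
    order; each term is at most a polynomial in r times 2^-r. *)
Definition pbad : R :=
  (r ^ 4 * 2 ^ r)%:R * ((Kt R + 18 * r%:R ^+ 2 * K0 R ^+ 2) * 8^-1 ^+ r) +
  (r ^ 4 * 2 ^ r).+1%:R * 4^-1 ^+ r + Kt R * 2^-1 ^+ (3 * r) +
  (r ^ 4)%:R * (K1 * 2^-1 ^+ r.+1).

Lemma pr_badev : pr P badev <= pbad.
Proof.
have sumc (N : nat) (F : 'I_N -> R) x : (forall i, F i <= x) -> \sum_i F i <= N%:R * x.
  move=> h; apply: (@le_trans _ _ (\sum_(i < N) x)); first by apply: ler_sum.
  by rewrite sumr_const card_ord -[leLHS]mulr_natl.
have m1 : measurable [set w | exists g : 'I_(ncell * nfine), dblev g w].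
  by apply: measurable_exists => g; exact: measurable_dblev.
have m2 : measurable [set w | exists g : 'I_(ncell * nfine).+1, ballev g w].
  by apply: measurable_exists => g; exact: measurable_ballev.
have m3 := measurable_big_coord Yi (3 * r) 0.
have m4 : measurable [set w | exists c : 'I_ncell, manyev c r.+1 w].
  by apply: measurable_exists => c; exact: measurable_manyev.
have m12 := measurableU _ _ m1 m2; have m123 := measurableU _ _ m12 m3.
apply: (le_trans (prU _ m123 m4)); apply: lerD; last first.
  apply: (le_trans (pr_exists P (fun c => measurable_manyev _ _))).
  by apply: sumc => c; exact: pr_manyev.
apply: (le_trans (prU _ m12 m3)); apply: lerD; last first.
  apply: (le_trans (pr_big_coord Yi _ _)); first by rewrite muln_gt0.
  by rewrite muln1.
apply: (le_trans (prU _ m1 m2)); apply: lerD.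
  apply: (le_trans (pr_exists P (fun c => measurable_dblev _))).
  by apply: sumc => c; exact: pr_dblev.
apply: (le_trans (pr_exists P (fun c => measurable_ballev _))).
by apply: sumc => c; exact: pr_ballev.
Qed.

Hypothesis rbig : (3 * r * (Jtr ^ 2 + 2) <= 2 ^ r)%N.

Lemma not_bad_good w : ~ badev w -> good r theta (Yw w).
Proof.
move=> nb; split.
- by move=> g gm h; apply: nb; left; left; left; exists (Ordinal gm).
- move=> g gm; rewrite ltNge; apply/negP => h; apply: nb; left; left; right.
  by rewrite -ltnS in gm; exists (Ordinal gm).
- move=> c i cm im; apply: good_trunc_small => // k.
  rewrite leNgt; apply/negP => hk; apply: nb; left; right; by exists k.
- by move=> c cm h; apply: nb; right; exists (Ordinal cm).
Qed.

End Quarter_probability.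

(** Origin of the threshold 50: exp (- (r - 1)^2 / 8) <= exp (- 6 r) <= 2^(-6 r), the square of the
    window threshold 8^-r. *)
Lemma gap_sq r : (50 <= r)%N -> (6 * r * 8 <= r.-1 ^ 2)%N.
Proof.
case: r => // r hr; rewrite [_.-1]/= -mulnn.
by apply: (@leq_trans (49 * r)); [lia|rewrite leq_mul2r; lia].
Qed.

Section Sign_change_constant.
Variable R : realType.
Local Notation gam := (@normal_prob R 0 1).

(** Chosen to outweigh Z_0 < 1 and the terms of order at least 2, which amount to at most K0 / 8. *)
Definition a0 : R := K0 R + 2.
(** The factor 1/2 bounds from below the probability that |Z_k| <= 2 (k + 1) for all k >= 2. *)
Definition c0 : R := fine (gam `]0, 1[%classic) * fine (gam `](- a0 - 1), (- a0)[%classic) / 2.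

Lemma c0_gt0 : 0 < c0.
Proof.
rewrite divr_gt0// mulr_gt0// fine_gt0//; apply/andP; split.
- exact: normal_prob_itv_gt0.
- by rewrite ltey_eq fin_num_measure.
- by apply: normal_prob_itv_gt0; lra.
- by rewrite ltey_eq fin_num_measure.
Qed.

End Sign_change_constant.

(** * Independence, deviation and mean of the counts in a quarter *)

Section Quarter_counts.
Context d (T : measurableType d) (R : realType) (P : probability T R).
Variables (n r : nat) (theta : R) (Y : 'I_n.+1 -> T -> R).
Hypothesis n0 : (0 < n)%N.
Hypothesis r50 : (50 <= r)%N.
Hypothesis th : 0 < theta <= pi / 4.
Hypothesis hr : r%:R ^+ 4 <= Num.sqrt n%:R * theta <= r.+1%:R ^+ 4.
Hypothesis Yi : gauss_iid P Y.

Local Notation sn := (Num.sqrt (n%:R : R)).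
Local Notation clen := (clen r theta).
Local Notation flen := (flen r theta).
Local Notation gpt := (gpt r theta).
Local Notation ncell := (ncell r).
Local Notation nfine := (nfine r).
Local Notation Yw w := (fun k => Y k w).

Let r0 : (0 < r)%N. Proof. exact: leq_trans r50. Qed.

(** r - 1 and not r, because the two points may be the facing ends of their cells. *)
Lemma gpt_dist c c' i i' : (c + r <= c')%N -> (i <= nfine)%N -> (i' <= nfine)%N ->
  (r.-1)%:R * clen <= gpt (c' * nfine + i')%N - gpt (c * nfine + i)%N.
Proof.
move=> cc im im'.
have h : ((c * nfine + i) + r.-1 * nfine <= c' * nfine + i')%N.
  apply: (@leq_trans (c' * nfine)); last by rewrite leq_addr.
  apply: (@leq_trans ((c + r) * nfine)); last by rewrite leq_mul2r cc orbT.
  rewrite mulnDl -addnA leq_add2l -[r in (_ <= r * _)%N](prednK r0) mulSn leq_add2r//.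
have [cl0 _] := andP (clen_bounds r0 th).
rewrite lerBrDr; apply: le_trans (gpt_mono r0 th h); rewrite /gpt.
rewrite [X in _ <= X%:R * flen]addnC [X in _ <= X * flen]natrD [leRHS]mulrDl lerD2r natrM -mulrA ler_wpM2l// /flen mulrCA.
by rewrite divff ?mulr1// pnatr_eq0 -lt0n nfine_gt0.
Qed.

(* phi_k(t) phi_k(t') <= \sum_j phi_j(t) phi_j(t') = cos(t - t')^n is tiny. *)
Lemma window_disjoint_lt c c' k : (c + r <= c')%N -> (c' < ncell)%N ->
  k \in window n r theta c -> k \notin window n r theta c'.
Proof.
move=> cc cm; rewrite !inE => /existsP[i hi]; apply/negP => /existsP[i' hi'].
have ing b j : (b < ncell)%N -> (j <= nfine)%N -> (b * nfine + j <= ncell * nfine)%N.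
  move=> bm jm; apply: (@leq_trans (b.+1 * nfine)%N); last by rewrite leq_mul2r bm orbT.
  by rewrite mulSn addnC leq_add2r.
have cm' : (c < ncell)%N by apply: leq_ltn_trans cm; apply: leq_trans cc; exact: leq_addr.
have im : (i <= nfine)%N by rewrite -ltnS.
have im' : (i' <= nfine)%N by rewrite -ltnS.
move: hi hi'; set t := gpt _; set t' := gpt _ => hi hi'.
have ht : 0 <= t <= pi / 4 by apply: (gpt_range r0 th); exact: ing.
have ht' : 0 <= t' <= pi / 4 by apply: (gpt_range r0 th); exact: ing.
have p0 j u : 0 <= u <= pi / 4 -> 0 <= phi n j u.
  by move=> hu; apply: phi_ge0; [exact: sin_ge0_piquarter|exact/ltW/cos_gt0_piquarter].
have e0 : (0 : R) <= eps8 R r by rewrite exprn_ge0// invr_ge0.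
have dist : (r.-1)%:R * clen <= t' - t by apply: gpt_dist.
have [cl0 _] := andP (clen_bounds r0 th).
have d0 : 0 <= t' - t by apply: le_trans dist; rewrite mulr_ge0// ltW.
have : eps8 R r * eps8 R r < cos (t' - t) ^+ n.
  apply: (@lt_le_trans _ _ (phi n k t' * phi n k t)); first by apply: ltr_pM.
  rewrite -sum_phi (bigD1 k)//= lerDl sumr_ge0// => j _.
  by rewrite mulr_ge0// p0.
apply/negP; rewrite -leNgt.
have d4 : 0 <= t' - t <= pi / 4 by rewrite d0/=; move: ht ht'; lra.
apply: (le_trans (cos_pow_le n d4)).
apply: (@le_trans _ _ (expR (- (6 * r)%:R))).
  rewrite ler_expR lerN2 ler_pdivlMr//.
  have [sc _] := andP (sn_clen r0 hr).
  have h1 : (r.-1)%:R <= sn * (t' - t).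
    apply: (@le_trans _ _ ((r.-1)%:R * (sn * clen))); first by rewrite ler_peMr.
    by rewrite mulrCA ler_wpM2l// sqrtr_ge0.
  have : (r.-1)%:R ^+ 2 <= (sn * (t' - t)) ^+ 2.
    by rewrite lerXn2r// nnegrE// mulr_ge0// sqrtr_ge0.
  rewrite exprMn sqr_sqrtr//; apply: le_trans.
  rewrite -natrX -natrM ler_nat.
  exact: gap_sq.
apply: (le_trans (expRN_le_half _ _)).
have -> : eps8 R r * eps8 R r = 2^-1 ^+ (6 * r).
  rewrite /eps8 -exprMn mulnC exprM; rewrite -exprM mulnC exprM; congr (_ ^+ _); by field.
by [].
Qed.

Lemma window_disjoint c c' k : (c + r <= c')%N \/ (c' + r <= c)%N ->
  (c < ncell)%N -> (c' < ncell)%N ->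
  k \in window n r theta c -> k \notin window n r theta c'.
Proof.
move=> [cc|cc] cm cm' kc; first exact: window_disjoint_lt kc.
by apply/negP => kc'; have := window_disjoint_lt cc cm kc'; rewrite kc.
Qed.

Lemma sigma_tcount c v : sigma Y (window n r theta c) [set w | tcount r theta c (Yw w) = v].
Proof.
set J := window _ _ _ _.
pose b (i : 'I_nfine) (w : g_sigma_algebraType (cyl Y J)) : bool :=
  (ftrunc r theta c (Yw w) (gpt (c * nfine + i)%N) * ftrunc r theta c (Yw w) (gpt (c * nfine + i).+1%N) < 0).
have mf t : measurable_fun [set: g_sigma_algebraType (cyl Y J)] (fun w => ftrunc r theta c (Yw w) t).
  rewrite (_ : (fun w => _) = (fun w => \sum_(k < n.+1) (if k \in J then Y k w else 0) * phi n k t)).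
    apply: measurable_sum => k; apply: measurable_funM => //.
    by case: (boolP (k \in J)) => kJ //; exact: sigma_fun.
  apply/funext => w; rewrite /ftrunc big_mkcond/=; apply: eq_bigr => k _.
  by case: ifP => // _; rewrite mul0r.
have mb i : measurable [set w | b i w].
  rewrite /b; apply: (@measurable_lt_fun _ (g_sigma_algebraType (cyl Y J)) R
    (fun w => ftrunc r theta c (Yw w) (gpt (c * nfine + i)%N) * ftrunc r theta c (Yw w) (gpt (c * nfine + i).+1%N)) (fun=> 0)) => //.
  exact: measurable_funM.
have := measurable_bool_fun (fun x : {ffun 'I_nfine -> bool} => minn (\sum_i x i) r) v mb.
rewrite (_ : [set w | _] = [set w | tcount r theta c (Yw w) = v])//.
by apply/seteqP; split => w /=; under eq_bigr do rewrite ffunE.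
Qed.

Definition tc c w : nat := tcount r theta c (Yw w).
Definition tmu c : R := tmean P r (tc c).
Definition tdev c w : R := (tc c w)%:R - tmu c.

Lemma measurable_tc c v : measurable [set w | tc c w = v].
Proof. exact: (sigma_measurable Yi (@sigma_tcount c v)). Qed.

Lemma measurable_tdev c : measurable_fun [set: T] (tdev c).
Proof.
apply: measurable_funB => //.
rewrite (_ : (fun w => _) = (fun w => \sum_(v < r.+1) v%:R * \1_[set w | tc c w = v] w)).
  apply: measurable_sum => v; apply: measurable_funM => //.
  by apply: measurable_indic; exact: measurable_tc.
apply/funext => w.
have hw : (tc c w < r.+1)%N by rewrite ltnS tcount_le.
rewrite (bigD1 (Ordinal hw))//= big1 ?addr0.
  by rewrite indicE mem_set// mulr1.
by move=> v vw; rewrite indicE memNset ?mulr0//= => e; move/eqP: vw; apply; apply/val_inj.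
Qed.

(** The cells j r + rho are pairwise at index distance at least r, so their windows are disjoint and
    the r^3 counts independent. *)
Lemma class_tail rho (e s : R) : (rho < r)%N -> 0 < e <= 1 -> `|s| = 1 ->
  pr P [set w | e * r%:R ^+ 3 <= s * \sum_(j < r ^ 3) tdev (j * r + rho)%N w] <=
    expR (- (e ^+ 2 * r%:R / 8)).
Proof.
move=> rr /andP[e0 e1] s1.
have rp : (0 : R) < r%:R by rewrite ltr0n.
have cm j : (j < r ^ 3)%N -> (j * r + rho < ncell)%N.
  move=> jm; rewrite /ncell expnSr; apply: (@leq_trans (j.+1 * r)%N).
    by rewrite mulSn addnC ltn_add2r.
  by rewrite leq_mul2r jm orbT.
pose a := e ^+ 2 * r%:R / 4.
(* The value e / (4 r^2) minimises - u e r^3 + 2 u^2 r^5, the exponent of [capped_sum_tail]; [a] is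
   the threshold e r^3 times this value. *)
pose u := s * e / (4 * r%:R ^+ 2).
have := @capped_sum_tail _ _ _ P _ Y Yi (r ^ 3) r (fun j => window n r theta (j * r + rho)%N)
  (fun j => tc (j * r + rho)%N) u a.
have nu : `|u| = e / (4 * r%:R ^+ 2).
  have q0 : 0 < (4 * r%:R ^+ 2 : R) by rewrite mulr_gt0// exprn_gt0.
  by rewrite /u normrM normrM s1 mul1r gtr0_norm// gtr0_norm// invr_gt0.
have u2 : u ^+ 2 = (e / (4 * r%:R ^+ 2)) ^+ 2 by rewrite -nu real_normK// num_real.
have -> : - a + (r ^ 3)%:R * (2 * u ^+ 2 * r%:R ^+ 2) = - (e ^+ 2 * r%:R / 8).
  by rewrite u2 /a natrX; field; rewrite gt_eqF.
rewrite (_ : [set w | a <= _] = [set w | e * r%:R ^+ 3 <= s * \sum_(j < r ^ 3) tdev (j * r + rho)%N w]).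
  apply.
  - move=> i j im jm ij k; apply: window_disjoint; [|exact: cm|exact: cm].
    have [h|h] : (i < j)%N \/ (j < i)%N by lia.
      by left; nia.
    by right; nia.
  - by move=> c v _; exact: sigma_tcount.
  - by move=> c w; exact: tcount_le.
  - rewrite nu; have -> : e / (4 * r%:R ^+ 2) * r%:R = e / (4 * r%:R).
      by field; rewrite gt_eqF.
    rewrite ler_pdivrMr ?mulr_gt0//.
    have : (1 : R) <= r%:R by rewrite ler1n.
    lra.
have E x : (a <= u * x) = (e * r%:R ^+ 3 <= s * x).
  have k0 : 0 < e / (4 * r%:R ^+ 2) by rewrite divr_gt0// mulr_gt0// exprn_gt0.
  rewrite -[RHS](ler_pM2l k0) /a /u.
  by congr (_ <= _); [field; rewrite gt_eqF|ring].
by apply/funext => w; rewrite /mkset/= -E.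
Qed.

Definition devev (e : R) : set T := [set w | e * r%:R ^+ 4 <= `|\sum_(c < ncell) tdev c w|].

Lemma measurable_devev e : measurable (devev e).
Proof.
apply: (@measurable_le_fun _ _ _ (fun=> e * r%:R ^+ 4)) => //.
by apply: measurableT_comp => //; apply: measurable_sum => c; exact: measurable_tdev.
Qed.

(** A total deviation e r^4 forces a deviation e r^3 in one of the r classes, upwards or downwards:
    hence the factor 2 r. *)
Lemma pr_devev (e : R) : 0 < e <= 1 ->
  pr P (devev e) <= 2 * r%:R * expR (- (e ^+ 2 * r%:R / 8)).
Proof.
move=> he.
pose F (x : 'I_r * bool) : set T :=
  [set w | e * r%:R ^+ 3 <= (-1) ^+ x.2 * \sum_(j < r ^ 3) tdev (j * r + x.1)%N w].
have mF x : measurable (F x).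
  apply: (@measurable_le_fun _ _ _ (fun=> e * r%:R ^+ 3)) => //.
  by apply: measurable_funM => //; apply: measurable_sum => c; exact: measurable_tdev.
apply: (@le_trans _ _ (pr P [set w | exists x, F x w])).
  apply: pr_le; [exact: measurable_devev|exact: measurable_exists|].
  move=> w; rewrite /devev/= => hw.
  apply: contrapT => nF.
  have hF (rho : 'I_r) : `|\sum_(j < r ^ 3) tdev (j * r + rho)%N w| < e * r%:R ^+ 3.
    have h (b : bool) : (-1) ^+ b * \sum_(j < r ^ 3) tdev (j * r + rho)%N w < e * r%:R ^+ 3.
      by rewrite ltNge; apply/negP => hb; apply: nF; exists (rho, b).
    rewrite ltr_norml ltrNl; have := h true; have := h false.
    by rewrite expr0 expr1 mul1r mulN1r => -> ->.
  move: hw; apply/negP; rewrite -ltNge.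
  rewrite /ncell expnSr (sum_blocks _ _ (fun c => tdev c w)) exchange_big/=.
  apply: (le_lt_trans (ler_norm_sum _ _ _)).
  apply: (@lt_le_trans _ _ (\sum_(i < r) e * r%:R ^+ 3)).
    by apply: ltr_sum => [|i _]; [apply/hasP|exact: hF]; exists (Ordinal r0) => //; exact: mem_index_enum.
  by rewrite sumr_const card_ord -[leLHS]mulr_natl exprS mulrCA.
apply: (le_trans (pr_exists P mF)).
apply: (@le_trans _ _ (\sum_(x : 'I_r * bool) expR (- (e ^+ 2 * r%:R / 8)))).
  apply: ler_sum => -[rho b] _; apply: class_tail => //.
  by rewrite normrX normrN1 expr1n.
by rewrite sumr_const card_prod card_ord card_bool -[leLHS]mulr_natl natrM [r%:R * _]mulrC.
Qed.

Definition scev c : set T :=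
  [set w | ftrig (Yw w) (gpt (c * nfine)%N) * ftrig (Yw w) (gpt (c.+1 * nfine)%N) < 0].

Lemma measurable_scev c : measurable (scev c).
Proof.
have mf t : measurable_fun [set: T] (fun w => ftrig (Yw w) t).
  rewrite (_ : (fun w => _) = Zc Y t ord0); first by case: (Zc_iid Yi t).
  by apply/funext => w; exact: ftrig_Zc.
by apply: (@measurable_lt_fun _ _ _ _ (fun=> 0)) => //; exact: measurable_funM.
Qed.

Let i1 : 'I_n.+1 := inord 1.
Let i1E : i1 = 1%N :> nat. Proof. by rewrite inordK. Qed.

(* If 0 < Z_0 < 1, Z_1 < - a0 and the other Z_k are moderate, then the polynomial
   of the cell is positive at 0 and negative at 1. *)
Lemma pr_scev c : c0 R <= pr P (scev c).
Proof.
set tau := gpt (c * nfine)%N; have Zi := Zc_iid Yi tau; set Z := Zc Y tau in Zi.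
have i01 : ord0 != i1 by rewrite -val_eqE/= i1E.
pose I0 : set R := `]0, 1[%classic; pose I1 : set R := `](- a0 R - 1), (- a0 R)[%classic.
pose E : set T := [set w | I0 (Z ord0 w) /\ I1 (Z i1 w)].
pose F : set T := ~` big_coord Z 2 2.
have mE : measurable E.
  have [mZ _] := Zi; apply: measurableI; apply: measurable_fun_preimage => //.
  - exact: measurable_itv.
  - exact: measurable_itv.
have mF : measurable F by apply: measurableC; exact: (measurable_big_coord Zi).
have cE : cyl Z [set ord0; i1]%SET E.
  exists (fun i => if i == ord0 then I0 else I1).
    by move=> i; case: ifP => _; exact: measurable_itv.
  apply/seteqP; split => w /=.
    by move=> [h0 h1] i; rewrite !inE => /orP[] /eqP ->; rewrite ?eqxx// eq_sym (negbTE i01).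
  move=> h; split; first by have := h ord0; rewrite !inE eqxx; apply.
  by have := h i1; rewrite !inE eqxx orbT eq_sym (negbTE i01); apply.
have cF : cyl Z [set k : 'I_n.+1 | (2 <= k)%N]%SET F.
  exists (fun k => `[- (2 * k.+1%:R), 2 * k.+1%:R]%classic) => //.
  apply/seteqP; split => w /=.
    move=> nB k; rewrite inE => k2; rewrite in_itv/= -ler_norml leNgt.
    by apply/negP => hk; apply: nB; exists k.
  move=> h [k [k2 hk]]; have := h k; rewrite inE => /(_ k2).
  by rewrite in_itv/= -ler_norml leNgt hk.
have dj i : i \in [set ord0; i1]%SET -> i \notin [set k : 'I_n.+1 | (2 <= k)%N]%SET.
  by rewrite !inE => /orP[] /eqP ->; rewrite ?i1E.
have prF : 2^-1 <= pr P F.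
  rewrite prC; last exact: (measurable_big_coord Zi).
  have := pr_big_coord Zi 2 (isT : (0 < 2)%N).
  have := expR1_le4 R; rewrite /Kt; set p := pr _ _.
  have -> : (2^-1 : R) ^+ (2 * 3) = 64^-1 by rewrite exprVn -natrX.
  lra.
have prEF : pr P (E `&` F) = pr P E * pr P F.
  by rewrite /pr (cyl_indep Zi dj cE cF) fineM// fin_num_measure.
have prEE : pr P E = fine (normal_prob 0 1 I0) * fine (normal_prob 0 1 I1).
  have mI0 : measurable I0 by exact: measurable_itv.
  have mI1 : measurable I1 by exact: measurable_itv.
  by rewrite /pr (gauss_iid2 Zi i01 mI0 mI1) fineM// fin_num_measure.
apply: (@le_trans _ _ (pr P (E `&` F))).
  by rewrite prEF prEE /c0 ler_wpM2l// mulr_ge0 ?fine_ge0 ?measure_ge0.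
apply: pr_le; [exact: measurableI|exact: measurable_scev|].
move=> w [[/= z0 z1] nB]; rewrite /scev /= gpt_cell -/tau.
have hcl := clen_bounds r0 th.
have hcl' : 0 <= clen <= clen by rewrite lexx andbT ltW//; case/andP: hcl.
have hcl4 : 0 <= clen <= pi / 4 by case/andP: hcl => /ltW -> ->.
rewrite (ftrig_spoly tau (Yw w) hcl hcl') divff ?gt_eqF ?tan_gt0_piquarter//.
rewrite ftrig_Zc -/Z mulrCA pmulr_rlt0 ?exprn_gt0 ?cos_gt0_piquarter//.
move: z0 z1; rewrite /I0 /I1 /= !in_itv/= => /andP[z0 z01] /andP[_ z1].
rewrite pmulr_rlt0// horner_spoly.
rewrite (bigD1 ord0)//= (bigD1 i1)//=; last by rewrite eq_sym.
rewrite !expr1n !mulr1 i1E -/(bco n clen 1).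
have -> : sqbin R n (ord0 : 'I_n.+1) = 1 by rewrite /sqbin bin0 sqrtr1.
rewrite mulr1 -/(Z ord0 w) -/(Z i1 w).
have b1 : 1 <= bco n clen 1.
  by apply: (@le_trans _ _ (sn * clen)); [case/andP: (sn_clen r0 hr)|exact: bco1_ge].
have W : wnorm n.+1 2 (spoly clen (fun k => Z k w)) <= K0 R / 8.
  apply: (@le_trans _ _ (2 * 1 * (K0 R * 4^-1 ^+ 2))); last first.
    by rewrite le_eqVlt; apply/orP; left; apply/eqP; field.
  apply: wnorm_le => // k k2; first by rewrite mul1r; exact: (bco_clen r0 th hr).
  by rewrite leNgt; apply/negP => hk; apply: nB; exists k.
have rest : \sum_(k < n.+1 | (k != ord0) && (k != i1))
    rotv tau (Yw w) k * (sqbin R n k * tan clen ^+ k) * 1 ^+ k <= K0 R / 8.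
  apply: le_trans W; rewrite wnorm_spoly big_mkcond/=; apply: ler_sum => k _.
  case: ifP => [/andP[k0 k1]|_]; last by rewrite mulr_ge0.
  have k2 : (2 <= k)%N.
    by move: k0 k1; rewrite -!val_eqE/= i1E; case: (nat_of_ord k) => [|[|]].
  rewrite expr1n mulr1 (le_trans (ler_norm _))// ler_peMl// ler1n bin_gt0//.
set S := \sum_(_ < _ | _) _ in rest *.
have zb : Z i1 w * bco n clen 1 <= - a0 R.
  apply: (@le_trans _ _ (Z i1 w)); last exact: ltW.
  rewrite -subr_ge0 -[X in X - _]mulr1 -mulrBr.
  have := K0_gt0 R; rewrite /a0 in z1 *; nra.
change (Z ord0 w + (Z i1 w * bco n clen 1 + S) < 0).
have := K0_gt0 R; rewrite /a0 in zb *; lra.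
Qed.

Hypothesis rbig : (3 * r * (Jtr r ^ 2 + 2) <= 2 ^ r)%N.

(** The tail sum contains the probability of a positive count, and outside the bad event a sign
    change of f between the ends of the cell makes the count positive. *)
Lemma tmu_ge c : (c < ncell)%N -> c0 R - pr P (badev r theta Y) <= tmu c.
Proof.
move=> cm; have mB := measurable_badev r theta n0 Yi.
have mt v : measurable [set w | (v < tc c w)%N].
  have [] := @pr_pred_sum _ _ _ P r (tc c) (fun x => (v < x)%N) => //.
  - by move=> w; exact: tcount_le.
  - by move=> u; exact: measurable_tc.
rewrite lerBlDr; apply: (le_trans (pr_scev c)).
apply: (@le_trans _ _ (pr P ([set w | (0 < tc c w)%N] `|` badev r theta Y))).
  apply: pr_le; [exact: measurable_scev|exact: measurableU|].
  move=> w sw; have [Bw|nB] := pselect (badev r theta Y w); [by right|left => /=].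
  by apply: good_tcount_gt0 (not_bad_good r0 th hr rbig nB) cm sw.
apply: (le_trans (prU _ (mt 0%N) mB)); rewrite lerD2r.
rewrite /tmu /tmean (bigD1 (Ordinal r0))//= lerDl sumr_ge0// => v _.
exact: pr_ge0.
Qed.

Lemma sum_tmu_ge : r%:R ^+ 4 * (c0 R - pr P (badev r theta Y)) <= \sum_(c < ncell) tmu c.
Proof.
apply: (@le_trans _ _ (\sum_(c < ncell) (c0 R - pr P (badev r theta Y)))).
  by rewrite sumr_const card_ord -[leRHS]mulr_natl /ncell natrX.
by apply: ler_sum => c _; exact: tmu_ge.
Qed.

(** For m < r each term is at most the probability of B, beyond that the decay of [pr_manyev] is
    summed. This bounds the part of the mean number of zeros that lives on an exceptional event. *)
Lemma sum_many_le (B : set T) : measurable B ->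
  \sum_(c < ncell) \sum_(m < n.+1) pr P (manyev r theta Y c m.+1 `&` B) <=
    r%:R ^+ 4 * (r%:R * pr P B + K1 R * 2^-1 ^+ r).
Proof.
move=> mB.
apply: (@le_trans _ _ (\sum_(c < ncell) (r%:R * pr P B + K1 R * 2^-1 ^+ r))); last first.
  by rewrite sumr_const card_ord -[leLHS]mulr_natl /ncell natrX.
apply: ler_sum => c _; rewrite (bigID (fun m : 'I_n.+1 => (m < r)%N))/=.
have mm m : measurable (manyev r theta Y c m) by exact: (measurable_manyev _ _ Yi).
apply: lerD.
  apply: le_trans (sum_const_lt n.+1 r (pr_ge0 P B)).
  apply: ler_sum => m _; by apply: pr_le => //; exact: measurableI.
apply: (@le_trans _ _ (\sum_(m < n.+1 | (r <= m)%N) K1 R / 2 * 2^-1 ^+ m)).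
  rewrite (eq_bigl (fun m : 'I_n.+1 => (r <= m)%N)); last by move=> m; rewrite -leqNgt.
  apply: ler_sum => m _; apply: (@le_trans _ _ (pr P (manyev r theta Y c m.+1))).
    by apply: pr_le => //; exact: measurableI.
  by rewrite -mulrA -exprS; apply: (pr_manyev r0 th hr Yi).
rewrite -mulr_sumr; apply: (@le_trans _ _ (K1 R / 2 * (2 * 2^-1 ^+ r))).
  by rewrite ler_wpM2l ?divr_ge0 ?K1_ge0// sum_geo_half// invr_ge0 ler0n lexx.
by rewrite mulrA divfK.
Qed.

End Quarter_counts.

(** * From real zeros to angles *)

Section Angles.
Variable R : realType.
Implicit Types (a b : \bar R).

Definition ang (x : \bar R) : R :=
  match x with r%:E => atan r | +oo%E => pi / 2 | -oo%E => - (pi / 2) end.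

Lemma ang_bounds x : - (pi / 2) <= ang x <= pi / 2.
Proof.
case: x => [r||] /=; last 2 first.
- by rewrite lexx andbT; have := pi_gt0 R; lra.
- by rewrite lexx; have := pi_gt0 R; lra.
by rewrite !ltW// ?atan_gtNpi2 ?atan_ltpi2.
Qed.

Lemma ang_homo a b : (a < b)%E -> ang a < ang b.
Proof.
have pi0 := pi_gt0 R; case: a b => [r||] [s||]//= h.
- by rewrite lt_atan// -lte_fin.
- exact: atan_ltpi2.
- exact: atan_gtNpi2.
- by lra.
Qed.

Lemma lt_ang a b : (ang a < ang b) = (a < b)%E.
Proof.
apply/idP/idP; last exact: ang_homo.
apply: contraLR; rewrite -leNgt -leNgt le_eqVlt => /orP[/eqP ->//|/ang_homo/ltW//].
Qed.

End Angles.

Section Real_zeros.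
Variables (R : realType).

Lemma nb_real_zerosP (p : {poly R}) (a b : \bar R) : p != 0 ->
  exists zs : seq R, [/\ uniq zs, (size zs < size p)%N,
    (forall x, x \in zs = (a < x%:E < b)%E && root p x) & nb_real_zeros p a b = size zs].
Proof.
move=> p0; set S := [set x : R | (a < x%:E < b)%E /\ root p x].
have small (s : seq R) : uniq s -> {subset s <= S} -> (size s < size p)%N.
  move=> us sS; apply: max_poly_roots => //.
  by apply/allP => x /sS; rewrite inE => -[].
have fS : finite_set S.
  apply: contrapT => /(@infinite_set_fset _ _ (size p))[F FS].
  apply/negP; rewrite -ltnNge; apply: small; first exact: fset_uniq.
  by move=> x xF; rewrite inE; exact: FS.
exists (fset_set S); split.
- exact: fset_uniq.
- by apply: small => [|x]; [exact: fset_uniq|rewrite in_fset_set].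
- move=> x; rewrite in_fset_set//; apply/idP/idP; first by rewrite inE => -[-> ->].
  by move=> /andP[h1 h2]; rewrite inE.
- by [].
Qed.

(** The interval is infinite, so [fset_set] returns its default value; this lets [nb_zeros_le] cover
    the zero polynomial. *)
Lemma nb_real_zeros0 (a b : \bar R) : (a < b)%E -> nb_real_zeros 0 a b = 0%N.
Proof.
move=> ab; set S := [set x : R | (a < x%:E < b)%E /\ root 0 x].
suff nS : ~ finite_set S.
  by rewrite /nb_real_zeros /fset_set; case: pselect.
move=> fS; pose f (k : nat) := tan (ang a + (ang b - ang a) / k.+2%:R).
have h := ang_homo ab.
have := ang_bounds a; have := ang_bounds b => hb ha.
have fr k : ang a < ang a + (ang b - ang a) / k.+2%:R < ang b.
  rewrite ltrDl divr_gt0 ?subr_gt0//= -ltrBrDl ltr_pdivrMr// ltr_pMr ?subr_gt0//.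
  by rewrite ltr1n.
have fin k : ang a + (ang b - ang a) / k.+2%:R \in `](- (pi / 2)), (pi / 2)[.
  by rewrite in_itv/=; have := fr k; move: (_ + _) => x hx; lra.
have finj : injective f.
  move=> i j /(tan_inj (fin i) (fin j)) /addrI /mulfI.
  have d0 : ang b - ang a != 0 by rewrite gt_eqF// subr_gt0.
  by move=> /(_ d0) /invr_inj /eqP; rewrite eqr_nat => /eqP[].
have fm k : f k \in fset_set S.
  rewrite in_fset_set// inE; split; last by rewrite root0.
  have e : ang (f k)%:E = ang a + (ang b - ang a) / k.+2%:R by rewrite /= tanK.
  by rewrite -!lt_ang e.
have u : uniq (map f (iota 0 (size (fset_set S)).+1)) by rewrite map_inj_uniq ?iota_uniq.
have sub : {subset map f (iota 0 (size (fset_set S)).+1) <= fset_set S}.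
  by move=> x /mapP[k _ ->].
by have := uniq_leq_size u sub; rewrite size_map size_iota ltnn.
Qed.

End Real_zeros.

Section Angle_zeros.
Variables (R : realType) (n : nat).
Implicit Types (y : 'I_n.+1 -> R) (a b : \bar R).

Lemma ftrig_root y t : - (pi / 2) < t < pi / 2 -> (ftrig y t == 0) = root (ellp y) (tan t).
Proof.
move=> ht; have c0 : 0 < cos t by rewrite cos_gt0_pihalf.
by rewrite (ftrig_ellp _ (lt0r_neq0 c0)) mulf_eq0 expf_eq0 (gt_eqF c0) andbF.
Qed.

Lemma angle_zeros y a b : ellp y != 0 -> exists ts : seq R,
  [/\ uniq ts, (size ts <= n.+1)%N,
    (forall t, t \in ts = (ang a < t < ang b) && (ftrig y t == 0)) &
    nb_real_zeros (ellp y) a b = size ts].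
Proof.
move=> y0; have [zs [uzs szs hzs ->]] := nb_real_zerosP a b y0.
exists (map atan zs); split.
- rewrite map_inj_uniq// => u v e; by rewrite -[u]atanK e atanK.
- rewrite size_map (leq_trans (ltnW szs))// size_poly//.
- move=> t; have := ang_bounds a; have := ang_bounds b => hb ha.
  apply/mapP/idP.
    move=> [x]; rewrite hzs => /andP[h1 h2] ->.
    have -> : ang a < atan x < ang b by rewrite -[atan x]/(ang x%:E) !lt_ang.
    by rewrite ftrig_root ?atanK ?h2// atan_gtNpi2 atan_ltpi2.
  move=> /andP[h1 h2].
  have ht : t \in `](- (pi / 2)), (pi / 2)[ by rewrite in_itv/=; lra.
  have tE : atan (tan t) = t by rewrite tanK.
  exists (tan t) => //; rewrite hzs -!lt_ang /= tE h1/= -ftrig_root//.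
- by rewrite size_map.
Qed.

End Angle_zeros.

Section Quarters.
Variables (R : realType) (n r : nat) (a b : \bar R).
Hypothesis n0 : (0 < n)%N.
Hypothesis r0 : (0 < r)%N.
Hypothesis ab : (a < b)%E.
Implicit Types (y : 'I_n.+1 -> R).

Definition qlen : R := (ang b - ang a) / 4.
Definition qpt (i : nat) : R := ang a + i%:R * qlen.

Lemma qlen_bounds : 0 < qlen <= pi / 4.
Proof.
have := ang_homo ab; have := ang_bounds a; have := ang_bounds b; rewrite /qlen.
move=> h1 h2 h3; apply/andP; split; lra.
Qed.

Lemma qptS i : qpt i.+1 = qpt i + qlen.
Proof. by rewrite /qpt -natr1; ring. Qed.

Lemma qpt0 : qpt 0 = ang a. Proof. by rewrite /qpt mul0r addr0. Qed.

Lemma qpt4 : qpt 4 = ang b. Proof. by rewrite /qpt /qlen; field. Qed.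

Lemma qpt_mono : {homo qpt : i j / (i <= j)%N >-> i <= j}.
Proof.
move=> i j ij; rewrite lerD2l ler_wpM2r ?ler_nat//.
by case/andP: qlen_bounds => /ltW.
Qed.

Let qzeros (ts : seq R) (i : nat) : seq R :=
  [seq t - qpt i | t <- [seq t <- ts | (qpt i <= t) && (t < qpt i.+1)]].

Let size_qzeros ts : (forall t, t \in ts -> ang a < t < ang b) ->
  size ts = (\sum_(i < 4) size (qzeros ts i))%N.
Proof.
move=> h; under eq_bigr do rewrite size_map size_filter.
rewrite (count_itv_sum 4 ts qpt_mono) qpt0 qpt4; apply/esym/eqP; rewrite -all_count.
by apply/allP => t /h /andP[/ltW -> ->].
Qed.

Let uniq_qzeros ts i : uniq ts -> uniq (qzeros ts i).
Proof. by move=> u; rewrite map_inj_uniq ?filter_uniq// => x z /addIr. Qed.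

(** Quarters are closed on the left while the interval is open: the third condition removes the end
    [ang a], which belongs to the quarter of index 0. *)
Let mem_qzeros y ts i : (i < 4)%N ->
  (forall t, t \in ts = (ang a < t < ang b) && (ftrig y t == 0)) ->
  forall z, z \in qzeros ts i =
    [&& 0 <= z, z < qlen, ang a < qpt i + z & ftrig (rotv (qpt i) y) z == 0].
Proof.
move=> i4 h z; have := qlen_bounds => hq.
have cz (x : R) : 0 <= x -> x < qlen -> cos x != 0.
  move=> z0 z1; rewrite gt_eqF// cos_gt0_piquarter// z0/=; lra.
have fw (t : R) : qpt i <= t -> t < qpt i + qlen -> ang a < t -> ftrig y t == 0 ->
    [&& 0 <= t - qpt i, t - qpt i < qlen, ang a < qpt i + (t - qpt i) &
      ftrig (rotv (qpt i) y) (t - qpt i) == 0].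
  move=> t0 t1 ta ft.
  have z0 : 0 <= t - qpt i by lra.
  have z1 : t - qpt i < qlen by lra.
  have e : qpt i + (t - qpt i) = t by lra.
  rewrite z0 z1 -ftrig_rot ?cz//.
  by move: (_ + _) e => u ->; rewrite ta ft.
apply/mapP/idP.
  move=> [t]; rewrite mem_filter h qptS => /andP[/andP[t0 t1] /andP[/andP[ta tb] ft]] ->.
  exact: fw.
move=> /and4P[z0 z1 za fz]; exists (qpt i + z); last by lra.
rewrite mem_filter h qptS lerDl z0 ltrD2l z1 za ftrig_rot ?cz// fz !andbT/=.
apply: (@lt_le_trans _ _ (qpt i.+1)); first by rewrite qptS ltrD2l.
by rewrite -qpt4 qpt_mono.
Qed.

Lemma nb_zeros_le y : (nb_real_zeros (ellp y) a b <=
  \sum_(i < 4) \sum_(c < ncell r) \sum_(m < n.+1)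
    `[< many r qlen c m.+1 (rotv (qpt i) y) >])%N.
Proof.
have [->|y0] := eqVneq (ellp y) 0; first by rewrite nb_real_zeros0.
have [ts [uts sts hts ->]] := angle_zeros a b y0.
rewrite size_qzeros; last by move=> t; rewrite hts => /andP[].
apply: leq_sum => i _; apply: size_zeros_le => //.
- exact: qlen_bounds.
- exact: uniq_qzeros.
- by rewrite size_map size_filter (leq_trans (count_size _ _)).
- by move=> z; rewrite (mem_qzeros _ hts)// => /and4P[-> -> _ /eqP ->].
Qed.

Lemma nb_zeros_good y : (forall i, (i < 4)%N -> good r qlen (rotv (qpt i) y)) ->
  nb_real_zeros (ellp y) a b =
  (\sum_(i < 4) \sum_(c < ncell r) tcount r qlen c (rotv (qpt i) y))%N.
Proof.
move=> gy; have hq := qlen_bounds.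
(* The grid point 0 is not a zero. This makes the polynomial nonzero, and counting the end [ang a]
   adds no zero. *)
have f0 i : (i < 4)%N -> ftrig (rotv (qpt i) y) 0 != 0.
  by move=> i4; have := good_neq0 (gy i i4) (leq0n _); rewrite gpt0.
have y0 : ellp y != 0.
  apply: contraNneq (f0 0%N isT) => e; rewrite -ftrig_rot ?cos0 ?oner_neq0//.
  have yz k : y k = 0.
    have := congr1 (fun p : {poly R} => p`_k) e; rewrite coef_poly ltn_ord inord_val coef0.
    have sb : sqbin R n k != 0 by apply: lt0r_neq0; apply: sqbin_gt0; rewrite -ltnS.
    by move/eqP; rewrite mulf_eq0 (negbTE sb) orbF => /eqP.
  by apply/eqP; rewrite /ftrig big1// => k _; rewrite yz mul0r.
have [ts [uts sts hts ->]] := angle_zeros a b y0.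
rewrite size_qzeros; last by move=> t; rewrite hts => /andP[].
apply: eq_bigr => i _; apply: good_size_zeros => //.
- exact: gy.
- exact: uniq_qzeros.
- move=> z; rewrite (mem_qzeros _ hts)//.
  case: (boolP (0 <= z)) => //= z0; case: (boolP (z < qlen)) => //= z1.
  case: (boolP (ftrig _ _ == 0)) => fz; rewrite ?andbF// andbT.
  have zp : 0 < z.
    rewrite lt_neqAle z0 andbT; apply: contraTneq fz => <-; exact: f0.
  by have := qpt_mono (leq0n i); rewrite qpt0 => h; lra.
Qed.

End Quarters.

Lemma sum_nat_lt t r : (t <= r)%N -> (\sum_(v < r) (v < t) = t)%N.
Proof.
move=> tr; rewrite -[RHS]card_ord -sum1_card (big_ord_widen r (fun=> 1%N) tr).
by rewrite [RHS]big_mkcond/=; apply: eq_bigr => v _; case: ltnP.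
Qed.

Lemma sum_prod (V : nmodType) (I J : finType) (F : I * J -> V) :
  \sum_x F x = \sum_i \sum_j F (i, j).
Proof. by rewrite pair_bigA; apply: eq_bigr => -[]. Qed.

(** * Mean and deviation of the number of zeros in the interval *)

Section Zeros_of_interval.
Context d (T : measurableType d) (R : realType) (P : probability T R).
Variables (n r : nat) (a b : \bar R) (X : 'I_n.+1 -> T -> R).
Hypothesis n0 : (0 < n)%N.
Hypothesis r50 : (50 <= r)%N.
Hypothesis ab : (a < b)%E.
Local Notation theta := (qlen a b).
Hypothesis hr : r%:R ^+ 4 <= Num.sqrt n%:R * theta <= r.+1%:R ^+ 4.
Hypothesis Xi : gauss_iid P X.
Hypothesis rbig : (3 * r * (Jtr r ^ 2 + 2) <= 2 ^ r)%N.

Local Notation ncell := (ncell r).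

Let r0 : (0 < r)%N. Proof. exact: leq_trans r50. Qed.
Let th : 0 < theta <= pi / 4. Proof. exact: qlen_bounds. Qed.

Definition Yq (i : nat) : 'I_n.+1 -> T -> R := Zc X (qpt a b i).
Let Yi i : gauss_iid P (Yq i). Proof. exact: Zc_iid. Qed.

Definition nzeros (w : T) : nat := nb_real_zeros (ellp (fun k => X k w)) a b.
Definition enz : \bar R := 'E_P[fun w => (nzeros w)%:R].

Definition qbad : set T := [set w | exists i : 'I_4, badev r theta (Yq i) w].
Definition tcq (i c : nat) (w : T) : nat := tc r theta (Yq i) c w.
(** The centre with which both the number of zeros and its expectation are compared. *)
Definition stmu : R := \sum_(i < 4) \sum_(c < ncell) tmu P r theta (Yq i) c.

Lemma measurable_qbad : measurable qbad.
Proof. by apply: measurable_exists => i; exact: (measurable_badev _ _ n0 (Yi i)). Qed.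

Lemma pr_qbad : pr P qbad <= 4 * pbad R r.
Proof.
apply: (le_trans (pr_exists P (fun i : 'I_4 => measurable_badev _ _ n0 (Yi i)))).
apply: (@le_trans _ _ (\sum_(i < 4) pbad R r)).
  by apply: ler_sum => i _; exact: (pr_badev n0 r0 th hr (Yi i)).
by rewrite sumr_const card_ord -[leLHS]mulr_natl.
Qed.

Lemma nzeros_good w : ~ qbad w -> nzeros w = (\sum_(i < 4) \sum_(c < ncell) tcq i c w)%N.
Proof.
move=> nb; apply: nb_zeros_good => // i i4.
have := @not_bad_good _ _ _ _ _ _ (Yq i) r0 th hr rbig w.
by apply => h; apply: nb; exists (Ordinal i4).
Qed.

Lemma nzeros_le w : (nzeros w <= \sum_(i < 4) \sum_(c < ncell) \sum_(m < n.+1)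
  indb (manyev r theta (Yq i) c m.+1) w)%N.
Proof.
have := @nb_zeros_le _ _ _ _ _ r0 ab (fun k => X k w).
move=> /leq_trans; apply; apply: leq_sum => i _; apply: leq_sum => c _.
apply: leq_sum => m _; case: asboolP => // h.
by rewrite indbE.
Qed.

Let measurable_gt i c v : measurable [set w | (v < tcq i c w)%N].
Proof.
have [] := @pr_pred_sum _ _ _ P r (tcq i c) (fun x => (v < x)%N) => //.
- by move=> w; exact: tcount_le.
- by move=> u; exact: (measurable_tc _ _ (Yi i)).
Qed.

Let sum_indb_gt i c w : (\sum_(v < r) indb [set w | (v < tcq i c w)%N] w = tcq i c w)%N.
Proof.
rewrite -[RHS](@sum_nat_lt _ r) ?tcount_le//; apply: eq_bigr => v _.
by case: ltnP => h; [rewrite indbE|rewrite indbN//=; apply/negP; rewrite -leqNgt].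
Qed.

Let measurable_many i c m : measurable (manyev r theta (Yq i) c m `&` qbad).
Proof. by apply: measurableI; [exact: (measurable_manyev _ _ (Yi i))|exact: measurable_qbad]. Qed.

(** The number of zeros is dominated by indicators of two kinds: those that enumerate the truncated
    counts, and the [manyev] events cut by [qbad], whose number bounds the zeros there. *)
Lemma enz_le : (enz <= (stmu + 4 * (r%:R ^+ 4 * (r%:R * pr P qbad + K1 R * 2^-1 ^+ r)))%:E)%E.
Proof.
pose A (x : ('I_4 * ('I_ncell * 'I_r)) + ('I_4 * ('I_ncell * 'I_n.+1))) : set T :=
  match x with
  | inl (i, (c, v)) => [set w | (v < tcq i c w)%N]
  | inr (i, (c, m)) => manyev r theta (Yq i) c m.+1 `&` qbad
  end.
have mA x : measurable (A x).
  by case: x => -[i [c v]] /=; [exact: measurable_gt|exact: measurable_many].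
have split_sum (V : nmodType) (F : ('I_4 * ('I_ncell * 'I_r)) + ('I_4 * ('I_ncell * 'I_n.+1)) -> V) :
    \sum_x F x = \sum_(i < 4) \sum_(c < ncell) \sum_(v < r) F (inl (i, (c, v))) +
      \sum_(i < 4) \sum_(c < ncell) \sum_(m < n.+1) F (inr (i, (c, m))).
  rewrite big_sumType/=; congr (_ + _).
    by rewrite sum_prod; apply: eq_bigr => i _; rewrite sum_prod.
  by rewrite sum_prod; apply: eq_bigr => i _; rewrite sum_prod.
apply: (le_trans (@expectation_nat_le _ _ _ P nzeros _ A mA _)).
  move=> w; rewrite (split_sum nat (fun x => indb (A x) w)).
  have [Bw|nB] := pselect (qbad w).
    apply: (leq_trans (nzeros_le w)); apply: leq_trans (leq_addl _ _).
    apply: leq_sum => i _; apply: leq_sum => c _; apply: leq_sum => m _ /=.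
    have [h|h] := pselect (manyev r theta (Yq i) c m.+1 w); last by rewrite indbN.
    by rewrite !indbE.
  rewrite (nzeros_good nB); apply: leq_trans (leq_addr _ _).
  apply: leq_sum => i _; apply: leq_sum => c _ /=.
  by rewrite sum_indb_gt.
rewrite lee_fin split_sum lerD2l.
apply: (@le_trans _ _ (\sum_(i < 4) (r%:R ^+ 4 * (r%:R * pr P qbad + K1 R * 2^-1 ^+ r)))).
  apply: ler_sum => i _.
  exact: (sum_many_le r50 th hr (Yi i) measurable_qbad).
by rewrite sumr_const card_ord -[leLHS]mulr_natl.
Qed.

(** Only the part of the truncated counts outside [qbad] is kept; a cell loses at most r times the
    probability of [qbad]. *)
Lemma enz_ge : ((stmu - 4 * (r%:R ^+ 4 * (r%:R * pr P qbad)))%:E <= enz)%E.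
Proof.
pose A (x : 'I_4 * ('I_ncell * 'I_r)) : set T :=
  [set w | (x.2.2 < tcq x.1 x.2.1 w)%N] `&` ~` qbad.
have mA x : measurable (A x).
  by apply: measurableI; [exact: measurable_gt|apply: measurableC; exact: measurable_qbad].
have split_sum (V : nmodType) (F : 'I_4 * ('I_ncell * 'I_r) -> V) :
    \sum_x F x = \sum_(i < 4) \sum_(c < ncell) \sum_(v < r) F (i, (c, v)).
  by rewrite sum_prod; apply: eq_bigr => i _; rewrite sum_prod.
apply: le_trans (@expectation_nat_ge _ _ _ P nzeros _ A mA _); last first.
  move=> w; rewrite (split_sum nat (fun x => indb (A x) w)).
  have [Bw|nB] := pselect (qbad w).
    rewrite big1// => i _; rewrite big1// => c _; rewrite big1// => v _.
    by rewrite indbN// => -[].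
  rewrite (nzeros_good nB); apply: leq_sum => i _; apply: leq_sum => c _.
  rewrite -sum_indb_gt; apply: leq_sum => v _; rewrite /A /=.
  have [h|h] := pselect ([set w | (v < tcq i c w)%N] w); first by rewrite [X in (_ <= X)%N]indbE// /indb leq_b1.
  by rewrite indbN// => -[].
rewrite lee_fin split_sum lerBlDr.
have -> : 4 * (r%:R ^+ 4 * (r%:R * pr P qbad)) = \sum_(i < 4) \sum_(c < ncell) \sum_(v < r) pr P qbad :> R.
  have cs N (x : R) : \sum_(i < N) x = N%:R * x by rewrite sumr_const card_ord -[LHS]mulr_natl.
  by rewrite 3!cs /ncell natrX.
rewrite -big_split/=; apply: ler_sum => i _; rewrite -big_split/=; apply: ler_sum => c _.
rewrite -big_split/=; apply: ler_sum => v _.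
apply: (@le_trans _ _ (pr P (A (i, (c, v)) `|` qbad))); last exact: (prU _ (mA _) measurable_qbad).
apply: pr_le; [exact: measurable_gt|apply: measurableU; [exact: mA|exact: measurable_qbad]|].
by move=> w h; have [Bw|nB] := pselect (qbad w); [right|left].
Qed.

(** The error per cell when the expectation is replaced by [stmu]; there are 4 r^4 cells. *)
Definition ddl : R := r%:R * (4 * pbad R r) + K1 R * 2^-1 ^+ r.

Lemma enz_bounds : enz \is a fin_num /\ `|fine enz - stmu| <= 4 * (r%:R ^+ 4 * ddl).
Proof.
have h1 := enz_le; have h2 := enz_ge.
have fe : enz \is a fin_num.
  by rewrite fin_numE; move: h1 h2; case: enz.
split=> //; move: h1 h2; rewrite -[enz]fineK// !lee_fin.
have k0 : 0 <= K1 R * 2^-1 ^+ r by rewrite mulr_ge0 ?K1_ge0// exprn_ge0// invr_ge0.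
have rq : r%:R * pr P qbad <= r%:R * (4 * pbad R r) by rewrite ler_wpM2l// pr_qbad.
have r4 : (0 : R) <= r%:R ^+ 4 by rewrite exprn_ge0.
have hA : r%:R ^+ 4 * (r%:R * pr P qbad) <= r%:R ^+ 4 * ddl.
  by rewrite ler_wpM2l// /ddl ler_wpDr.
have hB : r%:R ^+ 4 * (r%:R * pr P qbad + K1 R * 2^-1 ^+ r) <= r%:R ^+ 4 * ddl.
  by rewrite ler_wpM2l// /ddl lerD2r.
move=> h1 h2; rewrite ler_distl; move: hA hB h1 h2.
move: (r%:R ^+ 4 * ddl) (r%:R ^+ 4 * (r%:R * pr P qbad)) (r%:R ^+ 4 * (r%:R * pr P qbad + K1 R * 2^-1 ^+ r)).
by move=> x1 x2 x3 *; lra.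
Qed.

Lemma stmu_ge : 4 * (r%:R ^+ 4 * (c0 R - pbad R r)) <= stmu.
Proof.
apply: (@le_trans _ _ (\sum_(i < 4) r%:R ^+ 4 * (c0 R - pbad R r))).
  by rewrite sumr_const card_ord -[leRHS]mulr_natl.
apply: ler_sum => i _; apply: le_trans (sum_tmu_ge n0 r50 th hr (Yi i) rbig).
rewrite ler_wpM2l ?exprn_ge0// lerD2l lerN2.
exact: (pr_badev n0 r0 th hr (Yi i)).
Qed.

Definition qexc (e : R) : set T := qbad `|` [set w | exists i : 'I_4, devev P r theta (Yq i) e w].

Lemma measurable_qexc e : measurable (qexc e).
Proof.
apply: measurableU; first exact: measurable_qbad.
by apply: measurable_exists => i; exact: (measurable_devev _ _ (Yi i)).
Qed.

Lemma pr_qexc e : 0 < e <= 1 ->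
  pr P (qexc e) <= 4 * pbad R r + 4 * (2 * r%:R * expR (- (e ^+ 2 * r%:R / 8))).
Proof.
move=> he.
have mF (i : 'I_4) : measurable (devev P r theta (Yq i) e) by exact: (measurable_devev _ _ (Yi i)).
apply: (le_trans (prU _ measurable_qbad (measurable_exists mF))).
apply: lerD; first exact: pr_qbad.
apply: (le_trans (pr_exists P mF)).
apply: (@le_trans _ _ (\sum_(i < 4) 2 * r%:R * expR (- (e ^+ 2 * r%:R / 8)))).
  by apply: ler_sum => i _; exact: (pr_devev n0 r50 th hr (Yi i) he).
by rewrite sumr_const card_ord -[leLHS]mulr_natl.
Qed.

(** The number of zeros and its mean are both within 4 e r^4 of [stmu], and the mean is at least 2
    c0 r^4: the ratio is off by at most 8 e / (2 c0). *)
Lemma zeros_concentration e w : 0 < e -> ddl <= e -> pbad R r + ddl <= c0 R / 2 ->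
  ~ qexc e w -> `|(nzeros w)%:R / fine enz - 1| <= 4 * e / c0 R.
Proof.
move=> e0 de pd nE.
have [fe be] := enz_bounds; have sg := stmu_ge.
have c00 := c0_gt0 R.
have r4 : (0 : R) < r%:R ^+ 4 by rewrite exprn_gt0// ltr0n.
have nb : ~ qbad w by move=> h; apply: nE; left.
have dv (i : 'I_4) : `|\sum_(c < ncell) tdev P r theta (Yq i) c w| <= e * r%:R ^+ 4.
  rewrite leNgt; apply/negP => h; apply: nE; right; exists i; exact: ltW.
have NS : `|(nzeros w)%:R - stmu| <= 4 * (r%:R ^+ 4 * e).
  have -> : (nzeros w)%:R - stmu = \sum_(i < 4) \sum_(c < ncell) tdev P r theta (Yq i) c w.
    rewrite (nzeros_good nb) natr_sum /stmu -sumrB; apply: eq_bigr => i _.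
    by rewrite natr_sum -sumrB; apply: eq_bigr => c _.
  apply: (le_trans (ler_norm_sum _ _ _)).
  apply: (@le_trans _ _ (\sum_(i < 4) e * r%:R ^+ 4)); first exact: ler_sum.
  by rewrite sumr_const card_ord -[leLHS]mulr_natl [e * _]mulrC.
have E0 : 4 * (r%:R ^+ 4 * (c0 R / 2)) <= fine enz.
  have h : r%:R ^+ 4 * (pbad R r + ddl) <= r%:R ^+ 4 * (c0 R / 2) by rewrite ler_pM2l.
  move: be; rewrite ler_distl => /andP[be _].
  have e1 : r%:R ^+ 4 * (pbad R r + ddl) = r%:R ^+ 4 * pbad R r + r%:R ^+ 4 * ddl by ring.
  have e2 : r%:R ^+ 4 * (c0 R - pbad R r) = r%:R ^+ 4 * (c0 R / 2) + r%:R ^+ 4 * (c0 R / 2) - r%:R ^+ 4 * pbad R r by field.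
  lra.
have EE : 0 < fine enz by apply: lt_le_trans E0; rewrite 2?mulr_gt0// divr_gt0.
have -> : (nzeros w)%:R / fine enz - 1 = ((nzeros w)%:R - fine enz) / fine enz.
  by rewrite mulrBl divff// gt_eqF.
rewrite normrM normfV (gtr0_norm EE) ler_pdivrMr//.
have NE : `|(nzeros w)%:R - fine enz| <= 8 * (r%:R ^+ 4 * e).
  have de' : r%:R ^+ 4 * ddl <= r%:R ^+ 4 * e by rewrite ler_pM2l.
  have := ler_distD stmu (nzeros w)%:R (fine enz).
  rewrite [X in _ <= _ + X]distrC; lra.
apply: (le_trans NE).
apply: (@le_trans _ _ (4 * e / c0 R * (4 * (r%:R ^+ 4 * (c0 R / 2))))).
  by rewrite le_eqVlt; apply/orP; left; apply/eqP; field; rewrite gt_eqF.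
by rewrite ler_wpM2l// ltW// divr_gt0// mulr_gt0.
Qed.

End Zeros_of_interval.

(** * Almost sure convergence *)

Section Asymptotics.
Variable R : realType.

Lemma poly_expR_small (C c eta : R) (j : nat) : 0 < c -> 0 < eta ->
  exists r1 : nat, forall r : nat, (r1 <= r)%N -> C * r%:R ^+ j * expR (- (c * r%:R)) <= eta.
Proof.
move=> c0 e0; have [r1 h1] := pow_le_expR j.+1 c0.
have /andP[_ h2] := truncn_itv (divr_ge0 (normr_ge0 C) (ltW e0)).
exists (maxn r1 (Num.truncn (`|C| / eta)).+1) => r; rewrite geq_max => /andP[/h1 hr1 hr2].
have r0 : (0 : R) < r%:R by rewrite ltr0n (leq_trans _ hr2).
have hC : `|C| <= eta * r%:R.
  by rewrite mulrC -ler_pdivrMr// (le_trans (ltW h2))// ler_nat.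
have E0 := expR_gt0 (c * r%:R).
rewrite expRN ler_pdivrMr//.
apply: (@le_trans _ _ (`|C| * r%:R ^+ j)); first by rewrite ler_wpM2r ?exprn_ge0// ler_norm.
apply: (@le_trans _ _ (eta * r%:R * r%:R ^+ j)); first by rewrite ler_wpM2r ?exprn_ge0.
by rewrite -mulrA -exprS ler_wpM2l// ltW.
Qed.

Lemma half_pow_le (r : nat) : (2^-1 : R) ^+ r <= expR (- (2^-1 * r%:R)).
Proof.
rewrite [2^-1 * _]mulrC -mulrN expRM_natl lerXn2r ?nnegrE ?invr_ge0 ?expR_ge0//.
rewrite expRN lef_pV2 ?posrE ?expR_gt0//.
apply: (le_trans (expR_le_quadratic _)) => //.
by rewrite expr2; lra.
Qed.

Definition Cb : R := 2 * Kt R + 18 * K0 R ^+ 2 + 2 + K1 R.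

Lemma Cb_ge0 : 0 <= Cb.
Proof.
by rewrite /Cb !addr_ge0 ?K1_ge0// mulr_ge0 ?Kt_ge0// exprn_ge0// ltW// K0_gt0.
Qed.

Lemma pbad_le r : (0 < r)%N -> pbad R r <= Cb * r%:R ^+ 6 * expR (- (2^-1 * r%:R)).
Proof.
move=> r0; have r1 : (1 : R) <= r%:R by rewrite ler1n.
set q : R := 2^-1 ^+ r.
have q0 : 0 < q by rewrite exprn_gt0// invr_gt0.
have q1 : q <= 1 by rewrite exprn_ile1// ?invr_ge0// invf_le1// ler1n.
apply: (@le_trans _ _ (Cb * r%:R ^+ 6 * q)); last first.
  by rewrite ler_wpM2l ?half_pow_le// mulr_ge0 ?Cb_ge0// exprn_ge0.
have rE : (2 ^ r)%:R = q^-1 :> R by rewrite natrX /q exprVn invrK.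
have q4 : 4^-1 ^+ r = q ^+ 2 :> R by rewrite /q -exprM mulnC exprM; congr (_ ^+ _); field.
have q8 : 8^-1 ^+ r = q ^+ 3 :> R by rewrite /q -exprM mulnC exprM; congr (_ ^+ _); field.
have q23 : 2^-1 ^+ (3 * r) = q ^+ 3 :> R by rewrite /q -exprM mulnC.
have qS : 2^-1 ^+ r.+1 = q / 2 :> R by rewrite exprSr.
have e2 : (r ^ 4 * 2 ^ r)%:R = r%:R ^+ 4 * q^-1 :> R by rewrite natrM rE natrX.
have e1 : (r ^ 4 * 2 ^ r).+1%:R = r%:R ^+ 4 * q^-1 + 1 :> R by rewrite -natr1 e2.
have e3 : (r ^ 4)%:R = r%:R ^+ 4 :> R by rewrite natrX.
rewrite /pbad q4 q8 q23 qS e1 e2 e3.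
have Kt0 := Kt_ge0 R; have K10 := K1_ge0 R; have K00 := sqr_ge0 (K0 R).
have r4 : 1 <= r%:R ^+ 4 :> R by rewrite exprn_ege1.
have r6 : r%:R ^+ 4 <= r%:R ^+ 6 :> R by rewrite ler_weXn2l.
have r62 : r%:R ^+ 4 * r%:R ^+ 2 = r%:R ^+ 6 :> R by rewrite -exprD.
have t1 : r%:R ^+ 4 * q^-1 * ((Kt R + 18 * r%:R ^+ 2 * K0 R ^+ 2) * q ^+ 3) <=
    (Kt R + 18 * K0 R ^+ 2) * r%:R ^+ 6 * q.
  have -> : r%:R ^+ 4 * q^-1 * ((Kt R + 18 * r%:R ^+ 2 * K0 R ^+ 2) * q ^+ 3) =
     (Kt R * r%:R ^+ 4 + 18 * K0 R ^+ 2 * (r%:R ^+ 4 * r%:R ^+ 2)) * q * q by field; rewrite gt_eqF.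
  rewrite r62 ler_pM2r//.
  apply: (@le_trans _ _ (Kt R * r%:R ^+ 4 + 18 * K0 R ^+ 2 * r%:R ^+ 6)).
    by rewrite ler_piMr// addr_ge0 ?mulr_ge0 ?exprn_ge0.
  by rewrite [leRHS]mulrDl lerD2r ler_wpM2l.
have t2 : (r%:R ^+ 4 * q^-1 + 1) * q ^+ 2 <= 2 * r%:R ^+ 6 * q.
  have -> : (r%:R ^+ 4 * q^-1 + 1) * q ^+ 2 = (r%:R ^+ 4 + q) * q by field; rewrite gt_eqF.
  by rewrite ler_pM2r//; lra.
have t3 : Kt R * q ^+ 3 <= Kt R * r%:R ^+ 6 * q.
  rewrite -mulrA ler_wpM2l// exprSr ler_pM2r//.
  apply: (@le_trans _ _ 1); first by rewrite exprn_ile1// ltW.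
  exact: le_trans r6.
have t4 : r%:R ^+ 4 * (K1 R * (q / 2)) <= K1 R * r%:R ^+ 6 * q.
  have -> : r%:R ^+ 4 * (K1 R * (q / 2)) = K1 R * (r%:R ^+ 4 / 2) * q by ring.
  rewrite ler_pM2r// ler_wpM2l//; lra.
apply: (le_trans (lerD (lerD (lerD t1 t2) t3) t4)).
by rewrite le_eqVlt; apply/orP; left; apply/eqP; rewrite /Cb; ring.
Qed.

(** [Jtr] is of order r^8, so the left side is polynomial of degree 17. *)
Lemma rbig_large : exists r1 : nat, forall r : nat, (r1 <= r)%N ->
  (3 * r * (Jtr r ^ 2 + 2) <= 2 ^ r)%N.
Proof.
pose A : R := 128 * 32 ^+ 2 + 1.
have A0 : 0 <= A by rewrite addr_ge0// mulr_ge0// exprn_ge0.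
have [r1 h1] := @poly_expR_small (3 * (A ^+ 2 + 2)) 2^-1 1 17 ltac:(by rewrite invr_gt0) ltr01.
exists (maxn 1 r1) => r; rewrite geq_max => /andP[r0 /h1 h].
have r1' : (1 : R) <= r%:R by rewrite ler1n.
rewrite -(ler_nat R) natrX.
have hJ : (Jtr r)%:R <= A * r%:R ^+ 8.
  have -> : A * r%:R ^+ 8 = 128 * (32 * r%:R ^+ 4) ^+ 2 + r%:R ^+ 8.
    by rewrite /A; move: (128 : R) (32 : R) (r%:R : R) => u v x; ring.
  rewrite /Jtr /Ltr natrD natrM natrX natrM natrX lerD2l.
  by apply: ler_eXnr.
apply: (@le_trans _ _ (3 * (A ^+ 2 + 2) * r%:R ^+ 17)).
  rewrite natrM natrM natrD natrX.
  have -> : 3 * (A ^+ 2 + 2) * r%:R ^+ 17 = 3 * r%:R * ((A * r%:R ^+ 8) ^+ 2 + 2 * r%:R ^+ 16).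
    by ring.
  rewrite ler_wpM2l ?mulr_ge0//; apply: lerD.
    by rewrite lerXn2r ?nnegrE// mulr_ge0// exprn_ge0.
  by rewrite ler_peMr// exprn_ege1.
have := half_pow_le r; rewrite exprVn => hq.
have p2 : (0 : R) < 2 ^+ r by rewrite exprn_gt0.
have X0 : 0 <= 3 * (A ^+ 2 + 2) * r%:R ^+ 17 :> R.
  by rewrite !mulr_ge0// ?exprn_ge0// addr_ge0// exprn_ge0.
have : 3 * (A ^+ 2 + 2) * r%:R ^+ 17 * (2 ^+ r)^-1 <= 1.
  by apply: le_trans h; rewrite ler_wpM2l.
by rewrite ler_pdivrMr// mul1r.
Qed.

(** Exponentials in r beat every power of r + 1, and (r + 1)^4 is at least n^(1/2) times the length
    of a quarter: the last bound becomes a power of that product. *)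
Lemma large_rank (e : R) (K : nat) : 0 < e <= 1 -> exists r1 : nat, forall r : nat, (r1 <= r)%N ->
  [/\ (50 <= r)%N, (3 * r * (Jtr r ^ 2 + 2) <= 2 ^ r)%N, ddl R r <= e,
    pbad R r + ddl R r <= c0 R / 2 &
    4 * pbad R r + 4 * (2 * r%:R * expR (- (e ^+ 2 * r%:R / 8))) <= (r.+1%:R ^+ K)^-1].
Proof.
move=> /andP[e0 e1]; have c00 := c0_gt0 R.
have h2 : (0 : R) < 2^-1 by rewrite invr_gt0.
have k0 : 0 < e ^+ 2 / 8 by rewrite divr_gt0// exprn_gt0.
have [ra ha] := rbig_large.
(* [pbad] and the two terms of [ddl] will each be at most eta: two of them fit in e, three in c0 /
   2. *)
pose eta := Num.min (e / 2) (c0 R / 6).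
have eta0 : 0 < eta by rewrite lt_min divr_gt0//= divr_gt0.
have [rb hb] := @poly_expR_small (4 * Cb) 2^-1 eta 7 h2 eta0.
have [rc hc] := @poly_expR_small (K1 R) 2^-1 eta 0 h2 eta0.
have [rd hd] := @poly_expR_small ((4 * Cb + 8) * 2 ^+ K) (e ^+ 2 / 8) 1 (6 + K) k0 ltr01.
exists (maxn 50 (maxn ra (maxn rb (maxn rc rd)))) => r.
rewrite !geq_max => /and5P[r50 /ha hra /hb hrb /hc hrc /hd hrd].
have r0 : (0 < r)%N by apply: leq_trans r50.
have r1 : (1 : R) <= r%:R by rewrite ler1n.
have pb := pbad_le r0.
set E := expR (- (2^-1 * r%:R)) in pb hrb hrc.
have E0 : 0 < E by exact: expR_gt0.
have hp : r%:R * (4 * pbad R r) <= eta.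
  apply: le_trans hrb; rewrite mulrCA.
  have -> : 4 * Cb * r%:R ^+ 7 * E = 4 * (r%:R * (Cb * r%:R ^+ 6 * E)) by ring.
  by rewrite ler_pM2l// ler_wpM2l.
have hk : K1 R * 2^-1 ^+ r <= eta.
  apply: le_trans hrc; rewrite expr0 mulr1 ler_wpM2l ?K1_ge0//; exact: half_pow_le.
have etae : eta <= e / 2 by rewrite ge_min lexx.
have etac : eta <= c0 R / 6 by rewrite ge_min lexx orbT.
have pbad0 : 0 <= pbad R r.
  have Kt0 := Kt_ge0 R; have K10 := K1_ge0 R.
  by rewrite /pbad !addr_ge0// ?mulr_ge0// ?addr_ge0// ?mulr_ge0// ?exprn_ge0// ?sqr_ge0.
have hpb : pbad R r <= eta.
  apply: le_trans hp; rewrite mulrCA; have : pbad R r <= r%:R * pbad R r by rewrite ler_peMl.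
  lra.
split => //.
- by rewrite /ddl; lra.
- by rewrite /ddl; lra.
have rK : (0 : R) < r.+1%:R ^+ K by rewrite exprn_gt0// ltr0n.
rewrite -[leRHS]mul1r ler_pdivlMr//; apply: le_trans hrd.
have -> : e ^+ 2 * r%:R / 8 = e ^+ 2 / 8 * r%:R by ring.
set F := expR (- (e ^+ 2 / 8 * r%:R)).
have F0 : 0 < F by exact: expR_gt0.
have EF : E <= F.
  rewrite ler_expR lerN2 ler_wpM2r//.
  have : e ^+ 2 <= 1 by rewrite exprn_ile1// ltW.
  lra.
have rp (j : nat) : (0 : R) <= r%:R ^+ j by rewrite exprn_ge0.
have -> : (4 * Cb + 8) * 2 ^+ K * r%:R ^+ (6 + K) * F =
    (4 * (Cb * r%:R ^+ 6 * F) + 4 * (2 * r%:R ^+ 6 * F)) * (2 * r%:R) ^+ K.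
  by rewrite exprD exprMn; ring.
apply: ler_pM => //.
- by rewrite addr_ge0 ?mulr_ge0// ltW.
- apply: lerD; rewrite ler_pM2l//.
    apply: (le_trans pb); rewrite ler_wpM2l// mulr_ge0 ?Cb_ge0//.
  by rewrite ler_pM2r// ler_pM2l// ler_eXnr.
- have r2 : (r.+1 <= 2 * r)%N by rewrite mul2n -addnn -addn1 leq_add2l.
  by rewrite lerXn2r ?nnegrE ?mulr_ge0// -natrM ler_nat.
Qed.

Lemma fourth_root (x : R) : 0 <= x -> exists r : nat, r%:R ^+ 4 <= x <= r.+1%:R ^+ 4.
Proof.
move=> x0.
have ex : exists r : nat, x <= r.+1%:R ^+ 4.
  have /andP[_ h] := truncn_itv x0; exists (Num.truncn x).
  by rewrite (le_trans (ltW h))// ler_eXnr// ler1n.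
have [] := ex_minnP ex => -[|r] hr rmin; first by exists 0%N; rewrite hr expr0n/= x0.
exists r.+1; rewrite hr andbT leNgt; apply/negP => /ltW /rmin.
by rewrite ltnn.
Qed.

End Asymptotics.

(** The constant depends on e and K only, so the intervals may vary with n; the free power K will be
    matched with the exponent k of the hypothesis on alpha. *)
Lemma exceptional_set (R : realType) (e : R) (K : nat) : 0 < e -> exists2 C : R, 0 <= C &
  forall (d : measure_display) (T : measurableType d) (P : probability T R)
    (n : nat) (a b : \bar R) (X : 'I_n.+1 -> T -> R),
  (0 < n)%N -> (a < b)%E -> gauss_iid P X ->
  exists E : set T, [/\ measurable E, pr P E <= C / (Num.sqrt n%:R * qlen a b) ^+ K &
    forall w, ~ E w -> `|(nzeros a b X w)%:R / fine (enz P a b X) - 1| <= e].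
Proof.
move=> e0; have c00 := c0_gt0 R.
(* [zeros_concentration] turns e' into 4 e' / c0, and [pr_devev] asks for e' <= 1. *)
pose e' := Num.min 1 (e * c0 R / 4).
have he' : 0 < e' <= 1.
  by rewrite lt_min ltr01/= ge_min lexx andbT divr_gt0// mulr_gt0.
have e'e : 4 * e' / c0 R <= e.
  by rewrite ler_pdivrMr// mulrC -ler_pdivlMr// ge_min lexx orbT.
have [r1 h1] := large_rank (4 * K) he'.
exists (r1.+1%:R ^+ (4 * K)); first by rewrite exprn_ge0.
move=> d T P n a b X n0 ab Xi.
have /andP[q0 _] := qlen_bounds ab.
set la := Num.sqrt n%:R * qlen a b.
have la0 : 0 < la by rewrite mulr_gt0// sqrtr_gt0 ltr0n.
have [r hr] := fourth_root (ltW la0).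
have laK : la ^+ K <= r.+1%:R ^+ (4 * K).
  by rewrite exprM lerXn2r ?nnegrE ?exprn_ge0 ?(ltW la0)//; case/andP: hr.
have laKp : 0 < la ^+ K by rewrite exprn_gt0.
case: (leqP r1 r) => [/h1[r50 rbig dle pdl prl]|rr1].
- exists (qexc P r a b X e'); split.
  + exact: measurable_qexc n0 Xi e'.
  + apply: (le_trans (pr_qexc n0 r50 ab hr Xi he')); apply: (le_trans prl).
    apply: (@le_trans _ _ (la ^+ K)^-1); first by rewrite lef_pV2 ?posrE// (lt_le_trans laKp).
    by rewrite ler_peMl ?invr_ge0 ?(ltW laKp)// exprn_ege1// ler1n.
  + move=> w nE; apply: le_trans e'e; case/andP: he' => e'0 _.
    exact: (zeros_concentration n0 r50 ab hr Xi rbig e'0 dle pdl nE).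
- (* finitely many ranks, absorbed by the constant *)
  exists setT; split => //; last by move=> w /(_ I).
  have -> : pr P setT = 1 by rewrite /pr probability_setT.
  rewrite ler_pdivlMr// mul1r; apply: (le_trans laK).
  rewrite lerXn2r ?nnegrE// ler_nat; exact: ltnW.
Qed.

Section Borel_Cantelli.
Context d (T : measurableType d) (R : realType) (P : probability T R).

Lemma ae_eventually_notin (E : nat -> set T) : (forall n, measurable (E n)) ->
  (\sum_(n <oo) P (E n) < +oo)%E ->
  {ae P, forall w, exists N : nat, forall n, (N <= n)%N -> ~ E n w}.
Proof.
move=> mE sE; exists (lim_sup_set E); split.
- by apply: bigcapT_measurable => n; exact: bigcup_measurable.
- exact: lim_sup_set_cvg0.
- move=> w /=; apply: contra_notP => nl.
  have [N hN] : exists N, ~ (\bigcup_(j >= N) E j) w.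
    apply: contrapT => h; apply: nl => N _; apply: contrapT => nN.
    by apply: h; exists N.
  by exists N => n Nn En; apply: hN; exists n.
Qed.

(** Countably many tolerances 1 / (p + 1) are enough, so that one null set serves them all. *)
Lemma ae_cvg_exceptional (Z : nat -> T -> R) (l : R) :
  (forall e, 0 < e -> exists E : nat -> set T, [/\ forall n, measurable (E n),
     (\sum_(n <oo) P (E n) < +oo)%E &
     forall n w, (0 < n)%N -> ~ E n w -> `|Z n w - l| <= e]) ->
  {ae P, forall w, (fun n => Z n w) @ \oo --> l}.
Proof.
move=> h.
have h' p : {ae P, forall w, exists N : nat, forall n, (N <= n)%N -> `|Z n w - l| <= p.+1%:R^-1}.
  have [E [mE sE hE]] := h p.+1%:R^-1 ltac:(by rewrite invr_gt0 ltr0n).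
  apply: filterS (ae_eventually_notin mE sE) => w [N hN].
  exists N.+1 => n Nn; apply: hE; first exact: leq_trans Nn.
  by apply: hN; exact: ltnW.
apply: filterS (ae_foralln h') => w hw; apply/cvgrPdist_le => e e0.
have ei : 0 < e^-1 by rewrite invr_gt0.
have /andP[_ te] := truncn_itv (ltW ei).
have [N hN] := hw (Num.truncn e^-1).
near=> n; rewrite distrC; apply: (@le_trans _ _ (Num.truncn e^-1).+1%:R^-1).
  by apply: hN; near: n; exact: nbhs_infty_ge.
by rewrite invf_ple ?posrE ?ltr0n// ltW// te// invr_gt0.
Unshelve. all: by end_near. Qed.

End Borel_Cantelli.

Section Alpha.
Variable R : realType.

(** The subtraction formula for the tangent. A positive cosine of the difference rules out 1 + a b =
    0 and the infinite values; the whole line has length pi and is excluded. *)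
Lemma tan_alpha (a b : \bar R) : (a < b)%E -> ang b - ang a <= pi / 4 ->
  alpha a b = (tan (ang b - ang a))%:E.
Proof.
move=> ab h4; have ba : 0 < ang b - ang a by rewrite subr_gt0 ang_homo.
have cp : 0 < cos (ang b - ang a) by rewrite cos_gt0_piquarter// ltW.
have pi0 := pi_gt0 R.
have cat x : 0 < cos (atan x) :> R by rewrite cos_gt0_pihalf// atan_gtNpi2 atan_ltpi2.
have sat x : sin (atan x) = x * cos (atan x) :> R.
  by have := atanK x; rewrite /tan => h; rewrite -{2}h divfK// gt_eqF.
case: a b ab ba h4 cp => [r||] [s||]//= _ ba h4.
- rewrite cosB mulrC -[X in _ + X]mulrC /tan sinB cosB.
  have cr := cat r; have cs := cat s.
  rewrite !sat => cp.
  have e : 0 < cos (atan r) * cos (atan s) * (1 + r * s).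
    by apply: lt_le_trans cp _; rewrite le_eqVlt; apply/orP; left; apply/eqP; ring.
  have d0 : 0 < 1 + r * s by move: e; rewrite pmulr_rgt0// mulr_gt0.
  rewrite ifF; last by apply/negP => /eqP e1; move: d0; rewrite e1 subrr ltxx.
  congr (_%:E).
  have -> : s * cos (atan s) * cos (atan r) - cos (atan s) * (r * cos (atan r)) =
    (s - r) * (cos (atan s) * cos (atan r)) by ring.
  have -> : cos (atan s) * cos (atan r) + s * cos (atan s) * (r * cos (atan r)) =
    (1 + r * s) * (cos (atan s) * cos (atan r)) by ring.
  move: (cos (atan s)) (cos (atan r)) cs cr => u v u0 v0.
  by field; rewrite !gt_eqF.
- move=> cp; have r0 : 0 < atan r by lra.
  have rp : 0 < r by rewrite ltNge; apply/negP => r0'; have := le_atan r0'; rewrite atan0; lra.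
  rewrite gt_eqF//; congr (_%:E).
  have e : pi / 2 - atan r = - atan r + pi / 2 by lra.
  rewrite e /tan sinDpihalf cosDpihalf cosN sinN opprK.
  by rewrite -[in LHS](atanK r) /tan invf_div.
- move=> cp; have r0 : atan s < 0 by lra.
  have sn : s < 0 by rewrite ltNge; apply/negP => r0'; have := le_atan r0'; rewrite atan0; lra.
  rewrite lt_eqF//; congr (_%:E).
  have e : atan s - - (pi / 2) = atan s + pi / 2 by lra.
  rewrite e /tan sinDpihalf cosDpihalf invrN mulrN; congr (- _).
  by rewrite -[in LHS](atanK s) /tan invf_div.
- by exfalso; lra.
Qed.

End Alpha.

Lemma elliptic_poly_ellp (R : realType) (c : nat -> R) (n : nat) :
  elliptic_poly c n = ellp (fun k : 'I_n.+1 => c k).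
Proof.
apply/polyP => i; rewrite !coef_poly; case: ltnP => // h.
by rewrite inordK.
Qed.

Lemma sum_inv_sqr (R : realType) : (\sum_(1 <= n <oo) ((n%:R ^+ 2)^-1 : R)%:E < +oo)%E.
Proof.
apply: (@le_lt_trans _ _ (2 : R)%:E); last exact: ltry.
apply: lime_le; first by apply: is_cvg_nneseries => n _ _; rewrite lee_fin invr_ge0 exprn_ge0.
apply: nearW => m; rewrite sumEFin lee_fin.
have h k : \sum_(1 <= n < k.+2) (n%:R ^+ 2)^-1 <= 2 - k.+1%:R^-1 :> R.
  elim: k => [|k IHk]; first by rewrite big_nat1 expr1n invr1; lra.
  rewrite big_nat_recr//=; apply: (le_trans (lerD IHk (lexx _))).
  have k0 : (0 : R) < k.+1%:R by rewrite ltr0n.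
  rewrite -[k.+2%:R]natr1; move: (k.+1%:R : R) k0 => x x0.
  rewrite -subr_ge0.
  have -> : 2 - (x + 1)^-1 - (2 - x^-1 + ((x + 1) ^+ 2)^-1) = (x * (x + 1) ^+ 2)^-1.
    by field; rewrite !gt_eqF// addr_gt0.
  by rewrite invr_ge0 mulr_ge0 ?exprn_ge0 ?addr_ge0// ltW.
case: m => [|[|m]]; [by rewrite big_geq|by rewrite big_geq|].
by apply: (le_trans (h m)); rewrite gerBl invr_ge0.
Qed.

(** * Summability of the exceptional probabilities and conclusion *)

Section Main.
Context (d : measure_display) (T : measurableType d) (R : realType) (P : probability T R).
Variables (omega : nat -> {RV P >-> R}) (a b : nat -> \bar R).
Hypothesis homega : iid_standard_normal omega.
Hypothesis hab : forall n, (1 <= n)%N -> (a n < b n)%E.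

Let X n : 'I_n.+1 -> T -> R := fun i => omega i.

(** One summable sequence [G] covers both alternatives of the theorem: it is 0 when alpha is never
    positive, and the given series otherwise. *)
Variables (k : R) (G : nat -> \bar R).
Hypothesis k0 : 0 < k.
Hypothesis G0 : forall n, (0 <= G n)%E.
Hypothesis sG : (\sum_(1 <= n <oo) G n < +oo)%E.
Hypothesis alphaG : forall n, (1 <= n)%N -> forall al : R, 0 < al ->
  alpha_seq a b n = al%:E -> G n = (al `^ (- k))%:E.

(** For Theta <= pi / 4, alpha_n is at most 8 n^(1/2) times the quarter length, so the bound is at
    most C 8^K alpha_n^-k when alpha_n >= 1; when alpha_n < 1, alpha_n^-k exceeds any probability,
    whence the 1 in [D]. For Theta > pi / 4 a quarter is longer than 1/8, and K >= 4 gives a term of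
    order n^-2. *)
Lemma sum_exceptional (C : R) (K : nat) (E : nat -> set T) : 0 <= C -> (4 <= K)%N -> k <= K%:R ->
  E 0%N = set0 -> (forall n, measurable (E n)) ->
  (forall n, (0 < n)%N -> pr P (E n) <= C / (Num.sqrt n%:R * qlen (a n) (b n)) ^+ K) ->
  (\sum_(n <oo) P (E n) < +oo)%E.
Proof.
move=> C0 K4 kK E0 mE hE; pose D : R := 1 + C * 8 ^+ K.
have C8 : 0 <= C * 8 ^+ K by rewrite mulr_ge0// exprn_ge0.
have D0 : 0 <= D by rewrite addr_ge0.
have I0 n : (0 <= (((n%:R : R) ^+ 2)^-1)%:E)%E by rewrite lee_fin invr_ge0 exprn_ge0.
have bound n : (P (E n) <= D%:E * (G n + (((n%:R : R) ^+ 2)^-1)%:E))%E.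
  case: n => [|n']; first by rewrite E0 measure0 mule_ge0// ?adde_ge0.
  set n := n'.+1; have n0 : (0 < n)%N by [].
  rewrite prE//; have p1 := pr_le1 P (mE n); have := hE n n0.
  have ab := hab n0; have /andP[q0 _] := qlen_bounds ab.
  set q := qlen _ _ in q0 *; set sn := Num.sqrt n%:R.
  have sn1 : 1 <= sn by rewrite -sqrtr1 ler_wsqrtr// ler1n.
  have sn0 : 0 < sn by apply: lt_le_trans sn1.
  have la0 : 0 < sn * q by rewrite mulr_gt0.
  have [h4|h4] := leP (ang (b n) - ang (a n)) (pi / 4).
    have q4 : ang (b n) - ang (a n) = 4 * q by rewrite /q /qlen; field.
    have hT : 0 <= 4 * q <= pi / 4 by rewrite -q4 h4 q4 mulr_ge0// ltW.
    have /andP[x1 x2] := tan_bounds hT.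
    have aE := tan_alpha ab h4; rewrite q4 in aE; move: (tan _) x1 x2 aE => x x1 x2 aE.
    have x0 : 0 < x by apply: lt_le_trans x1; rewrite mulr_gt0.
    have al0 : 0 < sn * x by rewrite mulr_gt0.
    have alE : alpha_seq a b n = (sn * x)%:E by rewrite /alpha_seq aE.
    rewrite (alphaG n0 al0 alE); set al := sn * x in al0 alE *.
    have al8 : al <= 8 * (sn * q).
      rewrite mulrCA /al ler_pM2l//; lra.
    move=> hp; rewrite -EFinD -EFinM lee_fin.
    apply: (@le_trans _ _ (D * al `^ (- k))); last first.
      by rewrite ler_wpM2l// lerDl invr_ge0 exprn_ge0.
    rewrite powRN; have [a1|a1] := ltP al 1.
      have pk : 0 < al `^ k by rewrite powR_gt0.
      apply: (le_trans p1); rewrite ler_pdivlMr// mul1r.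
      apply: (@le_trans _ _ 1); last by rewrite lerDl.
      have := @ge0_ler_powR _ k (ltW k0) al 1; rewrite powR1; apply; rewrite ?nnegrE ?ltW//.
    apply: (le_trans hp).
    have ak : al `^ k <= al ^+ K by rewrite -powR_mulrn ?(ltW al0)// ler_powR.
    have pk : 0 < al `^ k by rewrite powR_gt0.
    apply: (@le_trans _ _ (C * 8 ^+ K / al `^ k)); last first.
      by rewrite ler_wpM2r ?invr_ge0 ?(ltW pk)// lerDr.
    rewrite -mulrA ler_wpM2l// ler_pdivlMr// mulrC ler_pdivrMr ?exprn_gt0//.
    apply: (le_trans ak); rewrite -exprMn.
    have al0' := ltW al0; have la8 : 0 <= 8 * (sn * q) by rewrite mulr_ge0// ltW.
    by rewrite lerXn2r ?nnegrE.
  move=> hp; apply: (@le_trans _ _ (D%:E * (((n%:R : R) ^+ 2)^-1)%:E)%E); last first.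
    by apply: lee_wpmul2l; [rewrite lee_fin|rewrite leeDr].
  rewrite -EFinM lee_fin; apply: (le_trans hp).
  have q8 : 8^-1 <= q by rewrite /q /qlen; have := pi_ge2 R; lra.
  have nn : (n%:R : R) ^+ 2 = sn ^+ 4 by rewrite (exprM _ 2 2) sqr_sqrtr.
  rewrite nn; apply: (@le_trans _ _ (C * 8 ^+ K / sn ^+ 4)); last first.
    by rewrite ler_wpM2r ?invr_ge0 ?exprn_ge0 ?(ltW sn0)// lerDr.
  rewrite -mulrA ler_wpM2l// ler_pdivlMr ?exprn_gt0// mulrC ler_pdivrMr ?exprn_gt0//.
  rewrite -exprMn; apply: (@le_trans _ _ (sn ^+ K)); first by rewrite ler_weXn2l.
  have sn0' := ltW sn0; have la8 : 0 <= 8 * (sn * q) by rewrite mulr_ge0// ltW.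
  rewrite lerXn2r ?nnegrE// mulrCA ler_peMr//; lra.
have P0 n : (0 <= P (E n))%E by exact: measure_ge0.
rewrite (nneseries_recl (fun n _ => P0 n) isT) E0 measure0 add0e.
apply: (@le_lt_trans _ _ (\sum_(1 <= n <oo) (D%:E * (G n + (((n%:R : R) ^+ 2)^-1)%:E)))%E).
  by apply: lee_nneseries.
rewrite nneseriesZl; last by move=> n _; rewrite adde_ge0.
rewrite nneseriesD//; apply: lte_mul_pinfty => //.
by apply: lte_add_pinfty => //; exact: sum_inv_sqr.
Qed.

Lemma zeros_ratio_cvg :
  {ae P, forall w, (fun n => (nzeros (a n) (b n) (@X n) w)%:R / fine (enz P (a n) (b n) (@X n))) @ \oo --> (1 : R)}.
Proof.
apply: ae_cvg_exceptional => e e0.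
(* At least 4 for the series of n^-2, at least k for the series [G]. *)
pose K := maxn 4 (Num.truncn k).+1.
have kK : k <= K%:R.
  have /andP[_ h] := truncn_itv (ltW k0); rewrite (le_trans (ltW h))// ler_nat leq_maxr//.
have [C C0 hC] := exceptional_set K e0.
have ex n : exists E : set T, [/\ measurable E, n = 0%N -> E = set0,
    (0 < n)%N -> pr P E <= C / (Num.sqrt n%:R * qlen (a n) (b n)) ^+ K &
    (0 < n)%N -> forall w, ~ E w ->
      `|(nzeros (a n) (b n) (@X n) w)%:R / fine (enz P (a n) (b n) (@X n)) - 1| <= e].
  case: n => [|n]; first by exists set0.
  have [E [mE pE hE]] := hC d T P n.+1 (a n.+1) (b n.+1) (@X n.+1) (ltn0Sn n) (hab (ltn0Sn n)) (iid_gauss _ homega).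
  by exists E.
have [E hE] := choice ex; exists E; split.
- by move=> n; case: (hE n).
- apply: (@sum_exceptional C K) => //.
  + exact: leq_maxl.
  + by case: (hE 0%N) => _ ->.
  + by move=> n; case: (hE n).
  + by move=> n n0; case: (hE n) => _ _ /(_ n0).
- by move=> n w n0 nE; case: (hE n) => _ _ _ /(_ n0); apply.
Qed.

End Main.

Theorem theorem1p10 (d : measure_display) (T : measurableType d) (R : realType)
    (P : probability T R) (omega : nat -> {RV P >-> R})
    (homega : iid_standard_normal omega)
    (a b : nat -> \bar R)
    (hab : forall n, (1 <= n)%N -> (a n < b n)%E)
    (halpha :
      (forall n, (1 <= n)%N -> (alpha_seq a b n <= 0)%E) \/
      ((forall n, (1 <= n)%N -> (0 < alpha_seq a b n)%E) /\
       exists2 k : R, 0 < k &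
         (\sum_(1 <= n <oo) inv_power (alpha_seq a b n) k < +oo)%E)) :
  let N (n : nat) (w : T) : R :=
    (nb_real_zeros (elliptic_poly (fun j => omega j w) n) (a n) (b n))%:R in
  {ae P, forall w, (fun n => N n w / fine 'E_P[N n]) @ \oo --> (1 : R)}.
Proof.
move=> N; pose X n : 'I_n.+1 -> T -> R := fun i => omega i.
have NE : N = (fun n w => (nzeros (a n) (b n) (X n) w)%:R).
  apply/funext => n; apply/funext => w; by rewrite /N elliptic_poly_ellp.
have [k [G [k0 G0 sG alphaG]]] : exists (k : R) (G : nat -> \bar R),
    [/\ 0 < k, forall n, (0 <= G n)%E, (\sum_(1 <= n <oo) G n < +oo)%E &
     forall n, (1 <= n)%N -> forall al : R, 0 < al ->
       alpha_seq a b n = al%:E -> G n = (al `^ (- k))%:E].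
  case: halpha => [hneg|[hpos [k k0 sk]]].
    (* Here every Theta exceeds pi / 4, and the condition relating [G] to positive values of alpha
       is vacuous. *)
    exists 1, (fun=> 0%E); split => //; first by rewrite eseries0.
    by move=> n n1 al al0 e; have := hneg n n1; rewrite e lee_fin leNgt al0.
  exists k, (fun n => inv_power (alpha_seq a b n) k); split => //.
  - move=> n; rewrite /inv_power; case: (alpha_seq a b n) => // r.
    by rewrite lee_fin powR_ge0.
  - by move=> n n1 al al0 ->.
have h := zeros_ratio_cvg homega hab k0 G0 sG alphaG.
by rewrite NE.
Qed.
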